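(* Let $M=\mathbb{T}^2$. The rate $\langle t\rangle^{-\frac{\beta+2}{\beta+3}}$ is sharp for every $\beta\in(-1,\infty)$ in the class of damping functions $W(x,y)=\sum_{j=1}^nW_j(x)$, $W_j\in X^\beta_{\theta_j}$: for every $\beta\in(-1,\infty)$ there is a $W$ in this class such that for all $C,\epsilon>0$ there exist $t_0>0$ and initial data $(u_0,u_1)\in\mathcal{D}$ for which the solution $u$ of $(\partial_t^2-\Delta+W\partial_t)u=0$, $(u,\partial_tu)|_{t=0}=(u_0,u_1)$, satisfies $$E(u,t_0)^{1/2}>C\langle t_0\rangle^{-\frac{\beta+2}{\beta+3}-\epsilon}\left(\|\nabla u_0\|_{L^2}+\|u_1\|_{H^1}+\|-\Delta u_0+Wu_1\|_{L^2}\right).$$ Indeed, for $\beta\in(-1,0)$ this holds for the explicit damping $W(x,y)=\mathbf{1}_{|x|\ge\frac{\pi}{2}}\left((|x|-\tfrac{\pi}{2})^\beta+1\right)$, where $x\in[-\pi,\pi)$.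
   Context: $\mathbb{T}^2=\mathbb{S}^1_x\times\mathbb{S}^1_y$ is the flat torus, $\mathbb{S}^1=\mathbb{R}/2\pi\mathbb{Z}$, and $\langle t\rangle=(1+t^2)^{1/2}$. Polynomially controlled functions: fix $\theta\in\mathbb{S}^1$ and parametrize $\mathbb{S}^1$ by $x\in[-\pi,\pi)$ (ends identified) so that the point $\theta$ corresponds to $x=0$. $X^\beta_\theta$ is the set of measurable functions $f$ on $\mathbb{S}^1$ for which there are $C_0>0$ and $\sigma\in(0,\pi)$ with $C_0^{-1}V^\beta(x)\le f(x)\le C_0V^\beta(x)$ (for almost every $x$), where $V^\beta(x)=0$ for $|x|\le\sigma$ and $V^\beta(x)=(|x|-\sigma)^\beta$ for $\sigma<|x|\le\pi$. Admissible initial data: $\mathcal{D}=\{(u_0,u_1)\in H^1(M)\times H^1(M): -\Delta u_0+Wu_1\in L^2(M)\}$. Energy: $E(u,t)=\frac12\int_M|\nabla u|^2+|\partial_tu|^2\,dx$. Solutions are understood through the strongly continuous semigroup $e^{t\mathcal{A}}$ on $H^1(M)\times L^2(M)$ generated by $\mathcal{A}(u,v)=(v,\Delta u-Wv)$ with domain $\mathcal{D}$: $(u(t),\partial_tu(t))=e^{t\mathcal{A}}(u_0,u_1)$. *)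

(* Defs.v *)
From HB Require Import structures.
From mathcomp Require Import all_boot all_order all_algebra.
From mathcomp Require Import all_classical all_reals all_analysis.
From mathcomp Require Import complex.

Set Implicit Arguments.
Unset Strict Implicit.
Unset Printing Implicit Defensive.

Import Order.TTheory GRing.Theory Num.Theory.
Import numFieldNormedType.Exports.

Local Open Scope classical_set_scope.
Local Open Scope ring_scope.

(* The torus (R / 2 pi Z)^2 is identified with its fundamental domain
   [-pi, pi)^2.  A complex-valued function on the torus is represented by a
   function on R * R of which only the values on [-pi, pi)^2 matter, and an
   element of L^2 or H^1 by any of its representatives modulo a.e. equality.
   Periodicity enters through the test functions. *)
Section Torus.
Variable R : realType.
Implicit Types (f g u v : R * R -> R[i]) (phi W : R * R -> R) (e : R * R).

Definition torus : set (R * R) := `[- pi, pi[ `*` `[- pi, pi[.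

Definition area := (@lebesgue_measure R \x @lebesgue_measure R)%E.

Definition sqabs (z : R[i]) : R := complex.Re z ^+ 2 + complex.Im z ^+ 2.

Definition cint f : R[i] :=
  Complex (\int[area]_(p in torus) complex.Re (f p))
          (\int[area]_(p in torus) complex.Im (f p)).

Definition L1 f : Prop :=
  area.-integrable torus (fun p => (complex.Re (f p))%:E) /\
  area.-integrable torus (fun p => (complex.Im (f p))%:E).

Definition L2 f : Prop :=
  [/\ measurable_fun torus (fun p => complex.Re (f p)),
      measurable_fun torus (fun p => complex.Im (f p)) &
      (\int[area]_(p in torus) (sqabs (f p))%:E < +oo)%E].

Definition normL2 f : R := Num.sqrt (\int[area]_(p in torus) sqabs (f p)).

Definition dir_x : R * R := (1, 0).
Definition dir_y : R * R := (0, 1).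

Fixpoint Ck (k : nat) phi : Prop :=
  continuous phi /\
  if k is k'.+1 then
    [/\ forall p, derivable phi p dir_x, forall p, derivable phi p dir_y,
        Ck k' (fun p => 'D_dir_x phi p) & Ck k' (fun p => 'D_dir_y phi p)]
  else True.

Definition test_function phi : Prop :=
  (forall k, Ck k phi) /\
  forall x y, phi (x + 2 * pi, y) = phi (x, y) /\
              phi (x, y + 2 * pi) = phi (x, y).

Definition laplacian phi (p : R * R) : R :=
  'D_dir_x (fun q => 'D_dir_x phi q) p + 'D_dir_y (fun q => 'D_dir_y phi q) p.

Definition weak_partial e u g : Prop :=
  forall phi, test_function phi ->
    cint (fun p => ('D_e phi p)%:C%C * u p) =
    - cint (fun p => (phi p)%:C%C * g p).

Definition H1 u : Prop :=
  [/\ L2 u, exists2 g, L2 g & weak_partial dir_x u g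
          & exists2 g, L2 g & weak_partial dir_y u g].

(* For u in H^1 this is the weak derivative, which is unique a.e. *)
Definition partial e u : R * R -> R[i] :=
  xget (fun=> 0) [set g | L2 g /\ weak_partial e u g].

Definition sqgrad u (p : R * R) : R :=
  sqabs (partial dir_x u p) + sqabs (partial dir_y u p).

Definition norm_grad u : R := Num.sqrt (\int[area]_(p in torus) sqgrad u p).

Definition normH1 u : R := Num.sqrt (normL2 u ^+ 2 + norm_grad u ^+ 2).

(* The distribution - Delta u + W v is the function g.  The integrability of
   W v, which makes it a distribution, is automatic for v in H^1 and W in
   [damping_class] below. *)
Definition represents_damped_laplacian W u v g : Prop :=
  L1 (fun p => (W p)%:C%C * v p) /\
  forall phi, test_function phi ->
    cint (fun p => - ((laplacian phi p)%:C%C * u p)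
                   + (phi p)%:C%C * ((W p)%:C%C * v p)) =
    cint (fun p => (phi p)%:C%C * g p).

Definition damped_laplacian W u v : R * R -> R[i] :=
  xget (fun=> 0) [set g | L2 g /\ represents_damped_laplacian W u v g].

Definition state : Type := (R * R -> R[i]) * (R * R -> R[i]).
Implicit Types U V : state.

Definition in_energy_space U : Prop := H1 U.1 /\ L2 U.2.

Definition scale_state (c : R[i]) U : state :=
  (fun p => c * U.1 p, fun p => c * U.2 p).

Definition sub_state U V : state :=
  (fun p => U.1 p - V.1 p, fun p => U.2 p - V.2 p).

Definition add_state U V : state :=
  (fun p => U.1 p + V.1 p, fun p => U.2 p + V.2 p).

Definition eq_state U V : Prop :=
  ae_eq area torus U.1 V.1 /\ ae_eq area torus U.2 V.2.

Definition norm_state U : R := Num.sqrt (normH1 U.1 ^+ 2 + normL2 U.2 ^+ 2).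

Definition domain W U : Prop :=
  [/\ H1 U.1, H1 U.2 &
      exists2 g, L2 g & represents_damped_laplacian W U.1 U.2 g].

Definition generator W U : state :=
  (U.2, fun p => - damped_laplacian W U.1 U.2 p).

(* S acts on representatives; linearity and boundedness make it compatible
   with a.e. equality, so that it induces operators on H^1 x L^2. *)
Definition C0_semigroup (S : R -> state -> state) : Prop :=
  [/\ forall t, 0 <= t ->
        [/\ forall U, in_energy_space U -> in_energy_space (S t U),
            forall (c : R[i]) U V, in_energy_space U -> in_energy_space V ->
              eq_state (S t (add_state (scale_state c U) V))
                       (add_state (scale_state c (S t U)) (S t V)) &
            exists B : R, forall U, in_energy_space U ->
              norm_state (S t U) <= B * norm_state U],
      forall U, in_energy_space U -> eq_state (S 0 U) U,
      forall s t U, 0 <= s -> 0 <= t -> in_energy_space U ->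
        eq_state (S (s + t) U) (S s (S t U)) &
      forall U, in_energy_space U ->
        norm_state (sub_state (S t U) U) @[t --> 0^'+] --> (0 : R)].

Definition generated_by W (S : R -> state -> state) : Prop :=
  forall U V, in_energy_space U -> in_energy_space V ->
    norm_state (sub_state (scale_state (h^-1)%:C%C (sub_state (S h U) U)) V)
      @[h --> 0^'+] --> (0 : R)
    <-> domain W U /\ eq_state V (generator W U).

Definition energy U : R :=
  2^-1 * \int[area]_(p in torus) (sqgrad U.1 p + sqabs (U.2 p)).

Definition bracket (t : R) : R := Num.sqrt (1 + t ^+ 2).

Definition Vctrl (beta sigma x : R) : R :=
  if `|x| <= sigma then 0 else (`|x| - sigma) `^ beta.

(* Functions on the circle are 2 pi-periodic functions on the line, and x is
   the coordinate in which the point theta is the origin. *)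
Definition polynomially_controlled (beta theta : R) (w : R -> R) : Prop :=
  [/\ measurable_fun setT w,
      forall x, w (x + 2 * pi) = w x &
      exists C0 sigma : R, [/\ 0 < C0, 0 < sigma, sigma < pi &
        {ae @lebesgue_measure R, forall x, - pi <= x < pi ->
           C0^-1 * Vctrl beta sigma x <= w (theta + x)
             <= C0 * Vctrl beta sigma x}]].

Definition damping_class (beta : R) W : Prop :=
  exists (n : nat) (theta : 'I_n.+1 -> R) (w : 'I_n.+1 -> R -> R),
    (forall j, polynomially_controlled beta (theta j) (w j)) /\
    forall p, W p = \sum_(j < n.+1) w j p.1.

(* The solution with data (u0, u1) is t |-> S t (u0, u1), S being the C0
   semigroup (unique modulo a.e. equality) with generator (u, v) |->
   (v, Delta u - W v) on [domain W]. *)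
Definition rate_sharp (beta : R) W : Prop :=
  forall S, C0_semigroup S -> generated_by W S ->
  forall C eps : R, 0 < C -> 0 < eps ->
  exists (t0 : R) (u0 u1 : R * R -> R[i]),
    [/\ 0 < t0, domain W (u0, u1) &
        Num.sqrt (energy (S t0 (u0, u1))) >
        C * bracket t0 `^ (- ((beta + 2) / (beta + 3)) - eps)
          * (norm_grad u0 + normH1 u1 + normL2 (damped_laplacian W u0 u1))].

(* The representative in [-pi, pi) of x modulo 2 pi. *)
Definition wrap (x : R) : R :=
  x - 2 * pi * (Num.floor ((x + pi) / (2 * pi)))%:~R.

Definition explicit_damping (beta : R) (p : R * R) : R :=
  if pi / 2 <= `|wrap p.1| then (`|wrap p.1| - pi / 2) `^ beta + 1 else 0.

End Torus.

(* Main.v *)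
Require Import Defs.
From mathcomp Require Import all_boot all_order all_algebra.
From mathcomp Require Import all_classical all_reals all_analysis.
From mathcomp Require Import measurable_realfun complex ring lra.

Set Implicit Arguments.
Unset Strict Implicit.
Unset Printing Implicit Defensive.

Import Order.TTheory GRing.Theory Num.Theory.
Import numFieldNormedType.Exports.

Local Open Scope classical_set_scope.
Local Open Scope ring_scope.

(** Why the rate is sharp. The damping W depends on s = |x| - pi / 2 only: it
    vanishes for s < 0 and behaves like s ^ beta for small s > 0. Waves
    cos(x) cos(k y) of frequency lam = sqrt (k^2 + 1), concentrated in the
    undamped strip, have a wavelength of order one in the x direction, and they
    enter the damped region through a boundary layer whose width h balances the
    strength lam h ^ beta of the damping in it, that is, lam h ^ (beta + 2) = 1.
    On the torus one has to wait a time k / h for the layer to absorb such a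
    wave, and k / h = k ^ ((beta + 3) / (beta + 2)) while the graph norm exceeds
    the energy norm by a factor k: this is the rate
    (beta + 2) / (beta + 3).

    The proof works by duality, with no quasimode in the domain of the
    generator A. Gluing the cosine to the boundary layer gives a profile f which
    satisfies f'' + f = i lam w f up to an error eta of size h
    ([layer_solution], [profile_exists]); here w is a continuous truncation of
    the damping ([damp]). The energy pairing Phi with the mode f(x) cos(k y) is
    a linear functional on states, bounded by the energy norm with a constant of
    order k, and integration by parts gives Phi (A X) = i lam Phi (X) up to
    eta times the energy norm of X ([pairing_generator]), and up to the
    truncation error, which vanishes in the limit on a given state
    ([damp_tail]). Thus |Phi| changes slowly along an orbit; rather than
    differentiating it, the orbit is followed by Euler steps, whose remainders
    are controlled in the graph norm since the data lie in the domain of A^2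
    ([quotient_graph], [euler_step]).

    Suppose that all data in the domain decay at a rate t ^ -g times their graph
    norm. The data of [data0], supported in the undamped strip, have graph norm
    of order k^2 and satisfy |Phi| >= c k^2 ([pairing_data0]). Along the orbit
    up to time T this gives [rate_inequality], which after division by k^2 reads
      c <= A (k T ^ -g + h T ^ (1 - g)),   h <= k ^ (- 1 / (beta + 2)).
    For g > (beta + 2) / (beta + 3) the choice of a suitable power of k for T
    makes the right-hand side tend to zero ([no_such_rate]).

    The first claim is proved with the control function itself, centred at x = 0
    and vanishing for |x| <= pi / 2. For beta < 0 the explicit damping adds 1 to
    it where it is positive, and is covered by the same argument. *)

(** * Derivatives and primitives *)

Section DerivationRules.
Context {R : realType}.
Implicit Types (f g : R -> R) (x c df dg : R).

Lemma derD f g x df dg : is_derive x 1 f df -> is_derive x 1 g dg ->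
  is_derive x 1 (fun y => f y + g y) (df + dg).
Proof. by move=> ? ?; apply: is_deriveD. Qed.

Lemma derB f g x df dg : is_derive x 1 f df -> is_derive x 1 g dg ->
  is_derive x 1 (fun y => f y - g y) (df - dg).
Proof. by move=> ? ?; apply: is_deriveB. Qed.

Lemma derN f x df : is_derive x 1 f df -> is_derive x 1 (fun y => - f y) (- df).
Proof. by move=> ?; apply: is_deriveN. Qed.

Lemma derM f g x df dg : is_derive x 1 f df -> is_derive x 1 g dg ->
  is_derive x 1 (fun y => f y * g y) (df * g x + f x * dg).
Proof.
move=> h1 h2; have := @is_deriveM R R f g x 1 df dg h1 h2.
move=> h; apply: (is_derive_eq h); rewrite /GRing.scale /=.
by rewrite addrC; congr (_ + _); rewrite mulrC.
Qed.

Lemma derc c x : is_derive x 1 (fun=> c) (0 : R).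
Proof. exact: is_derive_cst. Qed.

Lemma derid x : is_derive x 1 (fun y => y) (1 : R).
Proof. exact: is_derive_id. Qed.

Lemma derZ c f x df : is_derive x 1 f df -> is_derive x 1 (fun y => c * f y) (c * df).
Proof.
by move=> h; apply: (is_derive_eq (derM (derc c x) h)); rewrite mul0r add0r.
Qed.

Lemma derC f g x df dg : is_derive (g x) 1 f df -> is_derive x 1 g dg ->
  is_derive x 1 (fun y => f (g y)) (df * dg).
Proof. by move=> ? ?; apply: (@is_derive1_comp R f g). Qed.

Lemma der_eq f x df dg : is_derive x 1 f df -> df = dg -> is_derive x 1 f dg.
Proof. by move=> ? <-. Qed.

Lemma der_val f x df : is_derive x 1 f df -> 'D_1 f x = df.
Proof. by case. Qed.

End DerivationRules.

Section Primitives.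
Context {R : realType}.
Implicit Types (f g F G : R -> R) (a b c x y : R).

Lemma is_derive_continuous f g : (forall x, is_derive x 1 f (g x)) -> continuous f.
Proof.
move=> h x; apply/differentiable_continuous/derivable1_diffP.
by have [] := h x.
Qed.

Lemma mean_value f g a b : a <= b ->
  (forall x, a < x < b -> is_derive x 1 f (g x)) ->
  {within `[a, b], continuous f} ->
  exists2 c, a <= c <= b & f b - f a = g c * (b - a).
Proof.
move=> ab h cf.
have h' x : x \in `]a, b[ -> is_derive x 1 f (g x) by rewrite in_itv; exact: h.
have [c cab e] := MVT_segment ab h' cf.
by exists c => //; move: cab; rewrite in_itv.
Qed.

Lemma mean_valueT f g a b : a <= b -> (forall x, is_derive x 1 f (g x)) ->
  exists2 c, a <= c <= b & f b - f a = g c * (b - a).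
Proof.
move=> ab h; apply: (@mean_value f g) => //.
exact/continuous_subspaceT/(is_derive_continuous h).
Qed.

Lemma incr_of_derive f g a b : (forall x, is_derive x 1 f (g x)) -> a <= b ->
  (forall x, a <= x <= b -> 0 <= g x) -> f a <= f b.
Proof.
move=> h ab g0; have [c cab e] := mean_valueT ab h.
by rewrite -subr_ge0 e mulr_ge0 ?subr_ge0 ?g0.
Qed.

Lemma decr_of_derive f g a b : (forall x, is_derive x 1 f (g x)) -> a <= b ->
  (forall x, a <= x <= b -> g x <= 0) -> f b <= f a.
Proof.
move=> h ab g0; have [c cab e] := mean_valueT ab h.
by rewrite -subr_le0 e mulr_le0_ge0 ?subr_ge0 ?g0.
Qed.

Lemma derive0_cst f : (forall x, is_derive x 1 f 0) -> forall x y, f x = f y.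
Proof. by move=> h x y; apply: is_derive_0_is_cst. Qed.

Let mu := @lebesgue_measure R.

Lemma right_primitive g a : continuous g ->
  exists F, forall x, a < x -> is_derive x 1 F (g x).
Proof.
move=> cg; exists (fun x => \int[mu]_(t in [set` `[a, x]]) g t) => x ax.
have ig : mu.-integrable `[a, x + 1] (EFin \o g).
  by apply: continuous_compact_integrable; [exact: segment_compact|
    exact: continuous_subspaceT].
have [] := @continuous_FTC1_closed R g a x (x + 1) _ ig ax (cg x).
  by rewrite ltrDl.
by move=> d e; apply: (DeriveDef d); rewrite -derive1E.
Qed.

Lemma left_primitive g b : continuous g ->
  exists F, forall x, x < b -> is_derive x 1 F (g x).
Proof.
move=> cg; have cg' : continuous (fun x => - g (- x)).
  move=> x; apply: continuousN; apply: continuous_comp; last exact: cg.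
  exact: opp_continuous.
have [F hF] := right_primitive (- b) cg'.
exists (fun x => F (- x)) => x xb.
have h : is_derive (- x) 1 F (- g (- - x)) by apply: hF; rewrite ltrN2.
have hN : is_derive x 1 (-%R : R -> R) (-1) by exact: is_deriveNid.
have := @is_derive1_comp R F (-%R) x _ _ h hN.
by rewrite opprK mulNr mulrN opprK mulr1.
Qed.

(** The fundamental theorem of calculus yields a primitive to the right of a
    base point and, by reflection, one to the left of another; they are glued
    across an interval on which they differ by a constant. *)
Lemma primitive_exists g c : continuous g ->
  exists G, (forall x, is_derive x 1 G (g x)) /\ G c = 0.
Proof.
move=> cg; have [A hA] := right_primitive (c - 1) cg.
have [B hB] := left_primitive c cg.
pose m := c - 1/2.
pose K := A m - B m.
have AB x : c - 1 < x < c -> A x = B x + K.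
  move=> /andP[x1 x2].
  suff H y z : c - 1 < y -> y <= z -> z < c -> A z - B z = A y - B y.
    rewrite /K -[A x](subrK (B x)) addrC; congr (_ + _).
    have m1 : c - 1 < m by rewrite /m; lra.
    have m2 : m < c by rewrite /m; lra.
    by have [xm|/ltW mx] := leP x m; [rewrite (H x m)|rewrite (H m x)].
  move=> y1 yz zc.
  have dd t : c - 1 < t -> t < c -> is_derive t 1 (A \- B) (g t - g t).
    move=> t1 t2; have h1 := hA t t1; have h2 := hB t t2.
    exact: is_deriveB.
  have dd' t : y < t < z -> is_derive t 1 (A \- B) (g t - g t).
    by move=> /andP[? ?]; apply: dd; lra.
  have [|w _ /=] := mean_value yz dd'.
  - apply: continuous_in_subspaceT => t; rewrite inE /= in_itv /= => /andP[? ?].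
    by apply/differentiable_continuous/derivable1_diffP;
      have [] := dd t ltac:(lra) ltac:(lra).
  - by rewrite subrr mul0r => /eqP; rewrite subr_eq0 => /eqP.
pose G := fun x => if m < x then A x else B x + K.
have GA x : c - 1 < x -> G x = A x.
  move=> h; rewrite /G; case: ltP => // xm; rewrite AB // h /=.
  by move: xm; rewrite /m; lra.
have GB x : x < c -> G x = B x + K.
  move=> h; rewrite /G; case: ltP => // xm; rewrite AB // h andbT.
  by move: xm; rewrite /m; lra.
have hG x : is_derive x 1 G (g x).
  have [h|h] := ltP (c - 1) x.
  - apply: (@near_eq_is_derive _ _ _ A G).
    + near=> z; apply/esym/GA; near: z; exact: lt_nbhsr.
    + exact: hA.
  - have hx : x < c by lra.
    apply: (@near_eq_is_derive _ _ _ (fun x => B x + K) G).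
    + near=> z; apply/esym/GB; near: z; exact: lt_nbhsl.
    + have hb := hB x hx.
      have hk := @is_derive_cst R R R K x 1.
      by have := @is_deriveD R R R B (cst K) x 1 _ _ hb hk; rewrite addr0.
exists (fun x => G x - G c); split; last by rewrite subrr.
move=> x; have hk := @is_derive_cst R R R (G c) x 1.
by have := @is_deriveB R R R G (cst (G c)) x 1 _ _ (hG x) hk; rewrite subr0.
Unshelve. all: by end_near. Qed.

End Primitives.

(** * A linear differential equation *)

Section LinearODE.
Context {R : realType}.
Implicit Types (f g h a b : R -> R) (x r c : R).

(** The intervals u n -+ 2 c / 2 ^ n are nested. *)
Lemma geometric_cvg (u : nat -> R) c :
  (forall n, `|u n.+1 - u n| <= c * 2^-1 ^+ n) ->
  exists l, forall n, `|u n - l| <= 2 * c * 2^-1 ^+ n.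
Proof.
move=> h; pose t n := 2 * c * 2^-1 ^+ n : R.
have tS n : t n.+1 = t n - c * 2^-1 ^+ n by rewrite /t exprS; field.
have lo n m : u n - t n <= u (n + m)%N - t (n + m)%N.
  elim: m => [|m]; first by rewrite addn0.
  move=> /le_trans; apply; rewrite addnS tS.
  by have := h (n + m)%N; rewrite ler_norml => /andP[]; lra.
have hi n m : u (n + m)%N + t (n + m)%N <= u n + t n.
  elim: m => [|m]; first by rewrite addn0.
  apply: le_trans; rewrite addnS tS.
  by have := h (n + m)%N; rewrite ler_norml => /andP[]; lra.
have t0 n : 0 <= t n.
  have := h n; have := normr_ge0 (u n.+1 - u n).
  by move=> + /[dup] => /le_trans /[apply]; rewrite /t; lra.
have lohi n m : u n - t n <= u m + t m.
  have := lo n m; have := hi m n; rewrite addnC.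
  by have := t0 (n + m)%N; lra.
pose A := [set u n - t n | n in setT].
have A0 : A !=set0 by exists (u 0%N - t 0%N), 0%N.
exists (sup A) => n; rewrite ler_distlC; apply/andP; split.
  by apply: ub_le_sup; [exists (u 0%N + t 0%N) => _ [m _ <-]|exists n].
by apply: ge_sup => // _ [m _ <-]; exact: lohi.
Qed.

Lemma half_small (x c : R) : 0 <= c -> 0 < x -> exists n, c * 2^-1 ^+ n < x.
Proof.
move=> c0 x0; have [n hn] : exists n : nat, c / x < n%:R.
  have := archi_boundP (divr_ge0 c0 (ltW x0)); by exists (Num.bound (c / x)).
exists n; rewrite exprVn ltr_pdivrMr ?exprn_gt0// mulrC.
rewrite -ltr_pdivrMr//; apply: (lt_le_trans hn).
have : (n < 2 ^ n)%N by rewrite ltn_expl.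
by move=> /ltnW; rewrite -(ler_nat R) natrX.
Qed.

Lemma eq_of_half x y c : (forall n, `|x - y| <= c * 2^-1 ^+ n) -> x = y.
Proof.
move=> h; apply/eqP; rewrite -subr_eq0 -normr_eq0 eq_le normr_ge0 andbT.
rewrite leNgt; apply/negP => p.
have c0 : 0 <= c by have := h 0%N; rewrite expr0 mulr1; apply: le_trans.
by have [n] := half_small c0 p; rewrite ltNge h.
Qed.

Lemma convex_ge h h1 h2 : (forall r, is_derive r 1 h (h1 r)) ->
  (forall r, is_derive r 1 h1 (h2 r)) -> (forall r, 0 <= h2 r) -> h1 0 = 0 ->
  forall r, h 0 <= h r.
Proof.
move=> d1 d2 p2 z r; have [r0|/ltW r0] := leP 0 r.
  apply: (incr_of_derive d1) => // x /andP[x0 _].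
  by rewrite -z; apply: (incr_of_derive d2).
apply: (decr_of_derive d1) => // x /andP[_ x0].
by rewrite -z; apply: (incr_of_derive d2).
Qed.

(** Chosen once and for all, so that Picard iterates below are functions. *)
Definition double_primitive g : R -> R :=
  xget (fun=> 0) [set G | exists G1, [/\ forall r, is_derive r 1 G (G1 r),
    forall r, is_derive r 1 G1 (g r), G 0 = 0 & G1 0 = 0]].

Lemma double_primitiveP g : continuous g -> exists G1,
  [/\ forall r, is_derive r 1 (double_primitive g) (G1 r),
    forall r, is_derive r 1 G1 (g r), double_primitive g 0 = 0 & G1 0 = 0].
Proof.
move=> cg; rewrite /double_primitive; case: xgetP => [G _ //|nG].
exfalso; have [G1 [d1 z1]] := primitive_exists 0 cg.
have [G [d z]] := primitive_exists 0 (is_derive_continuous d1).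
by apply: (nG G); exists G1.
Qed.

Section Weight.
Variable k : R.
Hypothesis k0 : 0 < k.

(** Up to a factor this is cosh (k r): its second derivative is k ^ 2 times
    itself, so that the double primitive contracts by k ^ -2 the norm weighted
    by it, on the whole line. *)
Definition weight r := expR (k * r) + expR (- (k * r)).

Lemma weight_der r : is_derive r 1 weight (k * (expR (k * r) - expR (- (k * r)))).
Proof.
have hl := derZ k (derid r).
have h1 := derC (is_derive_expR (k * r)) hl.
have h2 := @derC _ expR (fun y => - (k * y)) r _ _ (is_derive_expR _) (derN hl).
by apply: (der_eq (derD h1 h2)); ring.
Qed.

Lemma weight_der2 r :
  is_derive r 1 (fun r => k * (expR (k * r) - expR (- (k * r)))) (k ^+ 2 * weight r).
Proof.
have hl := derZ k (derid r).
have h1 := derC (is_derive_expR (k * r)) hl.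
have h2 := @derC _ expR (fun y => - (k * y)) r _ _ (is_derive_expR _) (derN hl).
by apply: (der_eq (derZ k (derB h1 h2))); rewrite /weight; ring.
Qed.

Lemma weight_ge1 r : 1 <= weight r.
Proof.
rewrite /weight; have [h|h] := leP 0 r.
  have : 1 <= expR (k * r) by rewrite -expR0 ler_expR mulr_ge0// ltW.
  by have := expR_ge0 (- (k * r)); lra.
have : 1 <= expR (- (k * r)).
  by rewrite -expR0 ler_expR -mulrN mulr_ge0 ?ltW// oppr_gt0.
by have := expR_ge0 (k * r); lra.
Qed.

(** Both functions c weight -+ (F - G), with F and G the double primitives, are
    convex and critical at 0, where they are non-negative. *)
Lemma double_primitive_bound f g c : continuous f -> continuous g -> 0 <= c ->
  (forall r, `|f r - g r| <= k ^+ 2 * c * weight r) ->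
  forall r, `|double_primitive f r - double_primitive g r| <= c * weight r.
Proof.
move=> cf cg c0 h r.
have [f1 [f1d f2d f0 f10]] := double_primitiveP cf.
have [g1 [g1d g2d g0 g10]] := double_primitiveP cg.
have key (s : R) : s = 1 \/ s = -1 ->
    0 <= c * weight r + s * (double_primitive f r - double_primitive g r).
  move=> hs.
  have d1 x := derD (derZ c (weight_der x)) (derZ s (derB (f1d x) (g1d x))).
  have d2 x := derD (derZ c (weight_der2 x)) (derZ s (derB (f2d x) (g2d x))).
  have p2 x : 0 <= c * (k ^+ 2 * weight x) + s * (f x - g x).
    have := h x; rewrite ler_norml => /andP[].
    by case: hs => ->; rewrite ?mul1r ?mulN1r; lra.
  have z : c * (k * (expR (k * 0) - expR (- (k * 0)))) + s * (f1 0 - g1 0) = 0.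
    by rewrite f10 g10 subrr !mulr0 oppr0 subrr !mulr0 addr0.
  apply: le_trans (convex_ge d1 d2 p2 z r).
  rewrite f0 g0 subrr mulr0 addr0; apply: mulr_ge0 => //.
  exact: le_trans ler01 (weight_ge1 0).
rewrite ler_norml; have := key 1 (or_introl erefl).
by have := key (-1) (or_intror erefl); lra.
Qed.

End Weight.

Lemma continuousMf f g : continuous f -> continuous g -> continuous (fun x => f x * g x).
Proof. by move=> cf cg x; apply: continuousM; [exact: cf|exact: cg]. Qed.

Lemma continuousZf c f : continuous f -> continuous (fun x => c * f x).
Proof. by move=> cf; apply: continuousMf => // x; exact: cst_continuous. Qed.

Lemma double_primitive_continuous g : continuous g -> continuous (double_primitive g).
Proof. by move=> /double_primitiveP[G1 [d _ _ _]]; exact: (is_derive_continuous d). Qed.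

Lemma weighted_limit_continuous k (u : nat -> R -> R) f c : 0 <= c ->
  (forall n, continuous (u n)) ->
  (forall n r, `|u n r - f r| <= c * 2^-1 ^+ n * weight k r) -> continuous f.
Proof.
move=> c0 cu h x; apply/cvgrPdist_lt => e e0.
have cw := is_derive_continuous (weight_der k).
pose M := weight k x + 1.
have M0 : 0 < M by rewrite /M /weight ltr_wpDl// addr_ge0// expR_ge0.
have [n hn] : exists n, c * M * 2^-1 ^+ n < e / 3.
  by apply: half_small; [rewrite mulr_ge0// ltW|rewrite divr_gt0].
have c1 := cu n x; move/cvgrPdist_lt : c1 => /(_ (e / 3)) c1.
have c2 := cw x; move/cvgrPdist_lt : c2 => /(_ 1 ltr01) c2.
near=> y.
have hy : `|u n x - u n y| < e / 3.
  by near: y; apply: c1; rewrite divr_gt0.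
have wy : `|weight k x - weight k y| < 1 by near: y; exact: c2.
have wM : weight k y <= M by move: wy; rewrite ltr_norml /M => /andP[]; lra.
have wM' : weight k x <= M by rewrite /M; lra.
have c2n : 0 <= c * 2^-1 ^+ n by rewrite mulr_ge0// exprn_ge0.
have bx := le_trans (h n x) (ler_wpM2l c2n wM').
have by_ := le_trans (h n y) (ler_wpM2l c2n wM).
have e1 : c * 2^-1 ^+ n * M < e / 3 by rewrite mulrAC.
move: hy bx by_; rewrite ltr_norml !ler_norml => /andP[? ?] /andP[? ?] /andP[? ?].
by rewrite ltr_norml; apply/andP; split; lra.
Unshelve. all: by end_near. Qed.

Section Picard.
Variables (om : R -> R) (L : R).
Hypotheses (com : continuous om) (L0 : 0 <= L) (omL : forall r, `|om r| <= L).

(* With k ^ 2 = 2 (L + 1) one iteration halves weighted distances. *)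
Let k := Num.sqrt (2 * (L + 1)).
Let k0 : 0 < k. Proof. by rewrite sqrtr_gt0 mulr_gt0// ltr_wpDl. Qed.
Let k2 : k ^+ 2 = 2 * (L + 1).
Proof. by rewrite sqr_sqrtr// mulr_ge0// addr_ge0. Qed.

Fixpoint picard n : (R -> R) * (R -> R) :=
  if n is n'.+1 then
    (fun r => 1 + double_primitive (fun x => - 1 * (om x * (picard n').2 x)) r,
     double_primitive (fun x => om x * (picard n').1 x))
  else (fun=> 0, fun=> 0).

Let cpicard n : continuous (picard n).1 /\ continuous (picard n).2.
Proof.
elim: n => [|n [c1 c2]] /=; first by split=> x; exact: cst_continuous.
split; last by apply: double_primitive_continuous; exact: continuousMf.
move=> x; apply: continuousD; first exact: cst_continuous.
by apply: double_primitive_continuous; apply: continuousZf; exact: continuousMf.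
Qed.

Let step f g c : continuous f -> continuous g -> 0 <= c ->
  (forall r, `|f r - g r| <= c * weight k r) ->
  (forall r, `|double_primitive (fun x => om x * f x) r -
     double_primitive (fun x => om x * g x) r| <= c / 2 * weight k r) /\
  (forall r, `|double_primitive (fun x => - 1 * (om x * f x)) r -
     double_primitive (fun x => - 1 * (om x * g x)) r| <= c / 2 * weight k r).
Proof.
move=> cf cg c0 h.
have c20 : 0 <= c / 2 by rewrite divr_ge0.
have b r : L * (c * weight k r) <= k ^+ 2 * (c / 2) * weight k r.
  rewrite k2; have : 0 <= c * weight k r.
    by apply: mulr_ge0 => //; exact: le_trans ler01 (weight_ge1 k0 r).
  by move=> ?; rewrite (_ : _ * _ * _ = (L + 1) * (c * weight k r)); [lra|field].
have h' r : `|om r * f r - om r * g r| <= k ^+ 2 * (c / 2) * weight k r.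
  rewrite -mulrBr normrM; apply: (le_trans _ (b r)).
  by apply: ler_pM.
split; apply: double_primitive_bound => //; try exact: continuousMf;
  try by apply: continuousZf; exact: continuousMf.
by move=> r; rewrite !mulN1r opprK -normrN opprD opprK; exact: h'.
Qed.

Let diff n : (forall r, `|(picard n.+1).1 r - (picard n).1 r| <= 2^-1 ^+ n * weight k r) /\
  (forall r, `|(picard n.+1).2 r - (picard n).2 r| <= 2^-1 ^+ n * weight k r).
Proof.
elim: n => [|n [i1 i2]].
  have c0 : continuous (fun x : R => om x * 0) by apply: continuousMf => // x; exact: cst_continuous.
  have c1 : continuous (fun x : R => -1 * (om x * 0)) by exact: continuousZf.
  have z1 r : double_primitive (fun x => om x * 0) r = 0.
    have [G [d1 d2 z1 z2]] := double_primitiveP c0.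
    have d2' x : is_derive x 1 G 0 by apply: (der_eq (d2 x)); rewrite mulr0.
    have d1' x : is_derive x 1 (double_primitive (fun x => om x * 0)) 0.
      by apply: (der_eq (d1 x)); rewrite (derive0_cst d2' x 0).
    by rewrite (derive0_cst d1' r 0).
  have z2 r : double_primitive (fun x => -1 * (om x * 0)) r = 0.
    have [G [d1 d2 z1' z2]] := double_primitiveP c1.
    have d2' x : is_derive x 1 G 0 by apply: (der_eq (d2 x)); rewrite !mulr0.
    have d1' x : is_derive x 1 (double_primitive (fun x => -1 * (om x * 0))) 0.
      by apply: (der_eq (d1 x)); rewrite (derive0_cst d2' x 0).
    by rewrite (derive0_cst d1' r 0).
  split=> r /=; rewrite ?z1 ?z2 expr0 mul1r; have := weight_ge1 k0 r.
    by rewrite addr0 subr0 normr1.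
  by rewrite subr0 normr0 => /(le_trans _); apply.
have [c1 c2] := cpicard n; have [c1' c2'] := cpicard n.+1.
have p : 0 <= 2^-1 ^+ n :> R by rewrite exprn_ge0.
have [s1 _] := step c1' c1 p i1; have [_ s2] := step c2' c2 p i2.
have e3 : 2^-1 ^+ n.+1 = 2^-1 ^+ n / 2 :> R by rewrite exprS mulrC.
split=> r; rewrite e3.
  have e (P Q : R) : 1 + P - (1 + Q) = P - Q by ring.
  by rewrite [X in `|X|]e; exact: s2.
exact: s1.
Qed.

(** The complex equation f'' = i om f for f = a + i b, with f(0) = 1 and
    f'(0) = 0: the Picard iterates converge in the weighted norm. *)
Lemma linear_ode : exists a b a1 b1 : R -> R,
  [/\ forall r, is_derive r 1 a (a1 r), forall r, is_derive r 1 b (b1 r),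
      forall r, is_derive r 1 a1 (- (om r * b r)),
      forall r, is_derive r 1 b1 (om r * a r) &
      [/\ a 0 = 1, b 0 = 0, a1 0 = 0 & b1 0 = 0]].
Proof.
have ea r : exists l, forall n, `|(picard n).1 r - l| <= 2 * weight k r * 2^-1 ^+ n.
  by apply: geometric_cvg => n; rewrite mulrC; exact: (diff n).1.
have eb r : exists l, forall n, `|(picard n).2 r - l| <= 2 * weight k r * 2^-1 ^+ n.
  by apply: geometric_cvg => n; rewrite mulrC; exact: (diff n).2.
have [a ha] := choice ea; have [b hb] := choice eb.
have ha' n r : `|(picard n).1 r - a r| <= 2 * 2^-1 ^+ n * weight k r.
  by rewrite mulrAC; exact: ha.
have hb' n r : `|(picard n).2 r - b r| <= 2 * 2^-1 ^+ n * weight k r.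
  by rewrite mulrAC; exact: hb.
have ca : continuous a.
  by apply: (weighted_limit_continuous _ _ ha') => // n; exact: (cpicard n).1.
have cb : continuous b.
  by apply: (weighted_limit_continuous _ _ hb') => // n; exact: (cpicard n).2.
have p n : 0 <= 2 * 2^-1 ^+ n :> R by rewrite mulr_ge0// exprn_ge0.
have Ea r : a r = 1 + double_primitive (fun x => -1 * (om x * b x)) r.
  apply: (@eq_of_half _ _ (2 * weight k r)) => n.
  have [_ s] := step (cpicard n).2 cb (p n) (hb' n).
  have := s r; have := ha r n.+1; rewrite /= exprS.
  set P := double_primitive _ r; set Q := double_primitive _ r.
  rewrite !ler_norml => /andP[? ?] /andP[? ?]; apply/andP; split; lra.
have Eb r : b r = double_primitive (fun x => om x * a x) r.
  apply: (@eq_of_half _ _ (2 * weight k r)) => n.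
  have [s _] := step (cpicard n).1 ca (p n) (ha' n).
  have := s r; have := hb r n.+1; rewrite /= exprS.
  set P := double_primitive _ r; set Q := double_primitive _ r.
  rewrite !ler_norml => /andP[? ?] /andP[? ?]; apply/andP; split; lra.
have cA : continuous (fun x => -1 * (om x * b x)) by apply: continuousZf; exact: continuousMf.
have cB : continuous (fun x => om x * a x) by exact: continuousMf.
have [a1 [da da1 a0 a10]] := double_primitiveP cA.
have [b1 [db db1 b0 b10]] := double_primitiveP cB.
have aE : a = (fun r => 1 + double_primitive (fun x => -1 * (om x * b x)) r) by apply/funext.
have bE : b = double_primitive (fun x => om x * a x) by apply/funext.
exists a, b, a1, b1; split.
- by move=> r; rewrite aE; apply: (der_eq (derD (derc 1 r) (da r))); rewrite add0r.
- by move=> r; rewrite bE; exact: db.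
- by move=> r; apply: (der_eq (da1 r)); rewrite mulN1r.
- by [].
- by split => //; [rewrite Ea a0 addr0|rewrite Eb].
Qed.

End Picard.
End LinearODE.

(** * The boundary layer *)

Section Layer.
Context {R : realType}.
Implicit Types (s t x r h m lam l : R).

(** The boundary layer: e = a + i b solves e'' = i lam w e on [0, l] with
    e' = -1 at the entrance and e' = 0 at the end. It is the solution started
    from the end, divided by its slope at the entrance; that slope is not zero
    because Im (conj e e') is monotone and increases where w > 0.

    The size of e(0): |e|^2 is convex and critical at l, hence decreases, and
    its slope at 0 is -2 Re e(0). So if |e(0)| >= 4 h, then |e|^2 stays above
    |e(0)|^2 / 2 on [0, h], and between h / 2 and h, where w >= m,
    Im (conj e e') grows by lam m h |e(0)|^2 / 4 at least; but it starts from
    Im e(0) and ends below 0. *)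
Lemma layer_solution (w : R -> R) (L l lam h m : R) :
  continuous w -> (forall s, 0 <= w s) -> (forall s, w s <= L) ->
  0 < lam -> 0 < h -> h <= l -> 0 < m -> (forall s, h / 2 <= s <= h -> m <= w s) ->
  exists a b a1 b1 : R -> R,
  [/\ (forall s, is_derive s 1 a (a1 s)) /\ (forall s, is_derive s 1 b (b1 s)),
      (forall s, is_derive s 1 a1 (- (lam * w s * b s))) /\
      (forall s, is_derive s 1 b1 (lam * w s * a s)),
      [/\ a1 0 = -1, b1 0 = 0, a1 l = 0 & b1 l = 0],
      0 <= a 0 /\ (forall s, 0 <= s <= l ->
        a s ^+ 2 + b s ^+ 2 <= a 0 ^+ 2 + b 0 ^+ 2 /\
        a1 s ^+ 2 + b1 s ^+ 2 <= 1) &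
      forall eta, 0 <= eta -> eta ^+ 2 = a 0 ^+ 2 + b 0 ^+ 2 ->
        4 * h <= eta -> lam * m * h * eta <= 4].
Proof.
move=> cw w0 wL lam0 h0 hl m0 wm.
have l0 : 0 < l by exact: lt_le_trans hl.
have L0 : 0 <= L by exact: le_trans (w0 0) (wL 0).
have dl x : is_derive x 1 (fun r => l - r) (-1 : R).
  by apply: (der_eq (derB (derc l x) (derid x))); rewrite sub0r.
pose om r := lam * w (l - r).
have com : continuous om.
  apply: continuousZf => x; apply: (@continuous_comp _ _ _ (fun r => l - r)) => //.
    exact: (is_derive_continuous dl).
  exact: cw.
have omL r : `|om r| <= lam * L.
  by rewrite ger0_norm ?mulr_ge0 ?w0 ?ler_wpM2l ?(ltW lam0).
have [y [z [y1 [z1 [dy dz dy1 dz1 [y0 z0 y10 z10]]]]]] :=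
  linear_ode com (mulr_ge0 (ltW lam0) L0) omL.
(* The squared modulus of y + i z is convex with a critical point at 0. *)
pose N r := y r ^+ 2 + z r ^+ 2.
have dN r : is_derive r 1 N (2 * (y r * y1 r + z r * z1 r)).
  apply: (der_eq (derD (derM (dy r) (dy r)) (derM (dz r) (dz r)))); ring.
have dN1 r : is_derive r 1 (fun r => 2 * (y r * y1 r + z r * z1 r))
    (2 * (y1 r ^+ 2 + z1 r ^+ 2)).
  apply: (der_eq (derZ 2 (derD (derM (dy r) (dy1 r)) (derM (dz r) (dz1 r))))); ring.
have N1 r : 1 <= N r.
  have -> : 1 = N 0 by rewrite /N y0 z0 expr1n expr0n addr0.
  apply: (convex_ge dN dN1) => [x|]; first by rewrite mulr_ge0// addr_ge0// sqr_ge0.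
  by rewrite y10 z10 !mulr0 addr0 mulr0.
(* K is Im (conj f f') for f = y + i z; it will show that f' does not vanish at l. *)
pose K r := y r * z1 r - z r * y1 r.
have dK r : is_derive r 1 K (om r * N r).
  apply: (der_eq (derB (derM (dy r) (dz1 r)) (derM (dz r) (dy1 r)))).
  by rewrite /N; ring.
have Kge0 r : 0 <= om r * N r.
  by rewrite mulr_ge0 ?(le_trans ler01 (N1 r))// mulr_ge0 ?w0 ?ltW.
have Kl : 0 < K l.
  have K0 : K 0 = 0 by rewrite /K y10 z10 !mulr0 subrr.
  have i1 : K 0 <= K (l - h) by apply: (incr_of_derive dK); rewrite ?subr_ge0.
  have i2 : K (l - h / 2) <= K l.
    by apply: (incr_of_derive dK) => //; rewrite gerBl divr_ge0 ?ltW.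
  have lh : l - h <= l - h / 2 by lra.
  have [c /andP[c1 c2] e] := mean_valueT lh dK.
  have : 0 < om c * N c * (l - h / 2 - (l - h)).
    apply: mulr_gt0; last by lra.
    apply: mulr_gt0; last exact: lt_le_trans (N1 c).
    by apply: mulr_gt0 => //; apply: lt_le_trans (wm _ _); rewrite //; lra.
  by rewrite -e; lra.
pose D := y1 l ^+ 2 + z1 l ^+ 2.
have D0 : 0 < D.
  rewrite lt_def addr_ge0 ?sqr_ge0// andbT paddr_eq0 ?sqr_ge0// !sqrf_eq0.
  apply/negP => /andP[/eqP y1l /eqP z1l].
  by move: Kl; rewrite /K y1l z1l !mulr0 subrr ltxx.
have DN : D != 0 by exact: lt0r_neq0.
(* p + i q is the inverse of f'(l), and e(s) = (p + i q) f(l - s). *)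
pose p := y1 l / D; pose q := - z1 l / D.
have pq1 : p * y1 l - q * z1 l = 1 by rewrite /p /q /D; field.
have pq0 : p * z1 l + q * y1 l = 0 by rewrite /p /q; field.
pose a s := p * y (l - s) - q * z (l - s).
pose b s := p * z (l - s) + q * y (l - s).
pose a1 s := - (p * y1 (l - s) - q * z1 (l - s)).
pose b1 s := - (p * z1 (l - s) + q * y1 (l - s)).
have ly s := @derC _ y (fun s => l - s) s _ _ (dy (l - s)) (dl s).
have lz s := @derC _ z (fun s => l - s) s _ _ (dz (l - s)) (dl s).
have ly1 s := @derC _ y1 (fun s => l - s) s _ _ (dy1 (l - s)) (dl s).
have lz1 s := @derC _ z1 (fun s => l - s) s _ _ (dz1 (l - s)) (dl s).
have da s : is_derive s 1 a (a1 s).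
  by apply: (der_eq (derB (derZ p (ly s)) (derZ q (lz s)))); rewrite /a1; ring.
have db s : is_derive s 1 b (b1 s).
  by apply: (der_eq (derD (derZ p (lz s)) (derZ q (ly s)))); rewrite /b1; ring.
have omw s : om (l - s) = lam * w s by rewrite /om subKr.
have da1 s : is_derive s 1 a1 (- (lam * w s * b s)).
  apply: (der_eq (derN (derB (derZ p (ly1 s)) (derZ q (lz1 s))))).
  by rewrite omw /b; ring.
have db1 s : is_derive s 1 b1 (lam * w s * a s).
  apply: (der_eq (derN (derD (derZ p (lz1 s)) (derZ q (ly1 s))))).
  by rewrite omw /a; ring.
have a10 : a1 0 = -1 by rewrite /a1 subr0 pq1.
have b10 : b1 0 = 0 by rewrite /b1 subr0 pq0 oppr0.
have a1l : a1 l = 0 by rewrite /a1 subrr y10 z10 !mulr0 subrr oppr0.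
have b1l : b1 l = 0 by rewrite /b1 subrr y10 z10 !mulr0 addr0 oppr0.
pose P s := a s ^+ 2 + b s ^+ 2.
pose P1 s := 2 * (a s * a1 s + b s * b1 s).
have dP s : is_derive s 1 P (P1 s).
  apply: (der_eq (derD (derM (da s) (da s)) (derM (db s) (db s)))).
  by rewrite /P1; ring.
have dP1 s : is_derive s 1 P1 (2 * (a1 s ^+ 2 + b1 s ^+ 2)).
  apply: (der_eq (derZ 2 (derD (derM (da s) (da1 s)) (derM (db s) (db1 s))))); ring.
have P1incr s t : s <= t -> P1 s <= P1 t.
  by move=> st; apply: (incr_of_derive dP1) => // x _;
    rewrite mulr_ge0// addr_ge0// sqr_ge0.
have P1le0 s : s <= l -> P1 s <= 0.
  by move=> /P1incr; rewrite {2}/P1 a1l b1l !mulr0 addr0 mulr0.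
have P10 : P1 0 = - 2 * a 0 by rewrite /P1 a10 b10; ring.
have a0 : 0 <= a 0 by have := P1le0 0 (ltW l0); rewrite P10; lra.
(* J is Im (conj e e'), which is non-positive since it increases to 0. *)
pose J s := a s * b1 s - b s * a1 s.
have dJ s : is_derive s 1 J (lam * w s * P s).
  apply: (der_eq (derB (derM (da s) (db1 s)) (derM (db s) (da1 s)))).
  by rewrite /P; ring.
have P0 s : 0 <= P s by rewrite addr_ge0// sqr_ge0.
have J0 s : 0 <= lam * w s * P s by rewrite !mulr_ge0// ltW.
have Jincr s t : s <= t -> J s <= J t by move=> st; exact: (incr_of_derive dJ).
have Jl : J l = 0 by rewrite /J a1l b1l !mulr0 subrr.
have Jle0 s : s <= l -> J s <= 0 by move=> /Jincr; rewrite Jl.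
have JE0 : J 0 = b 0 by rewrite /J a10 b10; ring.
pose Q s := a1 s ^+ 2 + b1 s ^+ 2.
have dQ s : is_derive s 1 Q (2 * (lam * w s) * J s).
  apply: (der_eq (derD (derM (da1 s) (da1 s)) (derM (db1 s) (db1 s)))).
  by rewrite /J; ring.
exists a, b, a1, b1; split => //.
  split=> // s /andP[s0 sl]; split.
    apply: (decr_of_derive dP) => // x /andP[_ xs]; apply: P1le0; lra.
  have -> : 1 = Q 0 by rewrite /Q a10 b10; ring.
  apply: (decr_of_derive dQ) => // x /andP[x0 xs].
  apply: mulr_ge0_le0; first by rewrite mulr_ge0// mulr_ge0// ltW.
  by apply: Jle0; lra.
move=> eta eta0 etaE heta.
have PE : P 0 = eta ^+ 2 by rewrite etaE.
have a0e : a 0 <= eta.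
  rewrite -(@ler_pXn2r _ 2)// ?nnegrE//; have := sqr_ge0 (b 0); lra.
have b0e : - b 0 <= eta.
  have [|bn] := leP (- b 0) 0; first by lra.
  rewrite -(@ler_pXn2r _ 2)// ?nnegrE//; last by lra.
  by rewrite sqrrN; have := sqr_ge0 (a 0); lra.
have eta_pos : 0 < eta by lra.
have Plow s : 0 <= s -> s <= h -> eta ^+ 2 / 2 <= P s.
  move=> s0 sh; have [c /andP[c0 cs] e] := mean_valueT s0 dP.
  have := P1incr 0 c c0; rewrite P10 => hc.
  have h1 : - 2 * eta <= P1 c by lra.
  have h2 : - 2 * eta * s <= P1 c * s by rewrite ler_wpM2r.
  have h3 : eta * s <= eta * h by rewrite ler_wpM2l.
  have h4 : eta * (4 * h) <= eta * eta by rewrite ler_wpM2l.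
  by move: e; rewrite subr0 PE; lra.
have h2h : h / 2 <= h by lra.
have [c /andP[c1 c2] e] := mean_valueT h2h dJ.
have i1 : J 0 <= J (h / 2) by apply: Jincr; lra.
have i2 : J h <= 0 by exact: Jle0.
have low : lam * m * (eta ^+ 2 / 2) <= lam * w c * P c.
  apply: ler_pM => //.
  - by rewrite mulr_ge0// ltW.
  - by rewrite divr_ge0// sqr_ge0.
  - by rewrite ler_wpM2l ?(ltW lam0) ?wm ?c1.
  - by apply: Plow; lra.
have low2 : lam * m * (eta ^+ 2 / 2) * (h - h / 2) <= eta.
  apply: (@le_trans _ _ (lam * w c * P c * (h - h / 2))).
    by rewrite ler_wpM2r//; lra.
  by rewrite -e; lra.
by rewrite -(ler_pM2r eta_pos); move: low2; lra.
Qed.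

End Layer.

(** * Approximation by trigonometric polynomials *)

Section Weierstrass.
Context {R : realType}.
Implicit Types (x y e : R) (g : nat -> R).

(** The Bernstein polynomial of degree n with values g 0, ..., g n, by de
    Casteljau's recursion, along which positivity and moments are proved. *)
Fixpoint bernstein n g : {poly R} :=
  if n is n'.+1 then
    (1 - 'X) * bernstein n' g + 'X * bernstein n' (fun k => g k.+1)
  else (g 0%N)%:P.

Lemma bernsteinS n g x : (bernstein n.+1 g).[x] =
  (1 - x) * (bernstein n g).[x] + x * (bernstein n (fun k => g k.+1)).[x].
Proof. by rewrite /= hornerD !hornerM hornerD hornerN !hornerX hornerC. Qed.

Lemma bernstein_le n g g' x : 0 <= x <= 1 -> (forall k, g k <= g' k) ->
  (bernstein n g).[x] <= (bernstein n g').[x].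
Proof.
move=> /andP[x0 x1]; elim: n g g' => [|n IH] g g' gg'.
  by rewrite /= !hornerC.
by rewrite !bernsteinS lerD// ler_wpM2l ?subr_ge0//; apply: IH.
Qed.

Lemma bernstein_affine n (c d : R) g x :
  (bernstein n (fun k => c + d * g k)).[x] = c + d * (bernstein n g).[x].
Proof.
elim: n g => [|n IH] g; first by rewrite /= !hornerC.
by rewrite !bernsteinS !IH; ring.
Qed.

Lemma bernstein_variance n (c : R) x :
  (bernstein n (fun k => (k%:R - c) ^+ 2)).[x] =
  n%:R * (x * (1 - x)) + (n%:R * x - c) ^+ 2.
Proof.
elim: n c => [|n IH] c; first by rewrite /= hornerC; ring.
have E : (fun k : nat => (k.+1%:R - c) ^+ 2) = (fun k : nat => (k%:R - (c - 1)) ^+ 2).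
  by apply/funext => k; rewrite -natr1; congr (_ ^+ 2); ring.
by rewrite bernsteinS E !IH -natr1; ring.
Qed.

(** By uniform continuity and boundedness |f x - f y| is at most
    e / 2 + K (x - y)^2, and the Bernstein polynomials average the second term
    to K x (1 - x) / n. *)
Lemma weierstrass (f : R -> R) (M e : R) : continuous f -> (forall x, `|f x| <= M) ->
  0 < e -> exists p : {poly R}, forall x, 0 <= x <= 1 -> `|p.[x] - f x| <= e.
Proof.
move=> cf fM e0.
have e2 : 0 < e / 2 by rewrite divr_gt0.
have M0 : 0 <= M by apply: le_trans (fM 0).
have [d [d0 hd]] : exists d, 0 < d /\ forall x y, 0 <= x <= 1 -> `|x - y| < d ->
    `|f x - f y| <= e / 2.
  have /compact_near_coveringP nc := @segment_compact R 0 1.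
  have : \forall d \near 0^'+, `[0, 1]%classic `<=`
      (fun x => forall y, `|x - y| < d -> `|f x - f y| <= e / 2).
    apply: nc => x _.
    have /cvgrPdist_lt /(_ (e / 2 / 2)) := cf x.
    rewrite [0 < _ / 2]divr_gt0// => /(_ isT) /nbhs_ballP[r /= r0 hr].
    have r2 : 0 < r / 2 by rewrite divr_gt0.
    near=> x' d => /= y xy.
    have h1 : `|x - x'| < r / 2 by near: x'; exact: cvgr_dist_lt.
    have dr : d < r / 2 by near: d; exact: nbhs_right_lt.
    have b1 : `|f x - f x'| < e / 2 / 2.
      by apply: hr; rewrite /ball/=; lra.
    have b2 : `|f x - f y| < e / 2 / 2.
      apply: hr; rewrite /ball/= -[x - y](subrKA x').
      by apply: (le_lt_trans (ler_normD _ _)); lra.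
    rewrite -[f x' - f y](subrKA (f x)); apply: (le_trans (ler_normD _ _)).
    by rewrite distrC; lra.
  move=> h; have [d [d0 hd]] : exists d, 0 < d /\ `[0, 1]%classic `<=`
      (fun x => forall y, `|x - y| < d -> `|f x - f y| <= e / 2).
    near (0 : R)^'+ => d; exists d; split; near: d => //; exact: nbhs_right_gt.
  by exists d; split => // x y x01; apply: hd; rewrite /= in_itv.
pose K := 2 * M / d ^+ 2.
have K0 : 0 <= K.
  by apply: divr_ge0; [exact: mulr_ge0|apply: exprn_ge0; exact: ltW].
have hK x y : 0 <= x <= 1 -> `|f x - f y| <= e / 2 + K * (x - y) ^+ 2.
  move=> x01; have [/(hd _ _ x01)h|h] := ltP `|x - y| d.
    by apply: (le_trans h); rewrite lerDl mulr_ge0// sqr_ge0.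
  have : 2 * M <= K * (x - y) ^+ 2.
    rewrite /K mulrAC ler_pdivlMr ?exprn_gt0// ler_wpM2l ?mulr_ge0//.
    by rewrite -(real_normK (num_real (x - y))) ler_pXn2r// nnegrE ltW.
  have := ler_normD (f x) (- f y); rewrite normrN.
  by have := fM x; have := fM y; lra.
have [n hn] : exists n, K / (e / 2) < n.+1%:R.
  exists (Num.bound (K / (e / 2))).
  apply: (lt_le_trans (archi_boundP _)); first by rewrite divr_ge0// ltW.
  by rewrite ler_nat.
have N0 : 0 < n.+1%:R :> R by rewrite ltr0n.
exists (bernstein n.+1 (fun k => f (k%:R / n.+1%:R))) => x x01.
pose G k := (k%:R - n.+1%:R * x) ^+ 2.
pose c := K / n.+1%:R ^+ 2.
have bnd k : `|f x - f (k%:R / n.+1%:R)| <= e / 2 + c * G k.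
  apply: (le_trans (hK _ _ x01)); rewrite lerD2l /c /G.
  by rewrite le_eqVlt; apply/orP; left; apply/eqP; field; rewrite lt0r_neq0.
have cv : c * (bernstein n.+1 G).[x] <= e / 2.
  rewrite bernstein_variance subrr expr0n addr0 /c.
  have -> : K / n.+1%:R ^+ 2 * (n.+1%:R * (x * (1 - x))) = K / n.+1%:R * (x * (1 - x)).
    by field; rewrite lt0r_neq0.
  have : K / n.+1%:R <= e / 2.
    rewrite ler_pdivrMr// mulrC -ler_pdivrMr//; exact: ltW.
  move=> h; rewrite -[e / 2]mulr1; case/andP: x01 => x0 x1.
  have q0 : 0 <= x * (1 - x) by rewrite mulr_ge0// subr_ge0.
  have q1 : x * (1 - x) <= 1 by rewrite mulr_ile1// ?subr_ge0// gerBl.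
  by apply: ler_pM => //; apply: divr_ge0 => //; exact: ltW.
have up : (bernstein n.+1 (fun k => f (k%:R / n.+1%:R))).[x] <=
    (f x + e / 2) + c * (bernstein n.+1 G).[x].
  rewrite -bernstein_affine; apply: bernstein_le => // k.
  by have := bnd k; rewrite ler_norml => /andP[]; lra.
have lo : (f x - e / 2) + (- c) * (bernstein n.+1 G).[x] <=
    (bernstein n.+1 (fun k => f (k%:R / n.+1%:R))).[x].
  rewrite -bernstein_affine; apply: bernstein_le => // k.
  by have := bnd k; rewrite ler_norml => /andP[]; lra.
by rewrite ler_norml; apply/andP; split; lra.
Unshelve. all: by end_near. Qed.

End Weierstrass.

Section Arccosine.
Context {R : realType}.
Implicit Types (x y : R).

Lemma acos_within : {within `[(-1 : R), 1], continuous (@acos R)}.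
Proof.
have aI x : x \in `[(-1), 1] -> acos x \in `[0, (pi : R)].
  by rewrite !in_itv /= => h; rewrite acos_ge0// acos_lepi.
have mono : {in `[(-1 : R), 1] &, {mono (@acos R) : x y /~ x <= y}}.
  move=> x y xI yI.
  have := @ltr_cos R _ _ (aI _ yI) (aI _ xI).
  by rewrite !acosK// => h; rewrite leNgt -h -leNgt.
apply: segment_dec_surj_continuous => //.
move=> y; rewrite /= acos1 acosN1 => yI.
have yI' : y \in `[0, pi] by [].
exists (cos y); last exact: cosK.
by rewrite /= in_itv /= cos_geN1 cos_le1.
Qed.

Definition clamp a b x : R := Num.max a (Num.min b x).

Lemma clamp_continuous a b : continuous (clamp a b).
Proof.
move=> x.
have c k : {for x, continuous (fun=> k : R)} by exact: cst_continuous.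
have cid : {for x, continuous (fun y : R => y)} by exact: cvg_id.
exact: (continuous_max (c a) (continuous_min (c b) cid)).
Qed.

Lemma clampP a b x : a <= b -> a <= clamp a b x <= b.
Proof. by move=> ab; rewrite /clamp le_max lexx /= ge_max ab /= ge_min lexx. Qed.

Lemma clamp_id a b x : a <= x <= b -> clamp a b x = x.
Proof. by move=> /andP[h1 h2]; rewrite /clamp (min_idPr h2) (max_idPr h1). Qed.

Lemma continuous_of_within a b (f g : R -> R) : {within `[a, b], continuous f} ->
  continuous g -> (forall x, a <= g x <= b) -> continuous (fun x => f (g x)).
Proof.
move=> /subspace_continuousP cf cg gI x.
have gx : `[a, b]%classic (g x) by rewrite /= in_itv /=; exact: gI.
have h := cf _ gx.
apply/cvgrPdist_lt => e e0; move/cvgrPdist_lt : h => /(_ e e0) h.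
near=> y.
have : `[a, b]%classic (g y) -> `|f (g x) - f (g y)| < e.
  by near: y; exact: (cg x _ h).
by apply; rewrite /= in_itv /=; exact: gI.
Unshelve. all: by end_near. Qed.

(** Extended by its end values, so as to be continuous on the whole line. *)
Definition circle_acos y := acos (clamp (-1) 1 y).

Lemma circle_acos_continuous : continuous circle_acos.
Proof.
apply: continuous_of_within acos_within (@clamp_continuous _ _) _ => x.
by apply: clampP; lra.
Qed.

Lemma circle_acosK x : 0 <= x <= pi -> circle_acos (cos x) = x.
Proof.
by move=> h; rewrite /circle_acos clamp_id ?cos_geN1 ?cos_le1// cosK// in_itv.
Qed.

Lemma circle_acosP y : 0 <= circle_acos y <= pi.
Proof.
have h : -1 <= clamp (-1) 1 y <= 1 by apply: clampP; lra.
by rewrite acos_ge0// acos_lepi.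
Qed.

End Arccosine.

Section Smooth.
Context {R : realType}.
Implicit Types (f g h a b : R -> R) (x y c d e : R).

Lemma continuous_compf f g : continuous f -> continuous g ->
  continuous (fun x => f (g x)).
Proof. by move=> cf cg x; apply: continuous_comp; [exact: cg|exact: cf]. Qed.

Fixpoint diff_upto k f : Prop :=
  if k is k'.+1 then
    exists2 g, (forall x, is_derive x 1 f (g x)) & diff_upto k' g
  else continuous f.

Definition smooth f := forall k, diff_upto k f.

Lemma diff_uptoW k f : diff_upto k.+1 f -> diff_upto k f.
Proof.
elim: k f => [|k IH] f [g d h]; first exact: is_derive_continuous d.
by exists g => //; exact: IH.
Qed.

Lemma diff_upto_cst k c : diff_upto k (fun=> c).
Proof.
elim: k c => [|k IH] c /=; first by move=> ?; exact: cst_continuous.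
by exists (fun=> 0) => // x; exact: derc.
Qed.

Lemma diff_uptoD k f g : diff_upto k f -> diff_upto k g ->
  diff_upto k (fun x => f x + g x).
Proof.
elim: k f g => [|k IH] f g /=.
  by move=> cf cg x; apply: continuousD; [exact: cf|exact: cg].
move=> [f' df sf] [g' dg sg]; exists (fun x => f' x + g' x); last exact: IH.
by move=> x; exact: derD.
Qed.

Lemma diff_uptoM k f g : diff_upto k f -> diff_upto k g ->
  diff_upto k (fun x => f x * g x).
Proof.
elim: k f g => [|k IH] f g; first exact: continuousMf.
move=> hf hg; have wf := diff_uptoW hf; have wg := diff_uptoW hg.
case: hf => f' df sf; case: hg => g' dg sg.
exists (fun x => f' x * g x + f x * g' x); last by apply: diff_uptoD; exact: IH.
by move=> x; exact: derM.
Qed.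

Lemma smooth_cst c : smooth (fun=> c).
Proof. by move=> k; exact: diff_upto_cst. Qed.

Lemma smoothD f g : smooth f -> smooth g -> smooth (fun x => f x + g x).
Proof. by move=> sf sg k; apply: diff_uptoD. Qed.

Lemma smoothM f g : smooth f -> smooth g -> smooth (fun x => f x * g x).
Proof. by move=> sf sg k; apply: diff_uptoM. Qed.

Lemma smooth_primitive f g : (forall x, is_derive x 1 f (g x)) -> smooth g -> smooth f.
Proof.
move=> d sg [|k]; first exact: is_derive_continuous d.
by exists g.
Qed.

Lemma smooth_derive f g : (forall x, is_derive x 1 f (g x)) -> smooth f -> smooth g.
Proof.
move=> d sf k; have [h dh sh] := sf k.+1.
suff -> : g = h by [].
by apply/funext => x; rewrite -(der_val (d x)) (der_val (dh x)).
Qed.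

Lemma der_affine c d x : is_derive x 1 (fun y => c * y + d) (c : R).
Proof.
by apply: (der_eq (derD (derZ c (derid x)) (derc d x))); rewrite mulr1 addr0.
Qed.

Lemma der_cos_affine c d x :
  is_derive x 1 (fun y => cos (c * y + d)) (- c * sin (c * x + d)).
Proof.
apply: (der_eq (@derC _ cos (fun y => c * y + d) x _ _ (is_derive_cos _) (der_affine c d x))).
by rewrite mulNr mulrC mulNr.
Qed.

Lemma der_sin_affine c d x :
  is_derive x 1 (fun y => sin (c * y + d)) (c * cos (c * x + d)).
Proof.
apply: (der_eq (@derC _ sin (fun y => c * y + d) x _ _ (is_derive_sin _) (der_affine c d x))).
by rewrite mulrC.
Qed.

Lemma smooth_trig c d : smooth (fun y => cos (c * y + d)) /\ smooth (fun y => sin (c * y + d)).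
Proof.
suff h k : diff_upto k (fun y => cos (c * y + d)) /\ diff_upto k (fun y => sin (c * y + d)).
  by split=> k; case: (h k).
elim: k => [|k [hc hs]].
  split; [exact: (is_derive_continuous (der_cos_affine c d))|].
  exact: (is_derive_continuous (der_sin_affine c d)).
split.
  exists (fun x => - c * sin (c * x + d)); first exact: der_cos_affine.
  by apply: diff_uptoM => //; exact: diff_upto_cst.
exists (fun x => c * cos (c * x + d)); first exact: der_sin_affine.
by apply: diff_uptoM => //; exact: diff_upto_cst.
Qed.

Lemma smooth_horner (p : {poly R}) f : smooth f -> smooth (fun x => p.[f x]).
Proof.
move=> sf; elim/poly_ind: p => [|p c IH].
  by rewrite (_ : (fun x => _) = (fun=> 0));
    [exact: smooth_cst|apply/funext => x; rewrite horner0].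
rewrite (_ : (fun x => _) = (fun x => p.[f x] * f x + c)).
  by apply: smoothD; [exact: smoothM|exact: smooth_cst].
by apply/funext => x; rewrite hornerMXaddC.
Qed.

Definition periodic2pi f := forall x, f (x + 2 * pi) = f x.

Lemma cos_shift x : cos (x + 2 * pi) = cos x :> R.
Proof. by rewrite mulr_natl cosD2pi. Qed.

Lemma sin_shift x : sin (x + 2 * pi) = sin x :> R.
Proof. by rewrite mulr_natl sinD2pi. Qed.

Lemma periodic_nat f n x : periodic2pi f -> f (x + n%:R * (2 * pi)) = f x.
Proof.
move=> pf; elim: n => [|n IH]; first by rewrite mul0r addr0.
by rewrite -natr1 mulrDl mul1r addrA pf.
Qed.

Lemma periodic_cosk (k : nat) : periodic2pi (fun x => cos (k%:R * x + 0)).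
Proof.
by move=> x; rewrite !addr0 mulrDr (periodic_nat _ _ cos_shift).
Qed.

Lemma periodic_sink (k : nat) : periodic2pi (fun x => sin (k%:R * x + 0)).
Proof.
by move=> x; rewrite !addr0 mulrDr (periodic_nat _ _ sin_shift).
Qed.

Lemma periodic_derive f g : (forall x, is_derive x 1 f (g x)) -> periodic2pi f -> periodic2pi g.
Proof.
move=> d pf x.
have h : is_derive x 1 (fun y => f (y + 2 * pi)) (g (x + 2 * pi)).
  have dl := derD (derid x) (derc (2 * pi) x).
  apply: (der_eq (@derC _ f (fun y => y + 2 * pi) x _ _ (d _) dl)).
  by rewrite addr0 mulr1.
rewrite -(der_val h) -(der_val (d x)); congr ('D_1 _ x).
by apply/funext => y; exact: pf.
Qed.

(** Uniform approximation, with two derivatives, of the even function on the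
    circle which extends f: the second derivative is a continuous function of
    cos x, hence a uniform limit of polynomials in cos x, and once its mean has
    been removed such a polynomial has two successive periodic primitives. *)
Lemma smooth_even_approx (f f1 f2 : R -> R) (e : R) :
  (forall x, is_derive x 1 f (f1 x)) -> (forall x, is_derive x 1 f1 (f2 x)) ->
  continuous f2 -> f1 0 = 0 -> f1 pi = 0 -> 0 < e ->
  exists a a1 a2 : R -> R,
  [/\ smooth a, periodic2pi a,
      (forall x, is_derive x 1 a (a1 x)) /\ (forall x, is_derive x 1 a1 (a2 x)) &
      forall x, - pi <= x <= pi ->
        [/\ `|a x - f `|x| | <= e, `|a1 x - Num.sg x * f1 `|x| | <= e
          & `|a2 x - f2 `|x| | <= e]].
Proof.
move=> d1 d2 c2 z0 zp e0.
have pi0 : 0 < pi :> R := pi_gt0 R.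
have D0 : 0 < 1 + pi + pi ^+ 2 :> R by have := exprn_gt0 2 pi0; lra.
pose e' := e / (2 * (1 + pi + pi ^+ 2)).
have e'0 : 0 < e' by rewrite divr_gt0// mulr_gt0.
have eE : e = 2 * e' * (1 + pi + pi ^+ 2) by move: D0; rewrite /e'; move: (1 + pi + pi ^+ 2) => D D0; field; rewrite lt0r_neq0.
pose G y := f2 (circle_acos (2 * y - 1)).
have cG : continuous G.
  apply: continuous_compf => //; apply: continuous_compf.
    exact: circle_acos_continuous.
  exact: (is_derive_continuous (der_affine 2 (-1))).
have [M hM] : exists M, forall y, `|G y| <= M.
  have cn : {within `[0, pi], continuous (fun x => `|f2 x|)}.
    apply: continuous_subspaceT => x; apply: continuous_comp; first exact: c2.
    exact: norm_continuous.
  have [c _ hc] := EVT_max (ltW pi0) cn.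
  by exists `|f2 c| => y; apply: hc; rewrite in_itv /=; exact: circle_acosP.
have [p hp] := weierstrass cG hM e'0.
pose u x : R := (1 + cos x) / 2.
have u01 x : 0 <= u x <= 1.
  by rewrite /u; have := cos_geN1 x; have := cos_le1 x; lra.
pose q x := p.[u x].
have hq x : 0 <= x <= pi -> `|q x - f2 x| <= e'.
  move=> hx; have := hp _ (u01 x); rewrite /G.
  by rewrite (_ : 2 * u x - 1 = cos x) ?circle_acosK// /u; lra.
have su : smooth u.
  have := smooth_trig 1 0 => -[sc _].
  have -> : u = (fun x => 2^-1 * (1 + cos (1 * x + 0))).
    by apply/funext => x; rewrite /u mul1r addr0 mulrC.
  by apply: smoothM; [exact: smooth_cst|apply: smoothD => //; exact: smooth_cst].
have sq : smooth q by exact: smooth_horner.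
have [A [dA A0]] := primitive_exists 0 (sq 0%N).
have Aodd x : A (- x) = - A x.
  have dN y : is_derive y 1 (fun y => A (- y)) (q (- y) * -1).
    exact: (@derC _ A (fun y => - y) y _ _ (dA _) (derN (derid y))).
  have dS y : is_derive y 1 (fun y => A (- y) + A y) 0.
    apply: (der_eq (derD (dN y) (dA y))); rewrite /q /u cosN; ring.
  by have := derive0_cst dS x 0; rewrite oppr0 A0 addr0 => /eqP; rewrite addr_eq0 => /eqP.
(* m is the mean of q. *)
pose m := A pi / pi.
have pin : pi != 0 :> R by exact: lt0r_neq0.
pose a1 x := A x - m * x.
have da1 x : is_derive x 1 a1 (q x - m).
  by apply: (der_eq (derB (dA x) (derZ m (derid x)))); rewrite mulr1.
have a1odd x : a1 (- x) = - a1 x by rewrite /a1 Aodd; ring.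
have a1pi : a1 pi = 0 by rewrite /a1 /m divfK// subrr.
have a10 : a1 0 = 0 by rewrite /a1 A0 mulr0 subrr.
have pq : periodic2pi q by move=> x; rewrite /q /u cos_shift.
have shift h h1 : (forall x, is_derive x 1 h (h1 x)) -> periodic2pi h1 ->
    h (- pi) = h pi -> periodic2pi h.
  move=> dh ph hpi x.
  have dS y : is_derive y 1 (fun y => h (y + 2 * pi) - h y) 0.
    have dl := derD (derid y) (derc (2 * pi) y).
    apply: (der_eq (derB (@derC _ h (fun y => y + 2 * pi) y _ _ (dh _) dl) (dh y))).
    by rewrite ph addr0 mulr1 subrr.
  have := derive0_cst dS x (- pi).
  rewrite (_ : - pi + 2 * pi = pi :> R); last by ring.
  by rewrite hpi subrr => /eqP; rewrite subr_eq0 => /eqP.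
have pa1 : periodic2pi a1.
  by apply: (shift _ _ da1); [move=> x; rewrite pq|rewrite a1odd a1pi oppr0].
have [A' [dA' A'0]] := primitive_exists 0 (is_derive_continuous da1).
pose a x := A' x + f 0.
have da x : is_derive x 1 a (a1 x).
  by apply: (der_eq (derD (dA' x) (derc (f 0) x))); rewrite addr0.
have aeven x : a (- x) = a x.
  have dN y : is_derive y 1 (fun y => a (- y)) (a1 (- y) * -1).
    exact: (@derC _ a (fun y => - y) y _ _ (da _) (derN (derid y))).
  have dS y : is_derive y 1 (fun y => a (- y) - a y) 0.
    by apply: (der_eq (derB (dN y) (da y))); rewrite a1odd; ring.
  by have := derive0_cst dS x 0; rewrite oppr0 subrr => /eqP; rewrite subr_eq0 => /eqP.
have pa : periodic2pi a by apply: (shift _ _ da) => //.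
have sa : smooth a.
  apply: (smooth_primitive da); apply: (smooth_primitive da1).
  by apply: smoothD => //; exact: smooth_cst.
(* Bounds on [0, pi] by the mean value theorem; the rest is parity. *)
have cmp h h1 c x : (forall x, is_derive x 1 h (h1 x)) -> h 0 = 0 ->
    (forall x, 0 <= x <= pi -> `|h1 x| <= c) -> 0 <= x <= pi -> `|h x| <= c * x.
  move=> dh h0 hc /andP[x0 xp]; have [y /andP[y0 yx]] := mean_valueT x0 dh.
  rewrite h0 !subr0 => ->; rewrite normrM (ger0_norm x0) ler_wpM2r// hc//; lra.
have bA x : 0 <= x <= pi -> `|A x - f1 x| <= e' * x.
  apply: (cmp (fun x => A x - f1 x) (fun x => q x - f2 x)) => //.
  by rewrite A0 z0 subrr.
have hm : `|m| <= e'.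
  have : `|A pi - f1 pi| <= e' * pi by apply: bA; rewrite lexx ltW.
  by rewrite zp subr0 /m normrM normfV (gtr0_norm pi0) ler_pdivrMr.
have b2 x : 0 <= x <= pi -> `|q x - m - f2 x| <= 2 * e'.
  move=> hx; have := hq x hx; have := hm; rewrite !ler_norml => /andP[? ?] /andP[? ?].
  by apply/andP; split; lra.
have b1 x : 0 <= x <= pi -> `|a1 x - f1 x| <= 2 * e' * x.
  apply: (cmp (fun x => a1 x - f1 x) (fun x => q x - m - f2 x)) => //.
  by rewrite a10 z0 subrr.
have b1' x : 0 <= x <= pi -> `|a1 x - f1 x| <= 2 * e' * pi.
  move=> hx; apply: (le_trans (b1 x hx)).
  by apply: ler_wpM2l; [rewrite mulr_ge0// ltW|case/andP: hx].
have b0 x : 0 <= x <= pi -> `|a x - f x| <= 2 * e' * pi * x.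
  apply: (cmp (fun x => a x - f x) (fun x => a1 x - f1 x)) => //.
  by rewrite /a A'0 add0r subrr.
have e'2 : 0 <= 2 * e' by rewrite mulr_ge0// ltW.
have Ppi : 0 <= 2 * e' * pi by rewrite mulr_ge0// ltW.
have Ppi2 : 0 <= 2 * e' * pi * pi by rewrite mulr_ge0// ltW.
have P1 : 2 * e' <= e by lra.
have P2 : 2 * e' * pi <= e by lra.
have P3 : 2 * e' * pi * pi <= e by lra.
exists a, a1, (fun x => q x - m); split => // x hx.
have h0 : 0 <= `|x| <= pi by rewrite normr_ge0 ler_norml.
have -> : a x = a `|x| by have [h|h] := ger0P x; rewrite ?aeven.
have -> : q x = q `|x| by rewrite /q /u; have [h|h] := ger0P x; rewrite ?cosN.
have -> : a1 x = Num.sg x * a1 `|x|.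
  have [h|h|->] := ltrgtP x 0; last by rewrite sgr0 normr0 a10 mul0r.
    by rewrite ltr0_sg// ltr0_norm// a1odd mulN1r opprK.
  by rewrite gtr0_sg// gtr0_norm// mul1r.
rewrite -mulrBr normrM; split.
- apply: (le_trans (b0 _ h0)); apply: (le_trans _ P3); apply: ler_wpM2l => //.
  by case/andP: h0.
- apply: (le_trans _ P2); apply: (le_trans _ (b1' _ h0)).
  by rewrite normr_sg; case: (x != 0); rewrite ?mul1r// mul0r.
- by apply: (le_trans (b2 _ h0)).
Qed.

End Smooth.

(** * Integration on the torus *)

Section TorusIntegral.
Context {R : realType}.
Implicit Types (f g h phi psi : R * R -> R) (M c : R) (p : R * R).

Local Notation T2 := (@torus R).
Local Notation mA := (@area R).

Lemma measurable_torus : measurable (T2).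
Proof. by apply: measurableX; exact: measurable_itv. Qed.

Lemma area_torusE : mA T2 = ((2 * pi) ^+ 2)%:E.
Proof.
rewrite /area /torus product_measure1E; try exact: measurable_itv.
have h : - pi < pi :> R by have := pi_gt0 R; lra.
rewrite /= !lebesgue_measure_itv /= lte_fin h -EFinB -EFinM.
by congr EFin; ring.
Qed.

Lemma area_torus : (mA T2 < +oo)%E.
Proof. by rewrite area_torusE ltry. Qed.

Definition rL1 g := mA.-integrable (T2) (fun p => (g p)%:E).
Definition tint g : R := \int[mA]_(p in T2) g p.

(** An open set is a countable union of boxes with rational data, hence it
    belongs to the product of the Borel sigma-algebras. *)
Lemma open_measurable2 (U : set (R * R)) : open U -> measurable U.
Proof.
move=> oU.
pose box (i : rat * rat * rat) : set (R * R) :=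
  `](ratr i.1.1 - ratr i.2), (ratr i.1.1 + ratr i.2)[ `*`
  `](ratr i.1.2 - ratr i.2), (ratr i.1.2 + ratr i.2)[.
pose F i := [set p | box i p /\ box i `<=` U].
have -> : U = \bigcup_i F i.
  apply/seteqP; split => [[x y] Uxy|p [i _]]; last first.
    by case=> h; apply.
  have /nbhs_ballP[e /= e0 he] := open_nbhs_nbhs (conj oU Uxy).
  have [d /andP[d0 de]] : exists d : rat, 0 < (ratr d : R) < e / 2.
    have [d] := rat_in_itvoo (divr_gt0 e0 (@ltr0n R 2)).
    by rewrite in_itv; exists d.
  have near_rat (z : R) : exists q : rat, `|z - ratr q| < ratr d.
    have h : z - ratr d < z + ratr d by lra.
    have [q] := rat_in_itvoo h.
    by rewrite in_itv /= => /andP[h1 h2]; exists q; rewrite ltr_distlC h1 h2.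
  have [q1 h1] := near_rat x; have [q2 h2] := near_rat y.
  exists (q1, q2, d) => //.
  have mem (z : R) q : `|z - ratr q| < ratr d ->
      z \in `](ratr q - ratr d), (ratr q + ratr d)[.
    by rewrite in_itv /= ltr_distlC => /andP[? ?]; apply/andP; split; lra.
  suff sub : box (q1, q2, d) `<=` U.
    by split => //; split; exact: mem.
  move=> p; case: p => x' y' [hx hy]; move: hx hy; rewrite /= !in_itv /= => hx hy; apply: he.
  have cl (z z' : R) q : `|z - ratr q| < ratr d -> ratr q - ratr d < z' < ratr q + ratr d ->
      `|z - z'| < e.
    by rewrite ltr_distlC ltr_norml => /andP[? ?] /andP[? ?]; apply/andP; split; lra.
  by split; rewrite /ball /=; [exact: cl h1 hx|exact: cl h2 hy].
apply: countable_bigcupT_measurable; first exact: countableP.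
move=> i; have [h|h] := pselect (box i `<=` U).
  have -> : F i = box i by apply/seteqP; split => [p [] //|p].
  by apply: measurableX; exact: measurable_itv.
have -> : F i = set0 by apply/seteqP; split => [p []|p].
exact: measurable0.
Qed.

Lemma continuous_measurable2 f : continuous f -> measurable_fun [set: R * R] f.
Proof.
move=> /continuousP cf; apply: (measurability _ (RGenOpens.measurableE R)).
move=> _ [_ [x [y ->]] <-]; rewrite setTI.
by apply: open_measurable2; apply: cf; exact: interval_open.
Qed.

Definition bmeas M f := measurable_fun (T2) f /\ forall p, T2 p -> `|f p| <= M.

Lemma continuous_bmeas f : continuous f -> exists M, bmeas M f.
Proof.
move=> cf.
have cK : compact (`[- pi, pi] `*` `[- pi, pi] : set (R * R)).
  by apply: compact_setX; exact: segment_compact.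
have [M hM] : exists M, forall p, (`[- pi, pi] `*` `[- pi, pi] : set (R * R)) p ->
    `|f p| <= M.
  have cn : {within (`[- pi, pi] `*` `[- pi, pi] : set (R * R)), continuous (fun p => `|f p|)}.
    apply: continuous_subspaceT => p; apply: continuous_comp; first exact: cf.
    exact: norm_continuous.
  have ne : (`[- pi, pi] `*` `[- pi, pi] : set (R * R)) !=set0.
    exists (0, 0); rewrite /= !in_itv /= oppr_le0.
    by rewrite pi_ge0.
  have [c _ hc] := compact_EVT_max ne cK cn; exists `|f c| => p Kp.
  by apply: hc; rewrite inE.
exists M; split; first exact: measurable_funS (continuous_measurable2 cf).
move=> p [] /=; rewrite !in_itv /= => /andP[a b] /andP[c d].
by apply: hM; split; rewrite /= in_itv /= ?a ?c ltW.
Qed.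

Lemma rL1_bmeas M f : bmeas M f -> rL1 f.
Proof.
move=> [mf bf]; apply: measurable_bounded_integrable => //.
- exact: measurable_torus.
- exact: area_torus.
- exists M; split; first exact: num_real.
  by move=> M' /ltW MM' p Tp /=; apply: le_trans MM'; exact: bf.
Qed.

Lemma rL1_measurable g : rL1 g -> measurable_fun (T2) g.
Proof. by move=> /measurable_int /measurable_EFinP. Qed.

Lemma rL1M M f g : bmeas M f -> rL1 g -> rL1 (fun p => f p * g p).
Proof.
move=> [mf bf] ig.
have := @integrableMr _ _ _ mA (T2) measurable_torus f (fun p => (g p)%:E) mf _ ig.
apply; exists M; split; first exact: num_real.
by move=> M' /ltW MM' p Tp /=; apply: le_trans MM'; exact: bf.
Qed.

Lemma rL1D f g : rL1 f -> rL1 g -> rL1 (fun p => f p + g p).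
Proof.
move=> hf hg.
by have := @integrableD _ _ _ mA T2 measurable_torus _ _ hf hg; apply: eq_integrable => //; exact: measurable_torus.
Qed.

Lemma rL1B f g : rL1 f -> rL1 g -> rL1 (fun p => f p - g p).
Proof.
move=> hf hg.
by have := @integrableB _ _ _ mA T2 measurable_torus _ _ hf hg; apply: eq_integrable => //; exact: measurable_torus.
Qed.

Lemma rL1Z c f : rL1 f -> rL1 (fun p => c * f p).
Proof.
move=> hf.
by have := @integrableZl _ _ _ mA T2 measurable_torus c _ hf; apply: eq_integrable => //; exact: measurable_torus.
Qed.

Lemma rL1N f : rL1 f -> rL1 (fun p => - f p).
Proof.
move=> hf.
by have := @integrableN _ _ _ mA T2 _ hf; apply: eq_integrable => //; exact: measurable_torus.
Qed.

Lemma rL1_norm f : rL1 f -> rL1 (fun p => `|f p|).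
Proof. by move=> hf; exact: (@integrable_norm _ _ _ mA T2 _ hf). Qed.

Lemma rL1_le f g : measurable_fun (T2) f -> rL1 g ->
  (forall p, T2 p -> `|f p| <= g p) -> rL1 f.
Proof.
move=> mf ig h; apply: (@le_integrable _ _ _ mA T2 measurable_torus _ (EFin \o g)) => //.
  exact/measurable_EFinP.
by move=> p Tp /=; rewrite lee_fin (le_trans (h p Tp))// ler_norm.
Qed.

Lemma tintD f g : rL1 f -> rL1 g -> tint (fun p => f p + g p) = tint f + tint g.
Proof. by move=> hf hg; exact: (@RintegralD _ _ _ mA T2 _ _ measurable_torus hf hg). Qed.

Lemma tintB f g : rL1 f -> rL1 g -> tint (fun p => f p - g p) = tint f - tint g.
Proof. by move=> hf hg; exact: (@RintegralB _ _ _ mA T2 _ _ measurable_torus hf hg). Qed.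

Lemma tintZ c f : rL1 f -> tint (fun p => c * f p) = c * tint f.
Proof. by move=> hf; exact: (@RintegralZl _ _ _ mA T2 _ c measurable_torus hf). Qed.

Lemma tintN f : rL1 f -> tint (fun p => - f p) = - tint f.
Proof.
move=> hf; rewrite -mulN1r -tintZ//; apply: eq_Rintegral => p _.
by rewrite mulN1r.
Qed.

Lemma tint_le f g : rL1 f -> rL1 g -> (forall p, T2 p -> f p <= g p) ->
  tint f <= tint g.
Proof. by move=> hf hg; exact: (@le_Rintegral _ _ _ mA T2 _ _ measurable_torus hf hg). Qed.

Lemma tint_ge0 f : (forall p, T2 p -> 0 <= f p) -> 0 <= tint f.
Proof. by move=> h; apply: (@Rintegral_ge0 _ _ _ mA). Qed.

Lemma tint_eq f g : (forall p, T2 p -> f p = g p) -> tint f = tint g.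
Proof. by move=> h; apply: eq_Rintegral => p /set_mem; exact: h. Qed.

Lemma rL1_eq f g : (forall p, T2 p -> f p = g p) -> rL1 f -> rL1 g.
Proof.
move=> h; apply: (@eq_integrable _ _ _ mA T2 measurable_torus) => p /set_mem Tp /=.
by rewrite h.
Qed.

Lemma tint_norm f : rL1 f -> `|tint f| <= tint (fun p => `|f p|).
Proof. by move=> hf; exact: (@le_normr_Rintegral _ _ _ mA T2 _ measurable_torus hf). Qed.

Lemma tintM_bound M f g : bmeas M f -> rL1 g ->
  `|tint (fun p => f p * g p)| <= M * tint (fun p => `|g p|).
Proof.
move=> bf ig; have ifg := rL1M bf ig.
apply: (le_trans (tint_norm ifg)); rewrite -tintZ; last exact: rL1_norm.
apply: tint_le; [exact: rL1_norm|by apply: rL1Z; exact: rL1_norm|].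
by move=> p Tp; rewrite normrM ler_wpM2r//; case: bf => _; exact.
Qed.

Lemma tint_cst c : tint (fun=> c) = c * (2 * pi) ^+ 2.
Proof.
rewrite /tint (@Rintegral_cst _ _ _ mA T2 measurable_torus c).
by congr (_ * _); exact: (congr1 fine area_torusE).
Qed.

Lemma tint_ae f g : measurable_fun (T2) f -> measurable_fun (T2) g ->
  ae_eq mA (T2) f g -> tint f = tint g.
Proof.
move=> mf mg h; rewrite /tint /Rintegral; congr fine.
apply: ae_eq_integral => //; first exact: measurable_torus.
- exact/measurable_EFinP.
- exact/measurable_EFinP.
- by apply: filterS h => p /[apply] ->.
Qed.

End TorusIntegral.

(** * Test functions and integration by parts *)

Section TestFunctions.
Context {R : realType}.
Implicit Types (phi psi : R * R -> R) (a b : R -> R) (x y d : R) (p : R * R).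

(** Directional derivatives along the axes are derivatives of the slices. *)
Lemma growth_dir_x phi x y :
  (fun h => h^-1 *: ((phi \o shift (x, y)) (h *: dir_x R) - phi (x, y))) =
  (fun h => h^-1 *: (((fun t => phi (t, y)) \o shift x) (h *: 1) - phi (x, y))).
Proof.
apply/funext => h /=; congr (_ *: (phi _ - _)).
by congr (_, _); rewrite /= /GRing.scale /= mulr0 add0r.
Qed.

Lemma growth_dir_y phi x y :
  (fun h => h^-1 *: ((phi \o shift (x, y)) (h *: dir_y R) - phi (x, y))) =
  (fun h => h^-1 *: (((fun t => phi (x, t)) \o shift y) (h *: 1) - phi (x, y))).
Proof.
apply/funext => h /=; congr (_ *: (phi _ - _)).
by congr (_, _); rewrite /= /GRing.scale /= mulr0 add0r.
Qed.

Lemma derive_dir_x phi p :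
  'D_(dir_x R) phi p = 'D_1 (fun t => phi (t, p.2)) p.1.
Proof. by case: p => x y; rewrite /derive growth_dir_x. Qed.

Lemma derive_dir_y phi p :
  'D_(dir_y R) phi p = 'D_1 (fun t => phi (p.1, t)) p.2.
Proof. by case: p => x y; rewrite /derive growth_dir_y. Qed.

Lemma derivable_dir_x phi p :
  derivable phi p (dir_x R) = derivable (fun t => phi (t, p.2)) p.1 1.
Proof. by case: p => x y; rewrite /derivable growth_dir_x. Qed.

Lemma derivable_dir_y phi p :
  derivable phi p (dir_y R) = derivable (fun t => phi (p.1, t)) p.2 1.
Proof. by case: p => x y; rewrite /derivable growth_dir_y. Qed.

Definition tensor a b p := a p.1 * b p.2.

Lemma continuous_tensor a b : continuous a -> continuous b -> continuous (tensor a b).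
Proof.
move=> ca cb p; apply: (@continuousM R (R * R)%type (fun p => a p.1) (fun p => b p.2)).
  by apply: (@continuous_comp _ _ _ fst a); [exact: cvg_fst|exact: ca].
by apply: (@continuous_comp _ _ _ snd b); [exact: cvg_snd|exact: cb].
Qed.

Lemma tensor_dx a a1 b p : (forall x, is_derive x 1 a (a1 x)) ->
  derivable (tensor a b) p (dir_x R) /\ 'D_(dir_x R) (tensor a b) p = tensor a1 b p.
Proof.
move=> da; rewrite derivable_dir_x derive_dir_x /tensor /=.
have h := derM (da p.1) (derc (b p.2) p.1).
by case: h => h1 h2; split => //; rewrite h2 mulr0 addr0.
Qed.

Lemma tensor_dy a b b1 p : (forall x, is_derive x 1 b (b1 x)) ->
  derivable (tensor a b) p (dir_y R) /\ 'D_(dir_y R) (tensor a b) p = tensor a b1 p.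
Proof.
move=> db; rewrite derivable_dir_y derive_dir_y /tensor /=.
have h := derM (derc (a p.1) p.2) (db p.2).
by case: h => h1 h2; split => //; rewrite h2 mul0r add0r.
Qed.

Lemma Ck_tensor k a b : diff_upto k a -> diff_upto k b -> Ck k (tensor a b).
Proof.
elim: k a b => [|k IH] a b ha hb.
  by split => //; exact: continuous_tensor.
have ca : continuous a by case: ha => a1 da _; exact: is_derive_continuous da.
have cb : continuous b by case: hb => b1 db _; exact: is_derive_continuous db.
split; first exact: continuous_tensor.
have wa := diff_uptoW ha; have wb := diff_uptoW hb.
case: ha => a1 da sa; case: hb => b1 db sb.
split.
- by move=> p; exact: (tensor_dx _ _ da).1.
- by move=> p; exact: (tensor_dy _ _ db).1.
- rewrite (_ : (fun p => _) = tensor a1 b); first exact: IH.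
  by apply/funext => p; exact: (tensor_dx _ _ da).2.
- rewrite (_ : (fun p => _) = tensor a b1); first exact: IH.
  by apply/funext => p; exact: (tensor_dy _ _ db).2.
Qed.

Lemma test_function_tensor a b : smooth a -> smooth b -> periodic2pi a ->
  periodic2pi b -> test_function (tensor a b).
Proof.
move=> sa sb pa pb; split; first by move=> k; exact: Ck_tensor.
by move=> x y; rewrite /tensor /= pa pb.
Qed.

Lemma Ck_cont k phi : Ck k phi -> continuous phi.
Proof. by case: k => [|k] []. Qed.

Lemma test_function_cont phi : test_function phi -> continuous phi.
Proof. by move=> [/(_ 0%N) /Ck_cont]. Qed.

Lemma test_function_dx phi : test_function phi ->
  test_function (fun p => 'D_(dir_x R) phi p).
Proof.
move=> [hC per]; split.
  by move=> k; have [_ []] := hC k.+1.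
move=> x y; rewrite !derive_dir_x /=; split.
- have d (z : R) : is_derive z 1 (fun t => phi (t, y)) ('D_1 (fun t => phi (t, y)) z).
    have [_ [dx _ _ _]] := hC 1%N.
    by apply: DeriveDef => //; have := dx (z, y); rewrite derivable_dir_x.
  by apply: (periodic_derive d) => t; exact: (per t y).1.
- by congr ('D_1 _ x); apply/funext => t; exact: (per t y).2.
Qed.

Lemma test_function_dy phi : test_function phi ->
  test_function (fun p => 'D_(dir_y R) phi p).
Proof.
move=> [hC per]; split.
  by move=> k; have [_ []] := hC k.+1.
move=> x y; rewrite !derive_dir_y /=; split.
- by congr ('D_1 _ y); apply/funext => t; exact: (per x t).1.
- have d (z : R) : is_derive z 1 (fun t => phi (x, t)) ('D_1 (fun t => phi (x, t)) z).
    have [_ [_ dy _ _]] := hC 1%N.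
    by apply: DeriveDef => //; have := dy (x, z); rewrite derivable_dir_y.
  by apply: (periodic_derive d) => t; exact: (per x t).2.
Qed.

Lemma test_function_derivable phi p : test_function phi ->
  derivable phi p (dir_x R) /\ derivable phi p (dir_y R).
Proof. by move=> [/(_ 1%N) [_ [hx hy _ _]] _]. Qed.

End TestFunctions.

Section IntegrationByParts.
Context {R : realType}.
Implicit Types (psi : R * R -> R) (x y : R).
Local Notation T2 := (@torus R).
Local Notation mA := (@area R).
Let TR : measurableType _ := measurableTypeR R.
Let mu := @lebesgue_measure R.

Lemma continuous_slice_x psi y : continuous psi -> continuous (fun x => psi (x, y)).
Proof.
move=> c x.
apply: (@continuous2_cvg _ _ _ _ (nbhs x) _ (fun x => x) (fun=> y) (fun a b => psi (a, b))).
- by apply: cvg_trans (c (x, y)); apply: near_eq_cvg; apply: nearW => -[].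
- exact: cvg_id.
- exact: cvg_cst.
Qed.

Lemma continuous_slice_y psi x : continuous psi -> continuous (fun y => psi (x, y)).
Proof.
move=> c y.
apply: (@continuous2_cvg _ _ _ _ (nbhs y) _ (fun=> x) (fun y => y) (fun a b => psi (a, b))).
- by apply: cvg_trans (c (x, y)); apply: near_eq_cvg; apply: nearW => -[].
- exact: cvg_cst.
- exact: cvg_id.
Qed.

Lemma FTC_circle (F f : R -> R) : continuous f -> (forall x : R, is_derive x 1 F (f x)) ->
  F pi = F (- pi) -> (\int[mu]_(x in `[(- pi)%R, pi%R[) (f x)%:E = 0)%E.
Proof.
move=> cf dF Fpi.
have cF := is_derive_continuous dF.
have pp : - pi < pi :> R by have := pi_gt0 R; lra.
rewrite integral_itv_bndo_bndc//; last first.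
  apply/measurable_EFinP; apply: measurable_funS (continuous_measurable_fun cf) => //.
rewrite (@continuous_FTC2 R f F (- pi) pi pp).
- by rewrite Fpi -EFinB subrr.
- exact: continuous_subspaceT.
- split.
  + by move=> x _; case: (dF x).
  + by apply: cvg_at_right_filter; exact: cF.
  + by apply: cvg_at_left_filter; exact: cF.
- by move=> x _; rewrite derive1E; exact: der_val.
Qed.

Lemma restrict_torus psi x y :
  ((EFin \o psi) \_ T2) (x, y) = if (x \in `[- pi, pi[) && (y \in `[- pi, pi[)
                         then (psi (x, y))%:E else 0%E.
Proof.
rewrite /patch; case: ifPn => [/set_mem [/= -> ->]//|]; case: ifPn => // /andP[h1 h2].
by move/negP; case; rewrite inE.
Qed.

(** Fubini, and the fundamental theorem of calculus on periodic slices. *)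
Lemma int_dx_eq0 psi (psi1 : R * R -> R) : continuous psi1 ->
  (forall x y : R, is_derive x 1 (fun t => psi (t, y)) (psi1 (x, y))) ->
  (forall x y, psi (x + 2 * pi, y) = psi (x, y)) -> tint psi1 = 0.
Proof.
move=> c1 d per; have [M bM] := continuous_bmeas c1.
have i1 := rL1_bmeas bM.
rewrite /tint /Rintegral integral_mkcond.
have i2 : mA.-integrable setT ((EFin \o psi1) \_ T2).
  by apply: (iffLR (@integrable_mkcond _ _ _ mA T2 (EFin \o psi1) measurable_torus)).
have := @integral21_prod_meas1 _ _ TR TR R mu mu _ i2.
rewrite /area => <-.
rewrite (_ : (fun y => _) = cst 0%E) ?integral_cst ?mul0e//.
apply/funext => y /=; have [yI|yI] := boolP (y \in `[- pi, pi[).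
  transitivity (\int[mu]_(x in `[(- pi)%R, pi%R[) (psi1 (x, y))%:E)%E.
    rewrite [RHS]integral_mkcond; apply: eq_integral => x _.
    by rewrite restrict_torus yI andbT /patch mem_setE.
  apply: (@FTC_circle (fun x => psi (x, y))) => //.
    exact: continuous_slice_x.
  by rewrite -(per (- pi) y); congr (psi (_, _)); ring.
apply: integral0_eq => x _.
by rewrite restrict_torus (negbTE yI) andbF.
Qed.

Lemma int_dy_eq0 psi (psi1 : R * R -> R) : continuous psi1 ->
  (forall x y : R, is_derive y 1 (fun t => psi (x, t)) (psi1 (x, y))) ->
  (forall x y, psi (x, y + 2 * pi) = psi (x, y)) -> tint psi1 = 0.
Proof.
move=> c1 d per; have [M bM] := continuous_bmeas c1.
have i1 := rL1_bmeas bM.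
rewrite /tint /Rintegral integral_mkcond.
have i2 : mA.-integrable setT ((EFin \o psi1) \_ T2).
  by apply: (iffLR (@integrable_mkcond _ _ _ mA T2 (EFin \o psi1) measurable_torus)).
have := @integral12_prod_meas1 _ _ TR TR R mu mu _ i2.
rewrite /area => <-.
rewrite (_ : (fun x => _) = cst 0%E) ?integral_cst ?mul0e//.
apply/funext => x /=; have [xI|xI] := boolP (x \in `[- pi, pi[).
  transitivity (\int[mu]_(y in `[(- pi)%R, pi%R[) (psi1 (x, y))%:E)%E.
    rewrite [RHS]integral_mkcond; apply: eq_integral => y _.
    by rewrite restrict_torus xI /patch mem_setE.
  apply: (@FTC_circle (fun y => psi (x, y))) => //.
    exact: continuous_slice_y.
  by rewrite -(per x (- pi)); congr (psi (_, _)); ring.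
apply: integral0_eq => y _.
by rewrite restrict_torus (negbTE xI).
Qed.

End IntegrationByParts.

(** * The fundamental lemma of the calculus of variations *)

Section ArcApproximation.
Context {R : realType}.
Implicit Types (a x y t r m : R).

Lemma cos_arc r t : 0 <= r <= pi -> `|t| < r -> cos r < cos t.
Proof.
move=> /andP[r0 rp] tr.
rewrite -[cos t](_ : cos `|t| = cos t); last by have [h|h] := ger0P t; rewrite ?cosN.
by rewrite ltr_cos// in_itv /= ?normr_ge0 ?r0 ?rp// (le_trans (ltW tr)).
Qed.

Lemma cos_coarc r t : 0 <= r <= pi -> r <= t <= 2 * pi - r -> cos t <= cos r.
Proof.
move=> /andP[r0 rp] /andP[rt tr]; rewrite leNgt; apply/negP => h.
have [tp|tp] := leP t pi.
  have t0 : 0 <= t by exact: le_trans rt.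
  by move: h; rewrite ltr_cos ?in_itv /= ?r0 ?t0// ltNge rt.
have e : cos t = cos (2 * pi - t) by rewrite addrC cos_shift cosN.
move: h; rewrite e ltr_cos ?in_itv /= ?r0 ?rp//; last by apply/andP; split; lra.
by move=> ?; lra.
Qed.

Lemma clamp01_eq0 x : x <= 0 -> clamp 0 1 x = 0 :> R.
Proof. by move=> h; rewrite /clamp (min_idPr _) ?(le_trans h)// (max_idPl _). Qed.

Lemma clamp01_eq1 x : 1 <= x -> clamp 0 1 x = 1 :> R.
Proof. by move=> h; rewrite /clamp (min_idPl h) (max_idPr _). Qed.

(** On [-pi, pi) a half-line is an arc of the circle, that is, a superlevel set
    of a shifted cosine: a steep continuous function of this cosine is close to
    its indicator, and is in turn close to a polynomial in the cosine. *)
Lemma half_line_approx a : exists A : nat -> R -> R,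
  [/\ forall n, smooth (A n), forall n, periodic2pi (A n),
      forall n x, `|A n x| <= 2 &
      forall x, - pi <= x < pi -> A n x @[n --> \oo] --> (if a < x then 1 else 0 : R)].
Proof.
have pi0 := pi_gt0 R.
have [ap|ap] := leP pi a.
  exists (fun _ _ => 0); split.
  - by move=> n; exact: smooth_cst.
  - by move=> n x.
  - by move=> n x; rewrite normr0.
  - move=> x /andP[_ xp]; rewrite ltNge (le_trans (ltW xp) ap) /=; exact: cvg_cst.
have [pa|pa] := ltP a (- pi).
  exists (fun _ _ => 1); split.
  - by move=> n; exact: smooth_cst.
  - by move=> n x.
  - by move=> n x; rewrite normr1 ler1n.
  - move=> x /andP[xp _]; rewrite (lt_le_trans pa xp); exact: cvg_cst.
pose m := (a + pi) / 2; pose r := (pi - a) / 2.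
have r0 : 0 <= r <= pi by rewrite /r; apply/andP; split; lra.
pose u x := (1 + cos (x - m)) / 2; pose u0 := (1 + cos r) / 2.
have u01 x : 0 <= u x <= 1.
  by rewrite /u; have := cos_geN1 (x - m); have := cos_le1 (x - m); lra.
pose H (n : nat) z : R := clamp 0 1 (n.+1%:R * z + (- n.+1%:R * u0)).
have cH n : continuous (H n).
  apply: continuous_compf; first exact: clamp_continuous.
  exact: (is_derive_continuous (der_affine _ _)).
have bH n z : `|H n z| <= 1.
  have /andP[h1 h2] := @clampP R 0 1 (n.+1%:R * z + (- n.+1%:R * u0)) ler01.
  by rewrite ger0_norm.
have e0 (n : nat) : 0 < n.+1%:R^-1 :> R by rewrite invr_gt0 ltr0n.
have [p hp] := choice (fun n => weierstrass (cH n) (bH n) (e0 n)).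
have su : smooth u.
  have [sc _] := smooth_trig 1 (- m).
  have -> : u = (fun x => 2^-1 * (1 + cos (1 * x + (- m)))).
    by apply/funext => x; rewrite /u mul1r mulrC.
  by apply: smoothM; [exact: smooth_cst|apply: smoothD => //; exact: smooth_cst].
exists (fun n x => (p n).[u x]); split.
- by move=> n; exact: smooth_horner.
- by move=> n x; rewrite /u addrAC cos_shift.
- move=> n x; have := hp n _ (u01 x); have := bH n (u x).
  have : n.+1%:R^-1 <= 1 :> R by rewrite invf_le1 ?ltr0n// ler1n.
  move: (n.+1%:R^-1) ((p n).[u x]) (H n (u x)) => i P Q.
  by rewrite !ler_norml => h /andP[? ?] /andP[? ?]; apply/andP; split; lra.
move=> x /andP[x1 x2].
have Hlim : exists N : nat, forall n, (N <= n)%N -> H n (u x) = (if a < x then 1 else 0).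
  have [ax|ax] := ltP a x.
    have hu : 0 < u x - u0.
      suff : cos r < cos (x - m) by rewrite /u /u0; lra.
      by apply: cos_arc => //; rewrite ltr_norml /m /r; apply/andP; split; lra.
    exists (Num.bound (u x - u0)^-1) => n hn; apply: clamp01_eq1.
    rewrite mulNr -mulrBr -ler_pdivrMr// div1r.
    have hi : 0 <= (u x - u0)^-1 by rewrite invr_ge0 ltW.
    apply: (le_trans (ltW (archi_boundP hi))).
    by rewrite ler_nat (leq_trans hn).
  exists 0%N => n _; apply: clamp01_eq0.
  rewrite mulNr -mulrBr pmulr_rle0 ?ltr0n// subr_le0.
  suff : cos (x - m) <= cos r by rewrite /u /u0; lra.
  rewrite -cosN opprB; apply: cos_coarc => //.
  by rewrite /m /r; apply/andP; split; lra.
have [N hN] := Hlim.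
apply/cvgrPdist_le => e ep.
near=> n.
rewrite distrC -(hN n); last by near: n; exact: nbhs_infty_ge.
apply: (le_trans (hp n _ (u01 x))).
near: n; exists (Num.bound e^-1) => // n /= hn.
have ei : 0 <= e^-1 by rewrite invr_ge0 ltW.
rewrite -[e]invrK lef_pV2 ?posrE ?ltr0n ?invr_gt0//.
by apply: (le_trans (ltW (archi_boundP ei))); rewrite ler_nat (leq_trans hn).
Unshelve. all: by end_near. Qed.

End ArcApproximation.

Section FundamentalLemma.
Context {R : realType}.
Local Notation T2 := (@torus R).
Local Notation mA := (@area R).
Let TR : measurableType _ := measurableTypeR R.

(** The sets over which an integrable function has integral zero form a
    lambda-system. *)
Lemma int0_on_sigma_algebra d (T' : measurableType d) (G : set (set T'))
    (F : TR * TR -> T') (g : R * R -> R) (D : set (TR * TR)) :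
  measurable D -> measurable_fun setT F -> mA.-integrable D (EFin \o g) ->
  @measurable _ T' = <<s G >> -> setI_closed G ->
  (\int[mA]_(p in D) (g p)%:E = 0)%E ->
  (forall A, G A -> (\int[mA]_(p in D `&` F @^-1` A) (g p)%:E = 0)%E) ->
  forall A, measurable A -> (\int[mA]_(p in D `&` F @^-1` A) (g p)%:E = 0)%E.
Proof.
move=> mD mF ig mG GI D0 G0.
have mFA A : measurable A -> measurable (D `&` F @^-1` A).
  by move=> mA'; apply: measurableI => //; rewrite -[X in measurable X]setTI; exact: mF.
have iS B : measurable B -> B `<=` D -> mA.-integrable B (EFin \o g).
  by move=> mB BD; apply: (integrableS _ _ BD).
rewrite mG; apply: (dynkin_induction mG GI) => //.
- by rewrite preimage_setT setIT.
- move=> A mA0 h.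
  have := @integral_setU_EFin _ _ _ mA (D `&` F @^-1` A) (D `&` F @^-1` (~` A)) g.
  rewrite -setIUr -preimage_setU setUv preimage_setT setIT D0 h add0e => <- //.
  + exact: mFA.
  + by apply: mFA; exact: measurableC.
  + by case/integrableP : ig => /measurable_EFinP.
  + apply/disj_setPS => p [[_ h1] [_ h2]]; exact: h2.
- move=> S mS tS S0.
  rewrite preimage_bigcup setI_bigcupr (@integral_bigcup _ _ _ mA).
  + by rewrite eseries0.
  + apply/trivIsetP => i j _ _ ij; apply/seteqP; split => // p [[_ hi] [_ hj]].
    by move/trivIsetP : tS => /(_ i j I I ij) /seteqP[/(_ (F p)) + _]; apply.
  + by move=> k; exact: mFA.
  + by apply: iS; [apply: bigcupT_measurable => k; exact: mFA|move=> p [k _ []]].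
Qed.

End FundamentalLemma.

Section FundamentalLemma.
Context {R : realType}.
Implicit Types (g : R * R -> R) (a c : R).
Local Notation T2 := (@torus R).
Local Notation mA := (@area R).
Let TR : measurableType _ := measurableTypeR R.

Definition rays a c : set (R * R) := fst @^-1` `]a, +oo[ `&` snd @^-1` `]c, +oo[.

Lemma measurable_fst_preim (A : set TR) : measurable A ->
  @measurable _ (TR * TR)%type (fst @^-1` A).
Proof. by move=> mA'; rewrite -[X in measurable X]setTI; exact: measurable_fst. Qed.

Lemma measurable_snd_preim (A : set TR) : measurable A ->
  @measurable _ (TR * TR)%type (snd @^-1` A).
Proof. by move=> mA'; rewrite -[X in measurable X]setTI; exact: measurable_snd. Qed.

(** Dominated convergence along products of two approximate half-lines. *)
Lemma rays_int0 g a c : rL1 g ->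
  (forall phi, test_function phi -> tint (fun p => phi p * g p) = 0) ->
  (\int[mA]_(p in T2 `&` rays a c) (g p)%:E = 0)%E.
Proof.
move=> ig h.
have [A [sA pA bA lA]] := half_line_approx a.
have [C [sC pC bC lC]] := half_line_approx c.
have tAC n := test_function_tensor (sA n) (sC n) (pA n) (pC n).
have b4 n p : `|tensor (A n) (C n) p| <= 4.
  rewrite /tensor normrM (_ : 4 = 2 * 2 :> R); last by ring.
  by apply: ler_pM.
have bm n : bmeas 4 (tensor (A n) (C n)).
  split; last by move=> p _; exact: b4.
  apply: measurable_funS (continuous_measurable2 (test_function_cont (tAC n))) => //.
have i_n n := rL1M (bm n) ig.
have mrays : @measurable _ (TR * TR)%type (rays a c).
  by apply: measurableI; [apply: measurable_fst_preim|apply: measurable_snd_preim];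
    exact: measurable_itv.
pose F n (p : R * R) := (tensor (A n) (C n) p * g p)%:E.
pose L := (EFin \o g) \_ (rays a c).
have mg := rL1_measurable ig.
have cvgF : {ae mA, forall p, T2 p -> F n p @[n --> \oo] --> L p}.
  apply: aeW => p [/= xI yI].
  have hA := lA p.1 xI; have hC := lC p.2 yI.
  have e : L p = ((if a < p.1 then 1 else 0) * (if c < p.2 then 1 else 0) * g p)%:E.
    rewrite /L /patch; case: ifPn => [/set_mem [/= ]|/negP].
      by rewrite !in_itv /= !andbT => -> ->; rewrite !mul1r.
    move=> hn; congr EFin; case: ifP => [h1|_]; last by rewrite !mul0r.
    case: ifP => [h2|_]; last by rewrite mulr0 mul0r.
    by exfalso; apply: hn; rewrite inE /rays /= !in_itv /= h1 h2.
  rewrite e; apply: cvg_EFin; first exact: nearW.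
  by apply: cvgM; [exact: cvgM|exact: cvg_cst].
have dom : {ae mA, forall p n, T2 p -> (`|F n p| <= (4 * `|g p|)%:E)%E}.
  apply: aeW => p n _; rewrite /F abse_EFin lee_fin normrM ler_wpM2r//; exact: b4.
have idom : mA.-integrable T2 (EFin \o (fun p => 4 * `|g p|)).
  by apply: rL1Z; exact: rL1_norm.
have mF n : @measurable_fun _ _ (TR * TR)%type _ T2 (F n).
  by apply/measurable_EFinP; exact: rL1_measurable (i_n n).
have mL : @measurable_fun _ _ (TR * TR)%type _ T2 L.
  apply/(measurable_restrict _ mrays measurable_torus).
  by apply: measurable_funS measurable_torus _ _; [|apply/measurable_EFinP].
have [_ _ lim] := @dominated_convergence _ _ _ mA T2 measurable_torus F L
  (EFin \o (fun p => 4 * `|g p|)) mF mL cvgF idom dom.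
rewrite integral_mkcondr -/L.
have z : (fun n => (\int[mA]_(p in T2) F n p)%E) = cst 0%E.
  apply/funext => n /=.
  have := h _ (tAC n); rewrite /tint /Rintegral /F => hz.
  rewrite -[LHS]fineK; first by rewrite hz.
  exact: (@integrable_fin_num _ _ _ mA T2 measurable_torus _ (i_n n)).
rewrite z in lim; rewrite -(cvg_lim (@ereal_hausdorff R) lim); exact: lim_cst.
Qed.

(** Quadrants of the torus are limits of test functions, and they generate the
    Borel sets, one coordinate after the other. *)
Lemma fundamental_lemma g : rL1 g ->
  (forall phi, test_function phi -> tint (fun p => phi p * g p) = 0) ->
  ae_eq mA T2 g (fun=> 0).
Proof.
move=> ig h.
have mT : @measurable _ (TR * TR)%type T2 by exact: measurable_torus.
have GI : setI_closed (@RGenOInfty.G R).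
  move=> _ _ [x ->] [y ->]; exists (Num.max x y).
  apply/seteqP; split => t /=; rewrite !in_itv /= !andbT gt_max.
    by move=> [-> ->].
  by move=> /andP[].
have mG : @measurable _ TR = <<s @RGenOInfty.G R >> by exact: RGenOInfty.measurableE.
have iS B : @measurable _ (TR * TR)%type B -> B `<=` T2 -> mA.-integrable B (EFin \o g).
  by move=> mB BD; apply: (@integrableS _ _ _ mA _ _ _ mT mB BD ig).
have all0 : (\int[mA]_(p in T2) (g p)%:E = 0)%E.
  have := rays_int0 (- pi - 1) (- pi - 1) ig h.
  rewrite (_ : T2 `&` _ = T2)//; apply/seteqP; split => [p []//|[x y] [/= hx hy]].
  split; first by split.
  by move: hx hy; rewrite /rays /= !in_itv /= !andbT => /andP[? _] /andP[? _];
    split; lra.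
have mI c : @measurable _ (TR * TR)%type (T2 `&` snd @^-1` `]c, +oo[).
  by apply: measurableI => //; apply: measurable_snd_preim; exact: measurable_itv.
have s1 c A : measurable A ->
    (\int[mA]_(p in T2 `&` snd @^-1` `]c, +oo[ `&` fst @^-1` A) (g p)%:E = 0)%E.
  move: A; apply: (int0_on_sigma_algebra (mI c) measurable_fst _ mG GI).
  - by apply: iS; [exact: mI|exact: subIsetl].
  - have := rays_int0 (- pi - 1) c ig h.
    rewrite (_ : T2 `&` rays _ c = T2 `&` snd @^-1` `]c, +oo[)//.
    apply/seteqP; split => [p [hT [_ ?]]//|[x y] [[/= hx hy] hc]].
    split; first by split.
    split => //; move: hx; rewrite /= !in_itv /= andbT => /andP[? _]; lra.
  - move=> _ [a ->]; rewrite -setIA [_ @^-1` _ `&` _]setIC.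
    exact: (rays_int0 a c ig h).
have s2 A B : measurable A -> measurable B ->
    (\int[mA]_(p in T2 `&` fst @^-1` A `&` snd @^-1` B) (g p)%:E = 0)%E.
  move=> mA'; move: B.
  have mD : @measurable _ (TR * TR)%type (T2 `&` fst @^-1` A).
    by apply: measurableI => //; exact: measurable_fst_preim.
  apply: (int0_on_sigma_algebra mD measurable_snd _ mG GI).
  - by apply: iS; [exact: mD|exact: subIsetl].
  - have := s1 (- pi - 1) A mA'.
    rewrite (_ : T2 `&` snd @^-1` `](- pi - 1), +oo[ = T2)//.
    apply/seteqP; split => [p []//|[x y] [/= hx hy]].
    split; first by split.
    by move: hy; rewrite /= !in_itv /= andbT => /andP[? _]; lra.
  - by move=> _ [c ->]; rewrite setIAC; exact: s1.
have s3 E : measurable E -> (\int[mA]_(p in T2 `&` E) (g p)%:E = 0)%E.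
  move=> mE.
  have := @int0_on_sigma_algebra R _ (TR * TR)%type
    [set A `*` B | A in measurable & B in measurable] id g T2 mT _ ig.
  move=> /(_ (@measurable_id _ _ setT) (measurable_prod_measurableType _ _) _ all0 _ E mE).
  rewrite preimage_id; apply.
  - move=> _ _ [A1 mA1 [B1 mB1 <-]] [A2 mA2 [B2 mB2 <-]].
    rewrite -setXI; exists (A1 `&` A2); first exact: measurableI.
    by exists (B1 `&` B2); first exact: measurableI.
  - move=> _ [A mA1 [B mB <-]]; rewrite preimage_id.
    by have := s2 A B mA1 mB; rewrite -setIA.
have e0 : ae_eq mA T2 (EFin \o g) (cst 0%E).
  apply: (@integral_ae_eq _ _ _ mA T2 mT) => //.
  move=> E ET mE; have := s3 E mE; rewrite (setIidr ET) => zE.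
  by rewrite [RHS]integral0_eq.
by apply: filterS e0 => p /[apply] /= [[]].
Qed.

End FundamentalLemma.

(** * Weak derivatives against modes *)

Section WeakIdentities.
Context {R : realType}.
Implicit Types (phi psi u v g : R * R -> R) (f a b : R -> R) (x y e : R).
Local Notation T2 := (@torus R).

Definition rweak (d : R * R) u g := forall phi, test_function phi ->
  tint (fun p => 'D_d phi p * u p) = - tint (fun p => phi p * g p).

Definition rrepresents W u v g := rL1 (fun p => W p * v p) /\
  forall phi, test_function phi ->
    tint (fun p => - (laplacian phi p * u p) + phi p * (W p * v p)) =
    tint (fun p => phi p * g p).

Lemma rL1_cont phi g : continuous phi -> rL1 g -> rL1 (fun p => phi p * g p).
Proof. by move=> /continuous_bmeas[M bM]; exact: rL1M bM. Qed.

Lemma tint_approx phi psi g e : continuous phi -> continuous psi -> rL1 g ->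
  (forall p, T2 p -> `|phi p - psi p| <= e) ->
  `|tint (fun p => phi p * g p) - tint (fun p => psi p * g p)| <=
  e * tint (fun p => `|g p|).
Proof.
move=> cphi cpsi ig h.
rewrite -tintB; try exact: rL1_cont.
rewrite (@tint_eq _ _ (fun p => (phi p - psi p) * g p)); last first.
  by move=> p _; rewrite mulrBl.
apply: tintM_bound => //; split => //.
apply: measurable_funB.
  exact: (measurable_funS _ _ (continuous_measurable2 cphi)).
exact: (measurable_funS _ _ (continuous_measurable2 cpsi)).
Qed.

Lemma eq0_of_small x c : 0 <= c -> (forall e, 0 < e -> `|x| <= e * c) -> x = 0.
Proof.
move=> c0 h; apply/eqP; rewrite -normr_eq0 eq_le normr_ge0 andbT leNgt.
apply/negP => x0; have c1 : 0 < c + 1 by rewrite ltr_wpDl.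
have := h (`|x| / (c + 1)) (divr_gt0 x0 c1).
rewrite leNgt => /negP; apply; rewrite -mulrA gtr_pMr// mulrC ltr_pdivrMr// mul1r.
by rewrite ltrDl.
Qed.

Definition even_ext f x := f `|x|.
(** In this form the extension is continuous as soon as f is, even where f 0 is
    not zero. *)
Definition odd_ext f x := f (Num.max x 0) - f (Num.max (- x) 0).

Lemma odd_extE f x : f 0 = 0 -> odd_ext f x = Num.sg x * f `|x|.
Proof.
move=> f0; rewrite /odd_ext.
have [h|h|->] : [\/ x < 0, 0 < x | x = 0].
  by have [h|h|h] := ltrgtP x 0; [apply: Or31|apply: Or32|apply: Or33].
- have -> : Num.max x 0 = 0 by apply/max_idPr; exact: ltW.
  have -> : Num.max (- x) 0 = - x by apply/max_idPl; rewrite oppr_ge0 ltW.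
  by rewrite ltr0_sg// ltr0_norm// f0 sub0r mulN1r.
- have -> : Num.max x 0 = x by apply/max_idPl; exact: ltW.
  have -> : Num.max (- x) 0 = 0 by apply/max_idPr; rewrite oppr_le0 ltW.
  by rewrite gtr0_sg// gtr0_norm// f0 subr0 mul1r.
- by rewrite sgr0 mul0r oppr0 subrr.
Qed.

Lemma continuous_even_ext f : continuous f -> continuous (even_ext f).
Proof. by move=> cf; apply: continuous_compf => // x; exact: norm_continuous. Qed.

Lemma continuous_max0 : continuous (fun x => Num.max x 0).
Proof.
move=> x; have c : {for x, continuous (fun=> 0 : R)} by exact: cst_continuous.
have cid : {for x, continuous (fun y : R => y)} by exact: cvg_id.
exact: (continuous_max cid c).
Qed.

Lemma continuous_odd_ext f : continuous f -> continuous (odd_ext f).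
Proof.
move=> cf x; apply: continuousB.
  by apply: (continuous_compf cf continuous_max0).
apply: (continuous_compf cf); apply: (continuous_compf continuous_max0).
exact: opp_continuous.
Qed.

(** The summand 0 keeps the affine argument of [der_cos_affine]. *)
Definition cosk (k : nat) y : R := cos (k%:R * y + 0).
Definition sink (k : nat) y : R := sin (k%:R * y + 0).

Lemma der_cosk k y : is_derive y 1 (cosk k) (- k%:R * sink k y).
Proof. exact: der_cos_affine. Qed.

Lemma der_sink k y : is_derive y 1 (sink k) (k%:R * cosk k y).
Proof. exact: der_sin_affine. Qed.

Lemma cosk_le1 k y : `|cosk k y| <= 1.
Proof. by rewrite ler_norml cos_geN1 cos_le1. Qed.

Lemma sink_le1 k y : `|sink k y| <= 1.
Proof. by rewrite ler_norml sin_geN1 sin_le1. Qed.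

Lemma continuous_cosk k : continuous (cosk k).
Proof. exact: is_derive_continuous (der_cosk k). Qed.

Lemma continuous_sink k : continuous (sink k).
Proof. exact: is_derive_continuous (der_sink k). Qed.

Section Mode.
Variable k : nat.

Section SmoothProfile.
Variables a a1 a2 : R -> R.
Hypotheses (sa : smooth a) (pa : periodic2pi a).
Hypotheses (da : forall x, is_derive x 1 a (a1 x)).
Hypotheses (da1 : forall x, is_derive x 1 a1 (a2 x)).

Let phi := tensor a (cosk k).
Let tphi : test_function phi.
Proof.
apply: test_function_tensor => //; [exact: (smooth_trig _ _).1|exact: periodic_cosk].
Qed.
Let Dx : (fun p => 'D_(dir_x R) phi p) = tensor a1 (cosk k).
Proof. by apply/funext => p; exact: (tensor_dx _ _ da).2. Qed.
Let Dy : (fun p => 'D_(dir_y R) phi p) = tensor a (fun y => - k%:R * sink k y).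
Proof. by apply/funext => p; exact: (tensor_dy _ _ (der_cosk k)).2. Qed.
Let Dxx : (fun p => 'D_(dir_x R) (tensor a1 (cosk k)) p) = tensor a2 (cosk k).
Proof. by apply/funext => p; exact: (tensor_dx _ _ da1).2. Qed.
Let Dyy : (fun p => 'D_(dir_y R) (tensor a (fun y => - k%:R * sink k y)) p) =
  tensor a (fun y => - k%:R * (k%:R * cosk k y)).
Proof.
apply/funext => p; apply: (tensor_dy _ _ _).2 => y.
exact: (derZ (- k%:R) (der_sink k y)).
Qed.

Let ca : continuous a. Proof. exact: is_derive_continuous da. Qed.
Let ca1 : continuous a1. Proof. exact: is_derive_continuous da1. Qed.
Let ca2 : continuous a2. Proof. exact: (smooth_derive da1 (smooth_derive da sa) 0%N). Qed.

Lemma smooth_mode_gradient u ux uy : rL1 u -> rL1 ux -> rL1 uy ->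
  rweak (dir_x R) u ux -> rweak (dir_y R) u uy ->
  tint (fun p => tensor a1 (cosk k) p * ux p) -
    k%:R * tint (fun p => tensor a (sink k) p * uy p) =
  - tint (fun p => tensor a2 (cosk k) p * u p) +
    k%:R ^+ 2 * tint (fun p => tensor a (cosk k) p * u p).
Proof.
move=> iu iux iuy wx wy.
have tx := test_function_dx tphi; have ty := test_function_dy tphi.
have := wx _ tx; rewrite Dx => hx; have := wy _ ty; rewrite Dy => hy.
have ck := @continuous_cosk k; have sk := @continuous_sink k.
have e1 : tint (fun p => tensor a (fun y => - k%:R * sink k y) p * uy p) =
    - k%:R * tint (fun p => tensor a (sink k) p * uy p).
  rewrite -tintZ; last by apply: rL1_cont => //; exact: continuous_tensor ca sk.
  by apply: tint_eq => p _; rewrite /tensor; ring.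
have e2 : tint (fun p => 'D_(dir_y R) (tensor a (fun y => - k%:R * sink k y)) p * u p) =
    - k%:R ^+ 2 * tint (fun p => tensor a (cosk k) p * u p).
  rewrite -tintZ; last by apply: rL1_cont => //; exact: continuous_tensor ca ck.
  apply: tint_eq => p _; have := congr1 (fun F : R * R -> R => F p) Dyy => /= ->.
  by rewrite /tensor; ring.
have r1 : tint (fun p => 'D_(dir_x R) phi p * ux p) =
    tint (fun p => tensor a1 (cosk k) p * ux p).
  by apply: tint_eq => p _; have := congr1 (fun F : R * R -> R => F p) Dx => /= ->.
have r2 : tint (fun p => 'D_(dir_y R) phi p * uy p) =
    tint (fun p => tensor a (fun y => - k%:R * sink k y) p * uy p).
  by apply: tint_eq => p _; have := congr1 (fun F : R * R -> R => F p) Dy => /= ->.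
have e3 : tint (fun p => 'D_(dir_x R) (tensor a1 (cosk k)) p * u p) =
    tint (fun p => tensor a2 (cosk k) p * u p).
  by apply: tint_eq => p _; have := congr1 (fun F : R * R -> R => F p) Dxx => /= ->.
move: hx hy; rewrite r1 r2 e1 e2 e3.
have ar (K X1 X2 Y1 Y2 : R) : X2 = - X1 -> - K ^+ 2 * Y2 = - (- K * Y1) ->
    X1 - K * Y1 = - X2 + K ^+ 2 * Y2.
  move=> -> h; have -> : K ^+ 2 * Y2 = - K * Y1 by rewrite -[LHS]opprK -mulNr h opprK.
  by rewrite opprK mulNr.
exact: ar.
Qed.

Lemma smooth_mode_damped W u v g : rL1 u -> rrepresents W u v g ->
  - tint (fun p => tensor a2 (cosk k) p * u p) +
    k%:R ^+ 2 * tint (fun p => tensor a (cosk k) p * u p) +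
    tint (fun p => tensor a (cosk k) p * (W p * v p)) =
  tint (fun p => tensor a (cosk k) p * g p).
Proof.
move=> iu [iW h]; rewrite -(h _ tphi).
have ck := @continuous_cosk k.
have i1 := rL1_cont (continuous_tensor ca2 ck) iu.
have i2 := rL1_cont (continuous_tensor ca ck) iu.
have i3 := rL1_cont (continuous_tensor ca ck) iW.
have L p : laplacian phi p = tensor a2 (cosk k) p - k%:R ^+ 2 * tensor a (cosk k) p.
  rewrite /laplacian Dx Dy.
  have := congr1 (fun F : R * R -> R => F p) Dxx => /= ->; have := congr1 (fun F : R * R -> R => F p) Dyy => /= ->.
  by rewrite /tensor; ring.
rewrite -tintN// -tintZ// -tintD; [|exact: rL1N|exact: rL1Z].
rewrite -tintD//; last by apply: rL1D; [exact: rL1N|exact: rL1Z].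
by apply: tint_eq => p _; rewrite L /phi; ring.
Qed.

End SmoothProfile.

Section Profile.
Variables f f1 f2 : R -> R.
Hypotheses (df : forall x, is_derive x 1 f (f1 x)).
Hypotheses (df1 : forall x, is_derive x 1 f1 (f2 x)).
Hypotheses (cf2 : continuous f2) (f10 : f1 0 = 0) (f1pi : f1 pi = 0).

Let cf : continuous f. Proof. exact: is_derive_continuous df. Qed.
Let cf1 : continuous f1. Proof. exact: is_derive_continuous df1. Qed.
Let ck := @continuous_cosk k.
Let sk := @continuous_sink k.

Let approx e : 0 < e -> exists a a1 a2 : R -> R,
  [/\ [/\ smooth a, periodic2pi a, forall x, is_derive x 1 a (a1 x) &
          forall x, is_derive x 1 a1 (a2 x)],
      forall p, T2 p -> `|tensor a (cosk k) p - tensor (even_ext f) (cosk k) p| <= e,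
      forall p, T2 p -> `|tensor a (sink k) p - tensor (even_ext f) (sink k) p| <= e,
      forall p, T2 p -> `|tensor a1 (cosk k) p - tensor (odd_ext f1) (cosk k) p| <= e &
      forall p, T2 p -> `|tensor a2 (cosk k) p - tensor (even_ext f2) (cosk k) p| <= e].
Proof.
move=> e0; have [a [a1 [a2 [sa pa [da da1] h]]]] :=
  smooth_even_approx df df1 cf2 f10 f1pi e0.
have key (b c t : R) : `|b - c| <= e -> `|t| <= 1 -> `|b * t - c * t| <= e.
  by move=> h1 h2; rewrite -mulrBl normrM -[e]mulr1; apply: ler_pM.
have TI p : T2 p -> - pi <= p.1 <= pi.
  by case=> /=; rewrite in_itv /= => /andP[h1 h2] _; rewrite h1 ltW.
exists a, a1, a2; split=> //.
- by move=> p /TI /h [h1 _ _]; apply: key => //; exact: cosk_le1.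
- by move=> p /TI /h [h1 _ _]; apply: key => //; exact: sink_le1.
- by move=> p /TI /h [_ h1 _]; apply: key; [rewrite odd_extE|exact: cosk_le1].
- by move=> p /TI /h [_ _ h1]; apply: key => //; exact: cosk_le1.
Qed.

(** Green's formula against the mode f(x) cos(k y), with f even and of class C^2
    on the circle: for a smooth f the mode is a test function, and the general
    case follows by uniform approximation of f. *)
Lemma mode_gradient u ux uy : rL1 u -> rL1 ux -> rL1 uy ->
  rweak (dir_x R) u ux -> rweak (dir_y R) u uy ->
  tint (fun p => tensor (odd_ext f1) (cosk k) p * ux p) -
    k%:R * tint (fun p => tensor (even_ext f) (sink k) p * uy p) =
  - tint (fun p => tensor (even_ext f2) (cosk k) p * u p) +
    k%:R ^+ 2 * tint (fun p => tensor (even_ext f) (cosk k) p * u p).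
Proof.
move=> iu iux iuy wx wy; apply/eqP; rewrite -subr_eq0; apply/eqP.
pose K := tint (fun p => `|ux p|) + k%:R * tint (fun p => `|uy p|) +
  tint (fun p => `|u p|) + k%:R ^+ 2 * tint (fun p => `|u p|).
have t0 (h : R * R -> R) : 0 <= tint (fun p => `|h p|) by exact: tint_ge0.
have kk : 0 <= k%:R :> R by [].
have kk2 : 0 <= k%:R ^+ 2 :> R by exact: sqr_ge0.
apply: (@eq0_of_small _ K).
  have := mulr_ge0 kk (t0 uy); have := mulr_ge0 kk2 (t0 u).
  by have := t0 ux; have := t0 u; rewrite /K; lra.
move=> e e0; have [a [a1 [a2 [[sa pa da da1] h0 hs h1 h2]]]] := approx e0.
have := smooth_mode_gradient sa pa da da1 iu iux iuy wx wy.
have cex := continuous_even_ext cf; have cox := continuous_odd_ext cf1.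
have cex2 := continuous_even_ext cf2.
have := tint_approx (continuous_tensor (is_derive_continuous da1) ck) (continuous_tensor cox ck) iux h1.
have := tint_approx (continuous_tensor (is_derive_continuous da) sk) (continuous_tensor cex sk) iuy hs.
have := tint_approx (continuous_tensor (smooth_derive da1 (smooth_derive da sa) 0%N) ck) (continuous_tensor cex2 ck) iu h2.
have := tint_approx (continuous_tensor (is_derive_continuous da) ck) (continuous_tensor cex ck) iu h0.
rewrite /K; set A1 := tint _; set A2 := tint _; set A3 := tint _.
set A4 := tint _; set A5 := tint _; set A6 := tint _; set A7 := tint _.
set A8 := tint _; set A9 := tint _; set A10 := tint _; set A11 := tint _.
move=> q1 q2 q3 q4 E.
have kq2 : `|k%:R * (A6 - A7)| <= k%:R * (e * A8).
  by rewrite normrM (ger0_norm kk) ler_wpM2l.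
have kq1 : `|k%:R ^+ 2 * (A1 - A2)| <= k%:R ^+ 2 * (e * A3).
  by rewrite normrM (ger0_norm kk2) ler_wpM2l.
move: kq1 kq2 q2 q4; rewrite !ler_norml => /andP[? ?] /andP[? ?] /andP[? ?] /andP[? ?].
by apply/andP; split; lra.
Qed.

(** The same approximation, in the equation - Delta u + W v = g. *)
Lemma mode_damped W u v g : rL1 u -> rL1 g -> rrepresents W u v g ->
  - tint (fun p => tensor (even_ext f2) (cosk k) p * u p) +
    k%:R ^+ 2 * tint (fun p => tensor (even_ext f) (cosk k) p * u p) +
    tint (fun p => tensor (even_ext f) (cosk k) p * (W p * v p)) =
  tint (fun p => tensor (even_ext f) (cosk k) p * g p).
Proof.
move=> iu ig rep; apply/eqP; rewrite -subr_eq0; apply/eqP.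
have iW := rep.1.
pose K := tint (fun p => `|u p|) + k%:R ^+ 2 * tint (fun p => `|u p|) +
  tint (fun p => `|W p * v p|) + tint (fun p => `|g p|).
have t0 (h : R * R -> R) : 0 <= tint (fun p => `|h p|) by exact: tint_ge0.
have kk2 : 0 <= k%:R ^+ 2 :> R by exact: sqr_ge0.
apply: (@eq0_of_small _ K).
  have := mulr_ge0 kk2 (t0 u); have := t0 u; have := t0 g.
  by have := t0 (fun p => W p * v p); rewrite /K; lra.
move=> e e0; have [a [a1 [a2 [[sa pa da da1] h0 hs h1 h2]]]] := approx e0.
have := smooth_mode_damped sa pa da da1 iu rep.
have cex := continuous_even_ext cf.
have cex2 := continuous_even_ext cf2.
have := tint_approx (continuous_tensor (smooth_derive da1 (smooth_derive da sa) 0%N) ck) (continuous_tensor cex2 ck) iu h2.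
have := tint_approx (continuous_tensor (is_derive_continuous da) ck) (continuous_tensor cex ck) iu h0.
have := tint_approx (continuous_tensor (is_derive_continuous da) ck) (continuous_tensor cex ck) iW h0.
have := tint_approx (continuous_tensor (is_derive_continuous da) ck) (continuous_tensor cex ck) ig h0.
rewrite /K; set A1 := tint _; set A2 := tint _; set A3 := tint _.
set A4 := tint _; set A5 := tint _; set A6 := tint _; set A7 := tint _.
set A8 := tint _; set A9 := tint _; set A10 := tint _; set A11 := tint _.
move=> q1 q2 q3 q4 E.
have kq3 : `|k%:R ^+ 2 * (A7 - A8)| <= k%:R ^+ 2 * (e * A9).
  by rewrite normrM (ger0_norm kk2) ler_wpM2l.
move: q1 q2 kq3 q4; rewrite !ler_norml => /andP[? ?] /andP[? ?] /andP[? ?] /andP[? ?].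
by apply/andP; split; lra.
Qed.

End Profile.
End Mode.
End WeakIdentities.

(** * Square-integrable functions *)

Section SquareIntegrable.
Context {R : realType}.
Implicit Types (f g h m phi : R * R -> R) (u v w z : R * R -> R[i]) (c : R[i]) (r : R).
Local Notation T2 := (@torus R).
Local Notation mA := (@area R).
Let TR : measurableType _ := measurableTypeR R.
Local Notation mfun2 f := (@measurable_fun _ _ (TR * TR)%type R T2 f).

Definition rL2 g := mfun2 g /\ rL1 (fun p => g p ^+ 2).

Lemma rL1_const r : rL1 (fun=> r).
Proof.
by apply: (@rL1_bmeas _ `|r|).
Qed.

Lemma rL2_rL1 g : rL2 g -> rL1 g.
Proof.
move=> [mg ig]; apply: (@rL1_le _ _ (fun p => 1 + g p ^+ 2)) => //.
  by apply: rL1D => //; exact: rL1_const.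
move=> p _; have := sqr_ge0 (`|g p| - 1); rewrite sqrrB1 real_normK ?num_real//.
have := normr_ge0 (g p); lra.
Qed.

(** Cauchy-Schwarz against 1, from 2 t |g| <= g^2 + t^2 with the optimal t. *)
Lemma rL2_norm1 g : rL2 g ->
  tint (fun p => `|g p|) <= 2 * pi * Num.sqrt (tint (fun p => g p ^+ 2)).
Proof.
move=> hg; have ig := rL2_rL1 hg; have i2 := hg.2.
set G := tint (fun p => g p ^+ 2).
have G0 : 0 <= G by apply: tint_ge0 => p _; exact: sqr_ge0.
have pi0 := pi_gt0 R.
have pin : pi != 0 :> R by exact: lt0r_neq0.
have key t : 0 < t -> tint (fun p => `|g p|) <= t / 2 * (2 * pi) ^+ 2 + (2 * t)^-1 * G.
  move=> t0; rewrite -tint_cst /G -tintZ// -tintD; [|exact: rL1_const|exact: rL1Z].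
  apply: tint_le => [||p _].
  - exact: rL1_norm.
  - by apply: rL1D; [exact: rL1_const|exact: rL1Z].
  - have := sqr_ge0 (`|g p| - t); rewrite sqrrB real_normK ?num_real// => h0.
    have e : (2 * t)^-1 * g p ^+ 2 + t / 2 - `|g p| =
        (2 * t)^-1 * (g p ^+ 2 - `|g p| * t *+ 2 + t ^+ 2).
      by rewrite -mulr_natr; field; exact: lt0r_neq0.
    have : 0 <= (2 * t)^-1 * (g p ^+ 2 - `|g p| * t *+ 2 + t ^+ 2).
      by rewrite mulr_ge0// invr_ge0 mulr_ge0// ltW.
    by rewrite -e; lra.
have [Gz|Gp] := leP G 0.
  have Ge : G = 0 by apply/eqP; rewrite eq_le Gz G0.
  rewrite Ge sqrtr0 mulr0; apply/ler_addgt0Pr => e e0; rewrite add0r.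
  have t0 : 0 < e / (2 * pi ^+ 2) by rewrite divr_gt0// mulr_gt0// exprn_gt0.
  apply: (le_trans (key _ t0)); rewrite Ge mulr0 addr0 le_eqVlt; apply/orP; left.
  by apply/eqP; move: (pi : R) pin => q qn; field.
have s0 : 0 < Num.sqrt G by rewrite sqrtr_gt0.
have t0 : 0 < Num.sqrt G / (2 * pi) by rewrite divr_gt0// mulr_gt0.
apply: (le_trans (key _ t0)).
have -> : (2 * (Num.sqrt G / (2 * pi)))^-1 * G = pi * Num.sqrt G.
  rewrite -{2}(sqr_sqrtr (ltW Gp)); move: (Num.sqrt G) s0 (pi : R) pin => s s0 q qn.
  by field; rewrite qn lt0r_neq0.
by rewrite le_eqVlt; apply/orP; left; apply/eqP; move: (pi : R) pin => q qn; field.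
Qed.

Lemma rL2D f g : rL2 f -> rL2 g -> rL2 (fun p => f p + g p).
Proof.
move=> [mf i_f] [mg i_g]; have mfg := measurable_funD mf mg; split => //.
apply: (@rL1_le _ _ (fun p => 2 * f p ^+ 2 + 2 * g p ^+ 2)).
- exact: measurable_funX.
- by apply: rL1D; exact: rL1Z.
- move=> p _; rewrite ger0_norm ?sqr_ge0//.
  by have := sqr_ge0 (f p - g p); lra.
Qed.

Lemma rL2Z r f : rL2 f -> rL2 (fun p => r * f p).
Proof.
move=> [mf i_f]; split; first by apply: measurable_funM => //; exact: measurable_cst.
by apply: (@rL1_eq _ (fun p => r ^+ 2 * f p ^+ 2)) (rL1Z _ i_f) => p _; rewrite exprMn.
Qed.

Lemma rL2_bmeas M f : bmeas M f -> rL2 f.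
Proof.
move=> [mf bf]; split => //; apply: (@rL1_bmeas _ (M ^+ 2)); split.
  exact: measurable_funX.
move=> p Tp; rewrite normrX ler_pXn2r ?nnegrE ?bf//.
exact: le_trans (bf p Tp).
Qed.

Definition re u p := complex.Re (u p).
Definition im u p := complex.Im (u p).

Lemma sqabs_ge0 (z : R[i]) : 0 <= sqabs z.
Proof. by rewrite /sqabs addr_ge0// sqr_ge0. Qed.

Lemma L2P u : L2 u <-> rL2 (re u) /\ rL2 (im u).
Proof.
split=> [[m1 m2 h]|[[m1 i1] [m2 i2]]].
  have i : rL1 (fun p => sqabs (u p)).
    apply/integrableP; split.
      apply/measurable_EFinP.
      by apply: measurable_funD; exact: measurable_funX.
    apply: le_lt_trans h; rewrite le_eqVlt; apply/orP; left; apply/eqP.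
    by apply: eq_integral => p _ /=; rewrite ger0_norm ?sqabs_ge0.
  split; split => //; apply: (rL1_le _ i); try exact: measurable_funX.
    by move=> p _; rewrite ger0_norm ?sqr_ge0// /sqabs lerDl sqr_ge0.
  by move=> p _; rewrite ger0_norm ?sqr_ge0// /sqabs lerDr sqr_ge0.
split => //.
have i : rL1 (fun p => sqabs (u p)) by exact: rL1D.
case/integrableP : i => _; apply: le_lt_trans.
rewrite le_eqVlt; apply/orP; left; apply/eqP.
by apply: eq_integral => p _ /=; rewrite ger0_norm ?sqabs_ge0.
Qed.

Lemma L2_rL1 u : L2 u -> rL1 (re u) /\ rL1 (im u).
Proof. by move=> /L2P[/rL2_rL1 ? /rL2_rL1 ?]. Qed.

Lemma L2_sqabs u : L2 u -> rL1 (fun p => sqabs (u p)).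
Proof. by move=> /L2P[[_ h1] [_ h2]]; exact: rL1D. Qed.

Lemma re_lin c u v : re (fun p => c * u p + v p) =
  (fun p => complex.Re c * re u p + (- complex.Im c) * im u p + re v p).
Proof.
by apply/funext => p; rewrite /re /im; case: c => a b; case: (u p) => x y;
  case: (v p) => x' y' /=; ring.
Qed.

Lemma im_lin c u v : im (fun p => c * u p + v p) =
  (fun p => complex.Re c * im u p + complex.Im c * re u p + im v p).
Proof.
by apply/funext => p; rewrite /re /im; case: c => a b; case: (u p) => x y;
  case: (v p) => x' y' /=; ring.
Qed.

Lemma L2_lin c u v : L2 u -> L2 v -> L2 (fun p => c * u p + v p).
Proof.
move=> /L2P[ru iu] /L2P[rv iv]; apply/L2P; rewrite re_lin im_lin.
by split; apply: rL2D => //; apply: rL2D; exact: rL2Z.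
Qed.

Lemma re_scale phi u : re (fun p => (phi p)%:C%C * u p) = (fun p => phi p * re u p).
Proof. by apply/funext => p; rewrite /re; case: (u p) => x y /=; ring. Qed.

Lemma im_scale phi u : im (fun p => (phi p)%:C%C * u p) = (fun p => phi p * im u p).
Proof. by apply/funext => p; rewrite /im; case: (u p) => x y /=; ring. Qed.

Lemma cint_scale phi u : cint (fun p => (phi p)%:C%C * u p) =
  Complex (tint (fun p => phi p * re u p)) (tint (fun p => phi p * im u p)).
Proof. by rewrite -re_scale -im_scale. Qed.

Lemma weak_partialP d u v : weak_partial d u v <->
  rweak d (re u) (re v) /\ rweak d (im u) (im v).
Proof.
split=> [h|[h1 h2] phi tphi].
  by split=> phi tphi; have := h phi tphi; rewrite !cint_scale => -[].
by rewrite !cint_scale h1// h2.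
Qed.

Lemma representsP W u v w : represents_damped_laplacian W u v w <->
  rrepresents W (re u) (re v) (re w) /\ rrepresents W (im u) (im v) (im w).
Proof.
have e phi : cint (fun p => - ((laplacian phi p)%:C%C * u p)
                   + (phi p)%:C%C * ((W p)%:C%C * v p)) =
    Complex (tint (fun p => - (laplacian phi p * re u p) + phi p * (W p * re v p)))
            (tint (fun p => - (laplacian phi p * im u p) + phi p * (W p * im v p))).
  by congr Complex; apply: tint_eq => p _; rewrite /re /im;
    case: (u p) => x y; case: (v p) => x' y' /=; ring.
have eL : L1 (fun p => (W p)%:C%C * v p) <->
    rL1 (fun p => W p * re v p) /\ rL1 (fun p => W p * im v p).
  by rewrite -re_scale -im_scale.
split=> [[/eL[i1 i2] h]|[[i1 h1] [i2 h2]]].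
  by split; split => // phi tphi; have := h phi tphi; rewrite e cint_scale => -[].
split; first exact/eL.
by move=> phi tphi; rewrite e cint_scale h1// h2.
Qed.

Lemma rweak_unique d f g h : rL1 g -> rL1 h -> rweak d f g -> rweak d f h ->
  ae_eq mA T2 g h.
Proof.
move=> ig ih wg wh.
have : ae_eq mA T2 (fun p => g p - h p) (fun=> 0).
  apply: fundamental_lemma => [|phi tphi]; first exact: rL1B.
  have cphi := test_function_cont tphi.
  rewrite (@tint_eq _ _ (fun p => phi p * g p - phi p * h p)); last first.
    by move=> p _; rewrite mulrBr.
  rewrite tintB; try exact: rL1_cont.
  by have := wg _ tphi; rewrite (wh _ tphi) => /oppr_inj ->; rewrite subrr.
by apply: filterS => p /[apply] /eqP; rewrite subr_eq0 => /eqP.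
Qed.

Lemma ae_complex u v : ae_eq mA T2 (re u) (re v) -> ae_eq mA T2 (im u) (im v) ->
  ae_eq mA T2 u v.
Proof.
apply: filterS2 => p h1 h2 Tp; have := h1 Tp; have := h2 Tp; rewrite /re /im.
by case: (u p) => ? ?; case: (v p) => ? ? /= -> ->.
Qed.

Lemma ae_re u v : ae_eq mA T2 u v -> ae_eq mA T2 (re u) (re v).
Proof. by apply: filterS => p /[apply]; rewrite /re => ->. Qed.

Lemma ae_im u v : ae_eq mA T2 u v -> ae_eq mA T2 (im u) (im v).
Proof. by apply: filterS => p /[apply]; rewrite /im => ->. Qed.

Lemma weak_partial_unique d u v w : L2 v -> L2 w -> weak_partial d u v ->
  weak_partial d u w -> ae_eq mA T2 v w.
Proof.
move=> /L2_rL1[rv iv] /L2_rL1[rw iw] /weak_partialP[a1 a2] /weak_partialP[b1 b2].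
by apply: ae_complex; [exact: rweak_unique a1 b1|exact: rweak_unique a2 b2].
Qed.

Lemma rrepresents_unique W f m g h : rL1 g -> rL1 h -> rrepresents W f m g ->
  rrepresents W f m h -> ae_eq mA T2 g h.
Proof.
move=> ig ih [_ wg] [_ wh].
have : ae_eq mA T2 (fun p => g p - h p) (fun=> 0).
  apply: fundamental_lemma => [|phi tphi]; first exact: rL1B.
  have cphi := test_function_cont tphi.
  rewrite (@tint_eq _ _ (fun p => phi p * g p - phi p * h p)); last first.
    by move=> p _; rewrite mulrBr.
  by rewrite tintB; [rewrite -(wg _ tphi) -(wh _ tphi) subrr|exact: rL1_cont|exact: rL1_cont].
by apply: filterS => p /[apply] /eqP; rewrite subr_eq0 => /eqP.
Qed.

Lemma represents_unique W u v w z : L2 w -> L2 z ->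
  represents_damped_laplacian W u v w -> represents_damped_laplacian W u v z ->
  ae_eq mA T2 w z.
Proof.
move=> /L2_rL1[rv iv] /L2_rL1[rw iw] /representsP[a1 a2] /representsP[b1 b2].
by apply: ae_complex; [exact: rrepresents_unique a1 b1|exact: rrepresents_unique a2 b2].
Qed.

Lemma normL2_ae u v : L2 u -> L2 v -> ae_eq mA T2 u v -> normL2 u = normL2 v.
Proof.
move=> Lu Lv h; congr Num.sqrt; apply: tint_ae.
- by have := rL1_measurable (L2_sqabs Lu).
- by have := rL1_measurable (L2_sqabs Lv).
- by apply: filterS h => p /[apply] ->.
Qed.


End SquareIntegrable.

(** * Norms and energy of states *)

Section States.
Context {R : realType}.
Implicit Types (f g h m phi : R * R -> R) (u v w z : R * R -> R[i]) (c : R[i]).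
Implicit Types (W : R * R -> R) (d : R * R) (X Y : state R).
Local Notation T2 := (@torus R).
Local Notation mA := (@area R).

Definition is_dir d := d = dir_x R \/ d = dir_y R.

Lemma test_function_dir d phi : is_dir d -> test_function phi ->
  test_function (fun p => 'D_d phi p).
Proof. by case=> -> ; [exact: test_function_dx|exact: test_function_dy]. Qed.

Lemma cont_dir d phi : is_dir d -> test_function phi -> continuous (fun p => 'D_d phi p).
Proof. by move=> hd tphi; exact: test_function_cont (test_function_dir hd tphi). Qed.

Lemma continuousDf f g : continuous f -> continuous g -> continuous (fun p => f p + g p).
Proof. by move=> cf cg p; exact: (cvgD (cf p) (cg p)). Qed.

Lemma continuous_laplacian phi : test_function phi -> continuous (fun p => laplacian phi p).
Proof.
move=> tphi.
have c1 := test_function_cont (test_function_dx (test_function_dx tphi)).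
have c2 := test_function_cont (test_function_dy (test_function_dy tphi)).
exact: (continuousDf c1 c2).
Qed.

Lemma tint_cont_ae m f g : continuous m -> rL1 f -> rL1 g -> ae_eq mA T2 f g ->
  tint (fun p => m p * f p) = tint (fun p => m p * g p).
Proof.
move=> cm i_f i_g h; apply: tint_ae.
- exact: rL1_measurable (rL1_cont cm i_f).
- exact: rL1_measurable (rL1_cont cm i_g).
- by apply: filterS h => p /[apply] ->.
Qed.

Lemma ae_sym (V : Type) (f g : R * R -> V) : ae_eq mA T2 f g -> ae_eq mA T2 g f.
Proof. by apply: filterS => p /[apply]. Qed.

Lemma ae_trans (V : Type) (f g h : R * R -> V) :
  ae_eq mA T2 f g -> ae_eq mA T2 g h -> ae_eq mA T2 f h.
Proof. by apply: filterS2 => p h1 h2 Tp; rewrite h1// h2. Qed.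

Lemma ae_refl (V : Type) (f : R * R -> V) : ae_eq mA T2 f f.
Proof. exact: aeW. Qed.

Lemma weak_partial_ae_l d u v w : is_dir d -> L2 u -> L2 v -> ae_eq mA T2 u v ->
  weak_partial d u w -> weak_partial d v w.
Proof.
move=> hd /L2_rL1[ru iu] /L2_rL1[rv iv] h /weak_partialP[w1 w2].
apply/weak_partialP; split=> phi tphi; rewrite -?w1 -?w2//;
  apply: tint_cont_ae => //; try exact: cont_dir.
- exact/ae_sym/ae_re.
- exact/ae_sym/ae_im.
Qed.

Lemma partialP d u : is_dir d -> H1 u -> L2 (partial d u) /\ weak_partial d u (partial d u).
Proof.
move=> hd [_ hx hy]; rewrite /partial; case: xgetP => [g _ //|nh]; exfalso.
by case: hd nh => -> nh; [case: hx => g|case: hy => g] => L w; apply: (nh g).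
Qed.

(** An equality everywhere: the derivative is chosen in a set which depends on
    the class of u only. *)
Lemma partial_ae d u v : is_dir d -> L2 u -> L2 v -> ae_eq mA T2 u v ->
  partial d u = partial d v.
Proof.
move=> hd Lu Lv h; rewrite /partial; congr (xget _ _).
apply/seteqP; split => g /= [Lg wg]; split => //.
  exact: (weak_partial_ae_l hd Lu Lv h).
exact: (weak_partial_ae_l hd Lv Lu (ae_sym h)).
Qed.

Lemma partial_ae_eq d u v : is_dir d -> H1 u -> L2 v -> weak_partial d u v ->
  ae_eq mA T2 (partial d u) v.
Proof.
by move=> hd hu Lv wv; have [Lp wp] := partialP hd hu; exact: weak_partial_unique wp wv.
Qed.

Lemma dx_dir : is_dir (dir_x R). Proof. by left. Qed.
Lemma dy_dir : is_dir (dir_y R). Proof. by right. Qed.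

Lemma H1_L2 u : H1 u -> L2 u. Proof. by case. Qed.

Lemma sqgrad_ae u v : L2 u -> L2 v -> ae_eq mA T2 u v -> sqgrad u = sqgrad v.
Proof.
move=> Lu Lv h; apply/funext => p; rewrite /sqgrad.
by rewrite (partial_ae dx_dir Lu Lv h) (partial_ae dy_dir Lu Lv h).
Qed.

Lemma norm_grad_ae u v : L2 u -> L2 v -> ae_eq mA T2 u v -> norm_grad u = norm_grad v.
Proof. by move=> Lu Lv h; rewrite /norm_grad (sqgrad_ae Lu Lv h). Qed.

Lemma normH1_ae u v : L2 u -> L2 v -> ae_eq mA T2 u v -> normH1 u = normH1 v.
Proof. by move=> Lu Lv h; rewrite /normH1 (norm_grad_ae Lu Lv h) (normL2_ae Lu Lv h). Qed.

Lemma rL1_sqgrad u : H1 u -> rL1 (sqgrad u).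
Proof.
move=> hu; have [Lx _] := partialP dx_dir hu; have [Ly _] := partialP dy_dir hu.
by apply: rL1D; exact: L2_sqabs.
Qed.

Lemma norm_state_ae X Y : in_energy_space X -> in_energy_space Y -> eq_state X Y ->
  norm_state X = norm_state Y.
Proof.
move=> [hX1 hX2] [hY1 hY2] [h1 h2]; rewrite /norm_state.
by rewrite (normH1_ae (H1_L2 hX1) (H1_L2 hY1) h1) (normL2_ae hX2 hY2 h2).
Qed.

Lemma energy_ae X Y : in_energy_space X -> in_energy_space Y -> eq_state X Y ->
  energy X = energy Y.
Proof.
move=> [hX1 hX2] [hY1 hY2] [h1 h2]; rewrite /energy; congr (_ * _).
apply: tint_ae.
- by have := rL1_measurable (rL1D (rL1_sqgrad hX1) (L2_sqabs hX2)).
- by have := rL1_measurable (rL1D (rL1_sqgrad hY1) (L2_sqabs hY2)).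
- rewrite (sqgrad_ae (H1_L2 hX1) (H1_L2 hY1) h1).
  by apply: filterS h2 => p /[apply] ->.
Qed.

Lemma norm_grad_ge0 u : 0 <= norm_grad u. Proof. exact: sqrtr_ge0. Qed.
Lemma normL2_ge0 u : 0 <= normL2 u. Proof. exact: sqrtr_ge0. Qed.
Lemma normH1_ge0 u : 0 <= normH1 u. Proof. exact: sqrtr_ge0. Qed.
Lemma norm_state_ge0 X : 0 <= norm_state X. Proof. exact: sqrtr_ge0. Qed.

Lemma le_sqrt_suml (a b : R) : 0 <= a -> a <= Num.sqrt (a ^+ 2 + b ^+ 2).
Proof.
move=> a0; have -> : a = Num.sqrt (a ^+ 2) by rewrite sqrtr_sqr ger0_norm.
by rewrite ler_wsqrtr// sqr_sqrtr ?sqr_ge0// lerDl sqr_ge0.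
Qed.

Lemma le_sqrt_sumr (a b : R) : 0 <= b -> b <= Num.sqrt (a ^+ 2 + b ^+ 2).
Proof. by move=> b0; rewrite addrC; exact: le_sqrt_suml. Qed.

Lemma sqrt_sum_le (a b : R) : 0 <= a -> 0 <= b -> Num.sqrt (a ^+ 2 + b ^+ 2) <= a + b.
Proof.
move=> a0 b0; rewrite -[a + b]ger0_norm ?addr_ge0// -sqrtr_sqr ler_wsqrtr//.
by have := mulr_ge0 a0 b0; rewrite sqrrD; lra.
Qed.

Lemma norm_grad_le_normH1 u : norm_grad u <= normH1 u.
Proof. by apply: le_sqrt_sumr; exact: norm_grad_ge0. Qed.

Lemma normH1_le_norm_state X : normH1 X.1 <= norm_state X.
Proof. by apply: le_sqrt_suml; exact: normH1_ge0. Qed.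

Lemma normL2_le_norm_state X : normL2 X.2 <= norm_state X.
Proof. by apply: le_sqrt_sumr; exact: normL2_ge0. Qed.

Lemma normL2_le_normH1 u : normL2 u <= normH1 u.
Proof. by apply: le_sqrt_suml; exact: normL2_ge0. Qed.

Definition density X p := sqgrad X.1 p + sqabs (X.2 p).

Lemma rL1_density X : in_energy_space X -> rL1 (density X).
Proof. by move=> [h1 h2]; apply: rL1D; [exact: rL1_sqgrad|exact: L2_sqabs]. Qed.

Lemma energyE X : energy X = 2^-1 * tint (density X).
Proof. by []. Qed.

Lemma sqgrad_ge0 u p : 0 <= sqgrad u p.
Proof. by rewrite addr_ge0// sqabs_ge0. Qed.

Lemma energy_le X : in_energy_space X ->
  Num.sqrt (energy X) <= norm_grad X.1 + normL2 X.2.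
Proof.
move=> hX; have [h1 h2] := hX.
apply: (le_trans _ (sqrt_sum_le (norm_grad_ge0 _) (normL2_ge0 _))).
rewrite ler_wsqrtr// energyE /norm_grad /normL2 !sqr_sqrtr.
- rewrite tintD; [|exact: rL1_sqgrad|exact: L2_sqabs].
  have a0 : 0 <= tint (sqgrad X.1) by apply: tint_ge0 => p _; exact: sqgrad_ge0.
  have b0 : 0 <= tint (fun p => sqabs (X.2 p)) by apply: tint_ge0 => p _; exact: sqabs_ge0.
  by move: a0 b0; rewrite /tint; lra.
- by apply: tint_ge0 => p _; exact: sqabs_ge0.
- by apply: tint_ge0 => p _; exact: sqgrad_ge0.
Qed.

(** Cauchy-Schwarz on the torus, whose area is finite. *)
Lemma component_le X f : in_energy_space X -> rL2 f ->
  (forall p, f p ^+ 2 <= density X p) ->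
  tint (fun p => `|f p|) <= 2 * pi * (2 * Num.sqrt (energy X)).
Proof.
move=> hX hf h; apply: (le_trans (rL2_norm1 hf)).
have pi0 := pi_gt0 R.
rewrite ler_wpM2l ?mulr_ge0 ?(ltW pi0)//.
have -> : 2 * Num.sqrt (energy X) = Num.sqrt (4 * energy X).
  have e4 : (4 : R) = 2 ^+ 2 by ring.
  have h4 : 0 <= (4 : R) by [].
  have h2 : Num.sqrt (4 : R) = 2 by rewrite e4 sqrtr_sqr ger0_norm.
  by rewrite (sqrtrM (energy X) h4) h2.
rewrite ler_wsqrtr//.
have i := rL1_density hX.
have h0 : tint (fun p => f p ^+ 2) <= tint (density X).
  by apply: tint_le => //; exact: hf.2.
have d0 : 0 <= tint (density X).
  by apply: tint_ge0 => p _; rewrite addr_ge0 ?sqgrad_ge0 ?sqabs_ge0.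
by rewrite energyE; lra.
Qed.

Lemma rweakD d f g (f' g' : R * R -> R) : is_dir d -> rL1 f -> rL1 g -> rL1 f' -> rL1 g' ->
  rweak d f f' -> rweak d g g' -> rweak d (fun p => f p + g p) (fun p => f' p + g' p).
Proof.
move=> hd i1 i2 i3 i4 w1 w2 phi tphi.
have c1 := cont_dir hd tphi; have c2 := test_function_cont tphi.
rewrite (@tint_eq _ _ (fun p => 'D_d phi p * f p + 'D_d phi p * g p)); last first.
  by move=> p _; rewrite mulrDr.
rewrite (@tint_eq _ (fun p => phi p * _) (fun p => phi p * f' p + phi p * g' p)); last first.
  by move=> p _; rewrite mulrDr.
rewrite tintD; try exact: rL1_cont.
rewrite tintD; try exact: rL1_cont.
by rewrite w1// w2// opprD.
Qed.

Lemma rweakZ d (r : R) f (f' : R * R -> R) : is_dir d -> rL1 f -> rL1 f' ->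
  rweak d f f' -> rweak d (fun p => r * f p) (fun p => r * f' p).
Proof.
move=> hd i1 i2 w1 phi tphi.
have c1 := cont_dir hd tphi; have c2 := test_function_cont tphi.
rewrite (@tint_eq _ _ (fun p => r * ('D_d phi p * f p))); last by move=> p _; ring.
rewrite (@tint_eq _ (fun p => phi p * _) (fun p => r * (phi p * f' p))); last by move=> p _; ring.
rewrite tintZ; last exact: rL1_cont.
rewrite tintZ; last exact: rL1_cont.
by rewrite w1// mulrN.
Qed.

Lemma weak_partial_lin d c u v w z : is_dir d -> L2 u -> L2 v -> L2 w -> L2 z ->
  weak_partial d u w -> weak_partial d v z ->
  weak_partial d (fun p => c * u p + v p) (fun p => c * w p + z p).
Proof.
move=> hd /L2_rL1[r1 i1] /L2_rL1[r2 i2] /L2_rL1[r3 i3] /L2_rL1[r4 i4].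
move=> /weak_partialP[a1 b1] /weak_partialP[a2 b2]; apply/weak_partialP.
rewrite !re_lin !im_lin.
by split; apply: rweakD => //; do ?[exact: rL1D|apply: rL1D => //; exact: rL1Z|apply: rL1D; exact: rL1Z];
  apply: rweakD => //; do ?[exact: rL1Z]; apply: rweakZ.
Qed.

Lemma H1_lin c u v : H1 u -> H1 v -> H1 (fun p => c * u p + v p).
Proof.
move=> [Lu [ux Lux wux] [uy Luy wuy]] [Lv [vx Lvx wvx] [vy Lvy wvy]]; split.
- exact: L2_lin.
- exists (fun p => c * ux p + vx p); first exact: L2_lin.
  exact: (weak_partial_lin c dx_dir).
- exists (fun p => c * uy p + vy p); first exact: L2_lin.
  exact: (weak_partial_lin c dy_dir).
Qed.

Lemma rrepresentsD W f g h (f' g' h' : R * R -> R) :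
  rL1 f -> rL1 f' -> rL1 h -> rL1 h' ->
  rrepresents W f g h -> rrepresents W f' g' h' ->
  rrepresents W (fun p => f p + f' p) (fun p => g p + g' p) (fun p => h p + h' p).
Proof.
move=> i1 i2 i3 i4 [j1 w1] [j2 w2]; split.
  by apply: (rL1_eq _ (rL1D j1 j2)) => p _; ring.
move=> phi tphi.
have c1 := continuous_laplacian tphi; have c2 := test_function_cont tphi.
pose A f g p := - (laplacian phi p * f p) + phi p * (W p * g p).
have iA a b : rL1 a -> rL1 (fun p => W p * b p) -> rL1 (A a b).
  move=> ia ib; apply: rL1D; last exact: rL1_cont.
  by apply: rL1N; exact: (rL1_cont c1).
rewrite (@tint_eq _ _ (fun p => A f g p + A f' g' p)); last by move=> p _; rewrite /A; ring.
rewrite tintD; [|exact: iA|exact: iA].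
rewrite w1// w2// -tintD; try exact: rL1_cont.
by apply: tint_eq => p _; ring.
Qed.

Lemma rrepresentsZ W (r : R) f g h : rL1 f -> rL1 h ->
  rrepresents W f g h ->
  rrepresents W (fun p => r * f p) (fun p => r * g p) (fun p => r * h p).
Proof.
move=> i1 i3 [j1 w1]; split.
  by apply: (rL1_eq _ (rL1Z r j1)) => p _; ring.
move=> phi tphi.
have c1 := continuous_laplacian tphi; have c2 := test_function_cont tphi.
pose A p := - (laplacian phi p * f p) + phi p * (W p * g p).
have iA : rL1 A.
  apply: rL1D; last exact: rL1_cont.
  by apply: rL1N; exact: (rL1_cont c1).
rewrite (@tint_eq _ _ (fun p => r * A p)); last by move=> p _; rewrite /A; ring.
rewrite tintZ// w1// -tintZ; last exact: rL1_cont.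
by apply: tint_eq => p _; ring.
Qed.

Lemma represents_lin W c u v w (u' v' w' : R * R -> R[i]) :
  L2 u -> L2 w -> L2 u' -> L2 w' ->
  represents_damped_laplacian W u v w -> represents_damped_laplacian W u' v' w' ->
  represents_damped_laplacian W (fun p => c * u p + u' p) (fun p => c * v p + v' p)
    (fun p => c * w p + w' p).
Proof.
move=> /L2_rL1[r1 i1] /L2_rL1[r2 i2] /L2_rL1[r3 i3] /L2_rL1[r4 i4].
move=> /representsP[a1 b1] /representsP[a2 b2]; apply/representsP.
rewrite !re_lin !im_lin.
by split; apply: rrepresentsD => //; do ?[apply: rL1D; exact: rL1Z];
  apply: rrepresentsD => //; do ?[exact: rL1Z]; apply: rrepresentsZ.
Qed.

Lemma damped_laplacianP W X : domain W X ->
  L2 (damped_laplacian W X.1 X.2) /\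
  represents_damped_laplacian W X.1 X.2 (damped_laplacian W X.1 X.2).
Proof.
move=> [_ _ [g Lg rg]]; rewrite /damped_laplacian.
by case: xgetP => [h _ //|nh]; exfalso; apply: (nh g).
Qed.

End States.

(** * The pairing of states with a mode *)

Section Modulus.
Context {R : realType}.
Implicit Types (z w : R[i]).

Definition cabs z := Num.sqrt (sqabs z).

Lemma cabsE z : cabs z = Normc.normc z.
Proof. by case: z. Qed.

Lemma cabs_ge0 z : 0 <= cabs z. Proof. exact: sqrtr_ge0. Qed.

Lemma cabsM z w : cabs (z * w) = cabs z * cabs w.
Proof. by rewrite !cabsE Normc.normcM. Qed.

Lemma cabsD z w : cabs (z + w) <= cabs z + cabs w.
Proof. by rewrite !cabsE le_normcD. Qed.

Lemma cabsN z : cabs (- z) = cabs z.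
Proof. by rewrite !cabsE normcN. Qed.

Lemma cabs_real (r : R) : cabs r%:C%C = `|r|.
Proof. by rewrite /cabs /sqabs /= expr0n addr0 sqrtr_sqr. Qed.

Lemma cabs_i : cabs (Complex 0 1 : R[i]) = 1.
Proof. by rewrite /cabs /sqabs /= expr0n add0r expr1n sqrtr1. Qed.

Lemma cabs_le z : cabs z <= `|complex.Re z| + `|complex.Im z|.
Proof.
rewrite /cabs /sqabs -[complex.Re z ^+ 2]real_normK ?num_real//.
by rewrite -[complex.Im z ^+ 2]real_normK ?num_real//; exact: sqrt_sum_le.
Qed.

Lemma Re_le_cabs z : `|complex.Re z| <= cabs z.
Proof. by rewrite -sqrtr_sqr ler_wsqrtr// /sqabs lerDl sqr_ge0. Qed.

End Modulus.

Section Multipliers.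
Context {R : realType}.
Implicit Types (m : R * R -> R) (u v : R * R -> R[i]) (c : R[i]).
Local Notation T2 := (@torus R).
Local Notation mA := (@area R).

Lemma continuousZ2 (r : R) m : continuous m -> continuous (fun p => r * m p).
Proof. by move=> cm p; apply: cvgM; [exact: cvg_cst|exact: cm]. Qed.

Definition mult m u : R[i] := cint (fun p => (m p)%:C%C * u p).

Definition cL1 u := rL1 (re u) /\ rL1 (im u).

Lemma L2_cL1 u : L2 u -> cL1 u. Proof. exact: L2_rL1. Qed.

Lemma mult_lin m c u v : continuous m -> cL1 u -> cL1 v ->
  mult m (fun p => c * u p + v p) = c * mult m u + mult m v.
Proof.
move=> cm [r1 i1] [r2 i2]; rewrite /mult !cint_scale re_lin im_lin.
have A := rL1_cont cm r1; have B := rL1_cont cm i1.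
have C := rL1_cont cm r2; have D := rL1_cont cm i2.
case: c => x y /=.
rewrite (@tint_eq _ _ (fun p => x * (m p * re u p) + (- y) * (m p * im u p) + m p * re v p)); last first.
  by move=> p _; ring.
rewrite (@tint_eq _ (fun p => m p * (x * im u p + _ + _))
   (fun p => x * (m p * im u p) + y * (m p * re u p) + m p * im v p)); last first.
  by move=> p _; ring.
have Z := @rL1Z R.
rewrite tintD//; last by apply: rL1D; exact: Z.
rewrite tintD; [|exact: Z|exact: Z].
rewrite tintD//; last by apply: rL1D; exact: Z.
rewrite tintD; [|exact: Z|exact: Z].
rewrite !tintZ//.
by apply/eqP; rewrite eq_complex /=; apply/andP; split; apply/eqP; ring.
Qed.

Lemma mult_linm m1 m2 (r : R) u : continuous m1 -> continuous m2 -> cL1 u ->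
  mult (fun p => r * m1 p + m2 p) u = r%:C%C * mult m1 u + mult m2 u.
Proof.
move=> c1 c2 [r1 i1]; rewrite /mult !cint_scale.
have A := rL1_cont c1 r1; have B := rL1_cont c1 i1.
have C := rL1_cont c2 r1; have D := rL1_cont c2 i1.
rewrite (@tint_eq _ _ (fun p => r * (m1 p * re u p) + m2 p * re u p)); last first.
  by move=> p _; ring.
rewrite (@tint_eq _ (fun p => (r * m1 p + _) * im u p)
   (fun p => r * (m1 p * im u p) + m2 p * im u p)); last first.
  by move=> p _; ring.
have Z := @rL1Z R.
rewrite tintD//; last exact: Z.
rewrite tintD//; last exact: Z.
rewrite !tintZ//.
by apply/eqP; rewrite eq_complex /=; apply/andP; split; apply/eqP; ring.
Qed.

Lemma mult_bound m M u : bmeas M m -> cL1 u ->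
  cabs (mult m u) <= M * (tint (fun p => `|re u p|) + tint (fun p => `|im u p|)).
Proof.
move=> bm [r1 i1]; apply: (le_trans (cabs_le _)); rewrite mulrDr /mult cint_scale /=.
by apply: lerD; exact: tintM_bound.
Qed.

Lemma mult_ae m u v : continuous m -> cL1 u -> cL1 v -> ae_eq mA T2 u v ->
  mult m u = mult m v.
Proof.
move=> cm [r1 i1] [r2 i2] h; rewrite /mult !cint_scale.
by congr Complex; apply: tint_cont_ae => //; [exact: ae_re|exact: ae_im].
Qed.

End Multipliers.

Section Functional.
Context {R : realType}.
Implicit Types (X Y : state R) (c : R[i]) (x : R).
Local Notation T2 := (@torus R).
Local Notation mA := (@area R).
Variables (k : nat) (lam : R) (a a1 a2 b b1 b2 : R -> R).
Hypotheses (da : forall x, is_derive x 1 a (a1 x)) (da1 : forall x, is_derive x 1 a1 (a2 x)).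
Hypotheses (db : forall x, is_derive x 1 b (b1 x)) (db1 : forall x, is_derive x 1 b1 (b2 x)).
Hypotheses (ca2 : continuous a2) (cb2 : continuous b2).
Hypotheses (a10 : a1 0 = 0) (a1pi : a1 pi = 0) (b10 : b1 0 = 0) (b1pi : b1 pi = 0).

Definition tE (f : R -> R) := tensor (even_ext f) (cosk k).
Definition helm (f f2 : R -> R) x := - f2 x + k%:R ^+ 2 * f x.

(** The bilinear energy pairing of a state with the mode (a + i b) cos(k y), to
    which the velocity - i lam (a + i b) cos(k y) is attached. The gradient term
    has been integrated by parts onto the mode, so that the pairing is defined
    without weak derivatives of the state. *)
Definition pairing X : R[i] :=
  mult (tE (helm a a2)) X.1 + Complex 0 1 * mult (tE (helm b b2)) X.1
  - Complex 0 1 * lam%:C%C * (mult (tE a) X.2 + Complex 0 1 * mult (tE b) X.2).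

Let cta f : continuous f -> continuous (tE f).
Proof.
by move=> cf; apply: continuous_tensor; [exact: continuous_even_ext|exact: continuous_cosk].
Qed.
Let c_a : continuous a. Proof. exact: is_derive_continuous da. Qed.
Let c_b : continuous b. Proof. exact: is_derive_continuous db. Qed.
Let chelm f f2 : continuous f -> continuous f2 -> continuous (helm f f2).
Proof.
move=> cf cf2 x; apply: cvgD; first by apply: cvgN; exact: cf2.
exact: (@continuousZf _ (k%:R ^+ 2) f cf x).
Qed.
Let cA : continuous (tE (helm a a2)). Proof. by apply: cta; exact: chelm. Qed.
Let cB : continuous (tE (helm b b2)). Proof. by apply: cta; exact: chelm. Qed.
Let ctEa := cta c_a.
Let ctEb := cta c_b.

Lemma pairing_lin c X Y : L2 X.1 -> L2 X.2 -> L2 Y.1 -> L2 Y.2 ->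
  pairing (add_state (scale_state c X) Y) = c * pairing X + pairing Y.
Proof.
move=> /L2_cL1 h1 /L2_cL1 h2 /L2_cL1 h3 /L2_cL1 h4.
by rewrite /pairing /= !mult_lin//; ring.
Qed.

Lemma pairing_ae X Y : L2 X.1 -> L2 X.2 -> L2 Y.1 -> L2 Y.2 -> eq_state X Y ->
  pairing X = pairing Y.
Proof.
move=> /L2_cL1 h1 /L2_cL1 h2 /L2_cL1 h3 /L2_cL1 h4 [e1 e2].
by rewrite /pairing (mult_ae cA h1 h3 e1) (mult_ae cB h1 h3 e1)
  (mult_ae ctEa h2 h4 e2) (mult_ae ctEb h2 h4 e2).
Qed.

(** Undoing this integration by parts bounds the pairing by the energy. *)
Let mult_helm f f1 f2 (u ux uy : R * R -> R[i]) :
  (forall x, is_derive x 1 f (f1 x)) -> (forall x, is_derive x 1 f1 (f2 x)) ->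
  continuous f2 -> f1 0 = 0 -> f1 pi = 0 -> cL1 u -> cL1 ux -> cL1 uy ->
  weak_partial (dir_x R) u ux -> weak_partial (dir_y R) u uy ->
  mult (tE (helm f f2)) u = mult (tensor (odd_ext f1) (cosk k)) ux
    - k%:R%:C%C * mult (tensor (even_ext f) (sink k)) uy.
Proof.
move=> df df1 cf2 f10 f1pi [u1 u2] [x1 x2] [y1 y2] /weak_partialP[wx1 wx2] /weak_partialP[wy1 wy2].
have E1 := mode_gradient k df df1 cf2 f10 f1pi u1 x1 y1 wx1 wy1.
have E2 := mode_gradient k df df1 cf2 f10 f1pi u2 x2 y2 wx2 wy2.
have cf := is_derive_continuous df.
have c1 := cta cf; have c2 := cta cf2.
have key (g : R * R -> R) : rL1 g -> tint (fun p => tE (helm f f2) p * g p) =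
    - tint (fun p => tE f2 p * g p) + k%:R ^+ 2 * tint (fun p => tE f p * g p).
  move=> ig; have i1 := rL1_cont c1 ig; have i2 := rL1_cont c2 ig.
  rewrite -tintN// -tintZ// -tintD; [|exact: rL1N|exact: rL1Z].
  by apply: tint_eq => p _; rewrite /tE /tensor /even_ext /helm; ring.
rewrite /mult !cint_scale !key// /tE -E1 -E2.
by apply/eqP; rewrite eq_complex /=; apply/andP; split; apply/eqP; ring.
Qed.

Let mult_damped f f1 f2 W (u v g : R * R -> R[i]) :
  (forall x, is_derive x 1 f (f1 x)) -> (forall x, is_derive x 1 f1 (f2 x)) ->
  continuous f2 -> f1 0 = 0 -> f1 pi = 0 -> cL1 u -> cL1 g ->
  represents_damped_laplacian W u v g ->
  mult (tE f) g = mult (tE (helm f f2)) u + mult (tE f) (fun p => (W p)%:C%C * v p).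
Proof.
move=> df df1 cf2 f10 f1pi [u1 u2] [g1 g2] /representsP[r1 r2].
have E1 := mode_damped k df df1 cf2 f10 f1pi u1 g1 r1.
have E2 := mode_damped k df df1 cf2 f10 f1pi u2 g2 r2.
have cf := is_derive_continuous df.
have c1 := cta cf; have c2 := cta cf2.
have key (h : R * R -> R) : rL1 h -> tint (fun p => tE (helm f f2) p * h p) =
    - tint (fun p => tE f2 p * h p) + k%:R ^+ 2 * tint (fun p => tE f p * h p).
  move=> ig; have i1 := rL1_cont c1 ig; have i2 := rL1_cont c2 ig.
  rewrite -tintN// -tintZ// -tintD; [|exact: rL1N|exact: rL1Z].
  by apply: tint_eq => p _; rewrite /tE /tensor /even_ext /helm; ring.
rewrite /mult !cint_scale !key// /tE -E1 -E2 re_scale im_scale.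
by apply/eqP; rewrite eq_complex /=; apply/andP; split; apply/eqP; ring.
Qed.

Variable S : R.
Hypotheses (bS : forall x, 0 <= x <= pi -> [/\ `|a x| <= S, `|b x| <= S, `|a1 x| <= S & `|b1 x| <= S]).

Let T2abs p : T2 p -> 0 <= `|p.1| <= pi.
Proof.
case=> /=; rewrite in_itv /= => /andP[h1 h2] _.
by rewrite normr_ge0 ler_norml h1 ltW.
Qed.

Let bmeas_tensor (f g : R -> R) M : continuous f -> continuous g ->
  (forall x, `|g x| <= 1) -> (forall p, T2 p -> `|f p.1| <= M) -> bmeas M (tensor f g).
Proof.
move=> cf cg g1 fM; split.
  exact: (measurable_funS _ _ (continuous_measurable2 (continuous_tensor cf cg))).
by move=> p Tp; rewrite /tensor normrM -[M]mulr1; apply: ler_pM => //; exact: fM.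
Qed.

Lemma bmeas_tE f M : continuous f -> (forall x, 0 <= x <= pi -> `|f x| <= M) ->
  bmeas M (tE f).
Proof.
move=> cf h; apply: bmeas_tensor.
- exact: continuous_even_ext.
- exact: continuous_cosk.
- exact: cosk_le1.
- by move=> p /T2abs; exact: h.
Qed.

Lemma component_dir X d : in_energy_space X -> is_dir d ->
  tint (fun p => `|re (partial d X.1) p|) + tint (fun p => `|im (partial d X.1) p|)
  <= 8 * pi * Num.sqrt (energy X).
Proof.
move=> hX hd; have [Lp _] := partialP hd hX.1; have [r1 r2] := (L2P _).1 Lp.
have le1 p : sqabs (partial d X.1 p) <= density X p.
  have gx (x y z : R) : 0 <= y -> 0 <= z -> x <= x + y + z by lra.
  have gy (x y z : R) : 0 <= x -> 0 <= z -> y <= x + y + z by lra.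
  by case: hd => ->; [apply: gx|apply: gy]; exact: sqabs_ge0.
have h1 := component_le hX r1 _; have h2 := component_le hX r2 _.
have e1 : tint (fun p => `|re (partial d X.1) p|) <= 2 * pi * (2 * Num.sqrt (energy X)).
  by apply: h1 => p; apply: le_trans (le1 p); rewrite /sqabs lerDl sqr_ge0.
have e2 : tint (fun p => `|im (partial d X.1) p|) <= 2 * pi * (2 * Num.sqrt (energy X)).
  by apply: h2 => p; apply: le_trans (le1 p); rewrite /sqabs lerDr sqr_ge0.
move: e1 e2; move: (tint _) (tint _) (Num.sqrt _) => ? ? ?; lra.
Qed.

Lemma component_velocity X : in_energy_space X ->
  tint (fun p => `|re X.2 p|) + tint (fun p => `|im X.2 p|) <= 8 * pi * Num.sqrt (energy X).
Proof.
move=> hX; have [r1 r2] := (L2P _).1 hX.2.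
have le1 p : sqabs (X.2 p) <= density X p.
  by rewrite /density lerDr sqgrad_ge0.
have h1 := component_le hX r1 _; have h2 := component_le hX r2 _.
have e1 : tint (fun p => `|re X.2 p|) <= 2 * pi * (2 * Num.sqrt (energy X)).
  by apply: h1 => p; apply: le_trans (le1 p); rewrite /sqabs lerDl sqr_ge0.
have e2 : tint (fun p => `|im X.2 p|) <= 2 * pi * (2 * Num.sqrt (energy X)).
  by apply: h2 => p; apply: le_trans (le1 p); rewrite /sqabs lerDr sqr_ge0.
move: e1 e2; move: (tint _) (tint _) (Num.sqrt _) => ? ? ?; lra.
Qed.

Let arith_bound (c1 c2 c3 c4 c5 c6 c7 c8 c9 c10 c11 K L SE : R) :
  c1 <= SE -> c2 <= SE -> K * c3 <= K * SE -> K * c4 <= K * SE ->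
  L * c5 <= L * SE -> L * c6 <= L * SE ->
  c11 <= c7 + L * c10 -> c7 <= c8 + c9 -> c8 <= c1 + K * c3 -> c9 <= c2 + K * c4 ->
  L * c10 <= L * (c5 + c6) -> c11 <= 2 * (1 + K + L) * SE.
Proof. by move=> *; lra. Qed.

Lemma pairing_bound X : in_energy_space X -> 0 <= S -> 0 <= lam ->
  cabs (pairing X) <= 16 * pi * S * (1 + k%:R + lam) * Num.sqrt (energy X).
Proof.
move=> hX S0 lam0; have [hX1 hX2] := hX.
have [Lx wx] := partialP dx_dir hX1; have [Ly wy] := partialP dy_dir hX1.
have Lu := L2_cL1 (H1_L2 hX1); have Lv := L2_cL1 hX2.
rewrite /pairing (mult_helm da da1 ca2 a10 a1pi Lu (L2_cL1 Lx) (L2_cL1 Ly) wx wy).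
rewrite (mult_helm db db1 cb2 b10 b1pi Lu (L2_cL1 Lx) (L2_cL1 Ly) wx wy).
have bodd (f f1 : R -> R) : (forall x, is_derive x 1 f1 (f x)) -> f1 0 = 0 ->
    (forall x, 0 <= x <= pi -> `|f1 x| <= S) -> bmeas S (tensor (odd_ext f1) (cosk k)).
  move=> df1 f10 hS; apply: bmeas_tensor.
  - by apply: continuous_odd_ext; exact: is_derive_continuous df1.
  - exact: continuous_cosk.
  - exact: cosk_le1.
  - move=> p /T2abs hp; rewrite odd_extE// normrM normr_sg.
    by case: (p.1 != 0); rewrite ?mul1r ?mul0r//; exact: hS.
have beven f : continuous f -> (forall x, 0 <= x <= pi -> `|f x| <= S) ->
    bmeas S (tensor (even_ext f) (sink k)).
  move=> cf hS; apply: bmeas_tensor.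
  - exact: continuous_even_ext.
  - exact: continuous_sink.
  - exact: sink_le1.
  - by move=> p /T2abs; exact: hS.
have q x : 0 <= x <= pi -> `|a x| <= S by move=> /bS[].
have q1 x : 0 <= x <= pi -> `|a1 x| <= S by move=> /bS[].
have r x : 0 <= x <= pi -> `|b x| <= S by move=> /bS[].
have r1 x : 0 <= x <= pi -> `|b1 x| <= S by move=> /bS[].
have hx := component_dir hX dx_dir; have hy := component_dir hX dy_dir.
have hv := component_velocity hX.
set E := 8 * pi * Num.sqrt (energy X) in hx hy hv.
have B1 := le_trans (mult_bound (bodd _ _ da1 a10 q1) (L2_cL1 Lx)) (ler_wpM2l S0 hx).
have B2 := le_trans (mult_bound (bodd _ _ db1 b10 r1) (L2_cL1 Lx)) (ler_wpM2l S0 hx).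
have B3 := le_trans (mult_bound (beven _ c_a q) (L2_cL1 Ly)) (ler_wpM2l S0 hy).
have B4 := le_trans (mult_bound (beven _ c_b r) (L2_cL1 Ly)) (ler_wpM2l S0 hy).
have B5 := le_trans (mult_bound (bmeas_tE c_a q) Lv) (ler_wpM2l S0 hv).
have B6 := le_trans (mult_bound (bmeas_tE c_b r) Lv) (ler_wpM2l S0 hv).
move: B1 B2 B3 B4 B5 B6.
set z1 := mult _ _; set z2 := mult _ _; set z3 := mult _ _; set z4 := mult _ _.
set z5 := mult _ _; set z6 := mult _ _ => B1 B2 B3 B4 B5 B6.
have K0 : 0 <= k%:R :> R by [].
have t1 := cabsD (z1 - k%:R%:C%C * z3 + Complex 0 1 * (z2 - k%:R%:C%C * z4))
  (- (Complex 0 1 * lam%:C%C * (z5 + Complex 0 1 * z6))).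
have t2 := cabsD (z1 - k%:R%:C%C * z3) (Complex 0 1 * (z2 - k%:R%:C%C * z4)).
have t3 := cabsD z1 (- (k%:R%:C%C * z3)).
have t4 := cabsD z2 (- (k%:R%:C%C * z4)).
have t5 := cabsD z5 (Complex 0 1 * z6).
move: t1 t2 t3 t4 t5; rewrite !(cabsN, cabsM, cabs_i, cabs_real, mul1r).
rewrite (ger0_norm K0) (ger0_norm lam0) => t1 t2 t3 t4 t5.
have m1 := ler_wpM2l K0 B3; have m2 := ler_wpM2l K0 B4.
have m3 := ler_wpM2l lam0 B5; have m4 := ler_wpM2l lam0 B6.
have m5 := ler_wpM2l lam0 t5.
have -> : 16 * pi * S * (1 + k%:R + lam) * Num.sqrt (energy X) =
    2 * (1 + k%:R + lam) * (S * E) by rewrite /E; ring.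
exact: arith_bound B1 B2 m1 m2 m3 m4 t1 t2 t3 t4 m5.
Qed.

Let arith_residual (c1 c2 c3 c4 c5 c6 c7 L S' TD eE : R) :
  c1 <= eE -> c2 <= eE -> L * c3 <= L * (S' * TD) -> L * c4 <= L * (S' * TD) ->
  c7 <= c5 + L * c6 -> c5 <= c1 + c2 -> L * c6 <= L * (c3 + c4) ->
  c7 <= 2 * eE + L * S' * (2 * TD).
Proof. by move=> *; lra. Qed.

(** Two integrations by parts let the generator act on the mode. There the mode
    equation f'' + f = i lam w f for f = a + i b, which holds up to eta, and
    lam^2 = k^2 + 1 turn it into the multiplication by i lam; what remains are
    the residuals of the equation and the difference between the damping W and
    the continuous damping w of the profile. *)
Variables (w : R -> R) (W : R * R -> R) (eta : R).
Hypotheses (cw : continuous w) (lam2 : lam ^+ 2 = k%:R ^+ 2 + 1) (eta0 : 0 <= eta).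
Hypothesis (resa : forall x, 0 <= x <= pi -> `|- a2 x - a x - lam * w x * b x| <= eta).
Hypothesis (resb : forall x, 0 <= x <= pi -> `|- b2 x - b x + lam * w x * a x| <= eta).

Lemma pairing_generator (u v g : R * R -> R[i]) : H1 u -> H1 v -> L2 g -> 0 <= S -> 0 <= lam ->
  represents_damped_laplacian W u v g ->
  cabs (pairing (v, fun p => - g p) - Complex 0 1 * lam%:C%C * pairing (u, v)) <=
  eta * (16 * pi * Num.sqrt (energy (u, v))) +
  lam * S * (2 * (tint (fun p => `|(W p - w `|p.1|) * re v p|) +
                  tint (fun p => `|(W p - w `|p.1|) * im v p|))).
Proof.
move=> Hu Hv Lg S0 lam0 rep.
have cu := L2_cL1 (H1_L2 Hu); have cv := L2_cL1 (H1_L2 Hv); have cg := L2_cL1 Lg.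
have Da := mult_damped da da1 ca2 a10 a1pi cu cg rep.
have Db := mult_damped db db1 cb2 b10 b1pi cu cg rep.
have [iW1 iW2] : cL1 (fun p => (W p)%:C%C * v p).
  by case: rep => -[h1 h2] _.
pose Wv (p : R * R) := (W p)%:C%C * v p.
pose wv (p : R * R) := (w `|p.1|)%:C%C * v p.
have cw1 : continuous (fun p : R * R => w `|p.1|).
  move=> p; apply: (@continuous_comp _ _ _ fst (fun x => w `|x|)); first exact: cvg_fst.
  exact: (continuous_even_ext cw).
have cwv : cL1 wv.
  by rewrite /cL1 /wv re_scale im_scale; case: cv => ? ?; split; exact: rL1_cont.
have Ng : pairing (v, fun p => - g p) =
    mult (tE (helm a a2)) v + Complex 0 1 * mult (tE (helm b b2)) v
    + Complex 0 1 * lam%:C%C * (mult (tE a) g + Complex 0 1 * mult (tE b) g).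
  have neg m : continuous m -> mult m (fun p => - g p) = - mult m g.
    move=> cm; case: cg => g1 g2.
    have -> : (fun p => - g p) = (fun p => (-1) * g p + (fun=> 0) p).
      by apply/funext => p; rewrite mulN1r addr0.
    have z0 : cL1 (fun=> 0 : R[i]).
      by split; rewrite /re /im /=; apply: rL1_const.
    rewrite mult_lin// mulN1r.
    have -> : mult m (fun=> 0) = 0.
      rewrite /mult cint_scale /re /im /=.
      rewrite (@tint_eq _ _ (fun=> 0)); last by move=> p _; rewrite mulr0.
      by rewrite tint_cst mul0r.
    by rewrite addr0.
  by rewrite /pairing /= !neg//; ring.
pose ra x := - a2 x - a x - lam * w x * b x.
pose rb x := - b2 x - b x + lam * w x * a x.
have cwa : continuous (fun x => w x * a x) by exact: continuousMf.
have cwb : continuous (fun x => w x * b x) by exact: continuousMf.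
have cra : continuous ra.
  move=> x; apply: cvgB; first by apply: cvgB; [apply: cvgN; exact: ca2|exact: c_a].
  by rewrite -mulrA; under eq_fun do rewrite -mulrA; exact: (@continuousZf _ lam _ cwb x).
have crb : continuous rb.
  move=> x; apply: cvgD; first by apply: cvgB; [apply: cvgN; exact: cb2|exact: c_b].
  by rewrite -mulrA; under eq_fun do rewrite -mulrA; exact: (@continuousZf _ lam _ cwa x).
have mw f : mult (tE (fun x => w x * f x)) v = mult (tE f) wv.
  rewrite /mult !cint_scale /wv re_scale im_scale.
  by congr Complex; apply: tint_eq => p _; rewrite /tE /tensor /even_ext; ring.
have Sa : mult (tE (helm a a2)) v = mult (tE ra) v + (lam ^+ 2)%:C%C * mult (tE a) v
    + lam%:C%C * mult (tE b) wv.
  have -> : tE (helm a a2) = (fun p => lam ^+ 2 * tE a p +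
      (fun p => lam * tE (fun x => w x * b x) p + tE ra p) p).
    apply/funext => p; rewrite /tE /tensor /even_ext /helm /ra lam2; ring.
  rewrite mult_linm//; last first.
    by apply: (continuousDf _ (cta cra)); exact: (@continuousZ2 _ lam _ (cta cwb)).
  by rewrite mult_linm//; [rewrite mw; ring|exact: cta|exact: cta].
have Sb : mult (tE (helm b b2)) v = mult (tE rb) v + (lam ^+ 2)%:C%C * mult (tE b) v
    - lam%:C%C * mult (tE a) wv.
  have -> : tE (helm b b2) = (fun p => lam ^+ 2 * tE b p +
      (fun p => (- lam) * tE (fun x => w x * a x) p + tE rb p) p).
    apply/funext => p; rewrite /tE /tensor /even_ext /helm /rb lam2; ring.
  rewrite mult_linm//; last first.
    by apply: (continuousDf _ (cta crb)); exact: (@continuousZ2 _ (- lam) _ (cta cwa)).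
  by rewrite mult_linm//; [rewrite mw rmorphN; ring|exact: cta|exact: cta].
have dW m : continuous m -> mult m Wv - mult m wv = mult m (fun p => (W p - w `|p.1|)%:C%C * v p).
  move=> cm.
  have -> : (fun p : R * R => (W p - w `|p.1|)%:C%C * v p) = (fun p => (-1) * wv p + Wv p).
    by apply/funext => p; rewrite /Wv /wv rmorphB /=; ring.
  by rewrite mult_lin//; ring.
have J2 : Complex 0 1 * Complex 0 1 = -1 :> R[i].
  by apply/eqP; rewrite eq_complex /=; apply/andP; split; apply/eqP; ring.
have main : pairing (v, fun p => - g p) - Complex 0 1 * lam%:C%C * pairing (u, v) =
    (mult (tE ra) v + Complex 0 1 * mult (tE rb) v) +
    Complex 0 1 * lam%:C%C * ((mult (tE a) (fun p => (W p - w `|p.1|)%:C%C * v p)) +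
      Complex 0 1 * (mult (tE b) (fun p => (W p - w `|p.1|)%:C%C * v p))).
  rewrite Ng Da Db /pairing /= Sa Sb -!dW// rmorphXn /= -/Wv.
  move: (mult _ _) (mult (tE rb) v) (mult (tE a) v) (mult (tE b) v) (mult (tE a) Wv)
    (mult (tE b) Wv) (mult (tE a) wv) (mult (tE b) wv) (mult _ u) (mult _ u) (lam%:C%C).
  move=> x1 x2 x3 x4 x5 x6 x7 x8 x9 x10 L.
  move: J2; move: (Complex 0 1 : R[i]) => J J2.
  have e : forall t : R[i], J * (J * t) = - t by move=> t; rewrite mulrA J2 mulN1r.
  apply/eqP; rewrite -subr_eq0; apply/eqP.
  transitivity ((J * J + 1) * (L ^+ 2 * (x3 + J * x4) + L * x8)); first by ring.
  by rewrite J2 addNr mul0r.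
rewrite main.
have hX : in_energy_space (u, v) by split => //=; exact: H1_L2.
have hv := component_velocity hX; rewrite /= in hv.
set E := 8 * pi * Num.sqrt (energy (u, v)) in hv.
have B1 := le_trans (mult_bound (bmeas_tE cra resa) cv) (ler_wpM2l eta0 hv).
have B2 := le_trans (mult_bound (bmeas_tE crb resb) cv) (ler_wpM2l eta0 hv).
pose D (p : R * R) := (W p - w `|p.1|)%:C%C * v p.
have cD : cL1 D.
  have -> : D = (fun p => (-1) * wv p + Wv p).
    by apply/funext => p; rewrite /D /Wv /wv rmorphB /=; ring.
  case: cwv => w1 w2; rewrite /cL1 re_lin im_lin.
  by split; apply: rL1D => //; apply: rL1D; exact: rL1Z.
have q x : 0 <= x <= pi -> `|a x| <= S by move=> /bS[].
have r x : 0 <= x <= pi -> `|b x| <= S by move=> /bS[].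
have B3 := mult_bound (bmeas_tE c_a q) cD.
have B4 := mult_bound (bmeas_tE c_b r) cD.
rewrite -/D; move: B3 B4; rewrite /D re_scale im_scale -/D.
set TD := tint _ + tint _ => B3 B4.
move: B1 B2 B3 B4; rewrite -/ra -/rb.
set z1 := mult _ _; set z2 := mult _ _; set z3 := mult _ _; set z4 := mult _ _.
move=> B1 B2 B3 B4.
have t1 := cabsD (z1 + Complex 0 1 * z2) (Complex 0 1 * lam%:C%C * (z3 + Complex 0 1 * z4)).
have t2 := cabsD z1 (Complex 0 1 * z2).
have t3 := cabsD z3 (Complex 0 1 * z4).
move: t1 t2 t3; rewrite !(cabsM, cabs_i, cabs_real, mul1r) (ger0_norm lam0) => t1 t2 t3.
have m3 := ler_wpM2l lam0 B3; have m4 := ler_wpM2l lam0 B4; have m5 := ler_wpM2l lam0 t3.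
have -> : eta * (16 * pi * Num.sqrt (energy (u, v))) = 2 * (eta * E) by rewrite /E; ring.
exact: arith_residual B1 B2 m3 m4 t1 t2 m5.
Qed.

End Functional.

(** * Orbits of the semigroup *)

Section Semigroup.
Context {R : realType}.
Implicit Types (X Y Z U V : state R) (c : R[i]) (t h : R).
Local Notation T2 := (@torus R).
Local Notation mA := (@area R).

Lemma le_of_dist0 (x e : R) : `|0 - x| <= e -> x <= e.
Proof. by rewrite sub0r normrN; exact: le_trans (ler_norm _). Qed.

Lemma dist0_le (x e : R) : 0 <= x -> x <= e -> `|0 - x| <= e.
Proof. by move=> x0; rewrite sub0r normrN ger0_norm. Qed.

Lemma eq_state_refl X : eq_state X X.
Proof. by split; exact: ae_refl. Qed.

Lemma eq_state_sym X Y : eq_state X Y -> eq_state Y X.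
Proof. by move=> [h1 h2]; split; exact: ae_sym. Qed.

Lemma eq_state_trans X Y Z : eq_state X Y -> eq_state Y Z -> eq_state X Z.
Proof. by move=> [h1 h2] [h3 h4]; split; [exact: ae_trans h3|exact: ae_trans h4]. Qed.

Lemma eq_state_lin c X Y X' Y' : eq_state X X' -> eq_state Y Y' ->
  eq_state (add_state (scale_state c X) Y) (add_state (scale_state c X') Y').
Proof.
move=> [h1 h2] [h3 h4]; split; [apply: filterS2 h1 h3|apply: filterS2 h2 h4];
  by move=> p e1 e2 Tp /=; rewrite e1// e2.
Qed.

Lemma energy_space_lin c X Y : in_energy_space X -> in_energy_space Y ->
  in_energy_space (add_state (scale_state c X) Y).
Proof. by move=> [h1 h2] [h3 h4]; split; [exact: H1_lin|exact: L2_lin]. Qed.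

Definition quotient c A B V : state R := sub_state (scale_state c (sub_state A B)) V.

(** Linearity of a semigroup is stated for combinations c X + Y. *)
Lemma quotientE c A B V : quotient c A B V =
  add_state (scale_state c (add_state (scale_state (-1) B) A))
            (add_state (scale_state (- 2%:R) V) V).
Proof.
rewrite /quotient /sub_state /scale_state /add_state /=; congr pair;
  by apply/funext => p; ring.
Qed.

Lemma energy_space_quotient c A B V : in_energy_space A -> in_energy_space B ->
  in_energy_space V -> in_energy_space (quotient c A B V).
Proof. by move=> hA hB hV; rewrite quotientE; do ?apply: energy_space_lin. Qed.

Lemma eq_state_quotient c A B V A' B' V' : eq_state A A' -> eq_state B B' ->
  eq_state V V' -> eq_state (quotient c A B V) (quotient c A' B' V').
Proof. by move=> hA hB hV; rewrite !quotientE; do ?apply: eq_state_lin. Qed.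

Lemma L2_zero : L2 (fun=> 0 : R[i]).
Proof.
apply/L2P; rewrite /re /im /=.
by split; apply: (@rL2_bmeas _ 0); split => // p _; rewrite normr0.
Qed.

Lemma H1_zero : H1 (fun=> 0 : R[i]).
Proof.
have w d : weak_partial d (fun=> 0 : R[i]) (fun=> 0).
  apply/weak_partialP; rewrite /re /im /=.
  have z (m : R * R -> R) : tint (fun p => m p * 0) = 0.
    by rewrite (@tint_eq _ _ (fun=> 0)) ?tint_cst ?mul0r// => p _; rewrite mulr0.
  by split=> phi _; rewrite !z oppr0.
by split; [exact: L2_zero|exists (fun=> 0) => //; exact: L2_zero|
  exists (fun=> 0) => //; exact: L2_zero].
Qed.

Lemma represents_zero (W : R * R -> R) :
  represents_damped_laplacian W (fun=> 0) (fun=> 0) (fun=> 0).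
Proof.
apply/representsP; rewrite /re /im /=.
have z : rrepresents W (fun=> 0) (fun=> 0) (fun=> 0).
  split.
    by apply: (@rL1_eq _ (fun=> 0)) (rL1_const 0) => p _; rewrite mulr0.
  by move=> phi _; apply: tint_eq => p _; rewrite !mulr0 oppr0 addr0.
by split.
Qed.

Lemma normL2_opp (u : R * R -> R[i]) : normL2 (fun p => - u p) = normL2 u.
Proof.
congr Num.sqrt; apply: tint_eq => p _.
by rewrite /sqabs; case: (u p) => x y /=; rewrite !sqrrN.
Qed.

Variables (W : R * R -> R) (S : R -> state R -> state R).
Hypotheses (sgS : C0_semigroup S) (genS : generated_by W S).

Let S_space t U : 0 <= t -> in_energy_space U -> in_energy_space (S t U).
Proof. by move=> t0 hU; have [/(_ t t0) [h _ _] _ _ _] := sgS; exact: h. Qed.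

Let S_lin t c U V : 0 <= t -> in_energy_space U -> in_energy_space V ->
  eq_state (S t (add_state (scale_state c U) V))
           (add_state (scale_state c (S t U)) (S t V)).
Proof. by move=> t0 hU; have [/(_ t t0) [_ h _] _ _ _] := sgS; exact: h. Qed.

Let S_add s t U : 0 <= s -> 0 <= t -> in_energy_space U ->
  eq_state (S (s + t) U) (S s (S t U)).
Proof. by have [_ _ h _] := sgS; exact: h. Qed.

Let S_quotient t c A B V : 0 <= t -> in_energy_space A -> in_energy_space B ->
  in_energy_space V ->
  eq_state (S t (quotient c A B V)) (quotient c (S t A) (S t B) (S t V)).
Proof.
move=> t0 hA hB hV; rewrite !quotientE.
apply: (eq_state_trans (S_lin _ t0 _ _)); try by do ?apply: energy_space_lin.
by apply: eq_state_lin; exact: S_lin.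
Qed.

Definition is_generator U V := [/\ in_energy_space U, in_energy_space V, domain W U &
  eq_state V (generator W U)].

(** S t is bounded and commutes with difference quotients, so it passes to the
    limit which defines the generator. *)
Lemma generator_semigroup t U V : 0 <= t -> is_generator U V ->
  is_generator (S t U) (S t V).
Proof.
move=> t0 [hU hV dU eV].
have hSU := S_space t0 hU; have hSV := S_space t0 hV.
have lim := (genS hU hV).2 (conj dU eV).
have [B hB] : exists B : R, forall U, in_energy_space U -> norm_state (S t U) <= B * norm_state U.
  by have [/(_ t t0) [_ _ h] _ _ _] := sgS.
have [dS eS] : domain W (S t U) /\ eq_state (S t V) (generator W (S t U)).
  apply: (genS hSU hSV).1.
  apply/cvgrPdist_le => e e0.
  pose B' := `|B| + 1.
  have B'0 : 0 < B' by rewrite ltr_wpDl.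
  have e1 : 0 < e / B' by rewrite divr_gt0.
  move/cvgrPdist_le : lim => /(_ _ e1) lim.
  near=> h.
  have h0 : 0 <= h by apply: ltW; near: h; exact: nbhs_right_gt.
  have small : `|0 - norm_state (quotient (h^-1)%:C%C (S h U) U V)| <= e / B'.
    by near: h; exact: lim.
  have {}small := le_of_dist0 small.
  apply: dist0_le; first exact: norm_state_ge0.
  have hSh := S_space h0 hU.
  have E : eq_state (quotient (h^-1)%:C%C (S h (S t U)) (S t U) (S t V))
      (S t (quotient (h^-1)%:C%C (S h U) U V)).
    apply: eq_state_trans (eq_state_sym (S_quotient _ t0 hSh hU hV)).
    apply: eq_state_quotient; try exact: eq_state_refl.
    apply: eq_state_trans (S_add t0 h0 hU); rewrite addrC.
    exact: eq_state_sym (S_add h0 t0 hU).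
  have q1 : in_energy_space (quotient (h^-1)%:C%C (S h U) U V).
    exact: energy_space_quotient.
  have -> : norm_state (sub_state (scale_state (h^-1)%:C%C
       (sub_state (S h (S t U)) (S t U))) (S t V)) =
      norm_state (S t (quotient (h^-1)%:C%C (S h U) U V)).
    apply: norm_state_ae => //; last exact: S_space.
    by apply: energy_space_quotient => //; exact: S_space.
  apply: (le_trans (hB _ q1)).
  have le1 : B * norm_state (quotient (h^-1)%:C%C (S h U) U V) <=
      B' * norm_state (quotient (h^-1)%:C%C (S h U) U V).
    by rewrite ler_wpM2r ?norm_state_ge0// /B'; have := ler_norm B; lra.
  apply: (le_trans le1).
  by rewrite mulrC -ler_pdivlMr.
by split.
Unshelve. all: by end_near. Qed.

Definition graph_norm X : R :=
  norm_grad X.1 + normH1 X.2 + normL2 (damped_laplacian W X.1 X.2).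

Lemma graph_norm_ge0 X : 0 <= graph_norm X.
Proof. exact: addr_ge0 (addr_ge0 (norm_grad_ge0 _) (normH1_ge0 _)) (normL2_ge0 _). Qed.

(** The generator maps the remainder of the difference quotient at U0 to the one
    at U1 = A U0. Both tend to zero in the norm of states, so that the first one
    tends to zero in the graph norm. *)
Lemma quotient_graph U0 U1 U2 t : 0 < t -> is_generator U0 U1 -> is_generator U1 U2 ->
  domain W (quotient (t^-1)%:C%C (S t U0) U0 U1) /\
  graph_norm (quotient (t^-1)%:C%C (S t U0) U0 U1) <=
    norm_state (quotient (t^-1)%:C%C (S t U0) U0 U1) +
    2 * norm_state (quotient (t^-1)%:C%C (S t U1) U1 U2).
Proof.
move=> t0 g01 g12; have [h0 h1 d0 [e0 e0']] := g01; have [_ h2 d1 [e1 e1']] := g12.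
have [hS0 hS1 dS [eS eS']] := generator_semigroup (ltW t0) g01.
set c := (t^-1)%:C%C; set D := quotient c (S t U0) U0 U1.
set D1 := quotient c (S t U1) U1 U2.
have hD : in_energy_space D by exact: energy_space_quotient.
have hD1 : in_energy_space D1 by exact: energy_space_quotient.
have [L0 r0] := damped_laplacianP d0; have [L1' r1] := damped_laplacianP d1.
have [LS rS] := damped_laplacianP dS.
pose q (u v w : R * R -> R[i]) (p : R * R) : R[i] :=
  c * ((-1) * v p + u p) + ((-1) * w p + 0).
pose g := q (damped_laplacian W (S t U0).1 (S t U0).2) (damped_laplacian W U0.1 U0.2)
  (damped_laplacian W U1.1 U1.2).
have D1E : D.1 = q (S t U0).1 U0.1 U1.1 by apply/funext => p; rewrite /D /q /=; ring.
have D2E : D.2 = q (S t U0).2 U0.2 U1.2 by apply/funext => p; rewrite /D /q /=; ring.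
have H1q u v w : H1 u -> H1 v -> H1 w -> H1 (q u v w).
  move=> Hu Hv Hw; apply: H1_lin; first exact: H1_lin.
  by apply: (H1_lin _ Hw); exact: H1_zero.
have L2q u v w : L2 u -> L2 v -> L2 w -> L2 (q u v w).
  move=> Hu Hv Hw; apply: L2_lin; first exact: L2_lin.
  by apply: (L2_lin _ Hw); exact: L2_zero.
have Lg : L2 g by exact: L2q.
have [HS1 HS2 _] := dS; have [H01 H02 _] := d0; have [H11 H12 _] := d1.
have Rg : represents_damped_laplacian W D.1 D.2 g.
  rewrite D1E D2E; apply: represents_lin.
  - by apply: L2_lin; exact: H1_L2.
  - exact: L2_lin.
  - by apply: L2_lin; [exact: H1_L2|exact: L2_zero].
  - by apply: L2_lin => //; exact: L2_zero.
  - by apply: represents_lin => //; exact: H1_L2.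
  - apply: represents_lin => //; [exact: H1_L2|exact: L2_zero|exact: L2_zero|].
    exact: represents_zero.
have dD : domain W D.
  split; first by case: hD.
    by rewrite D2E; exact: H1q.
  by exists g.
split => //.
have [LD RD] := damped_laplacianP dD.
have eg : ae_eq mA T2 (damped_laplacian W D.1 D.2) g by exact: represents_unique RD Rg.
have n1 : norm_grad D.1 <= norm_state D.
  exact: le_trans (norm_grad_le_normH1 _) (normH1_le_norm_state _).
have n2 : normH1 D.2 <= norm_state D1.
  have -> : normH1 D.2 = normH1 D1.1.
    have [_ HD2 _] := dD.
    apply: normH1_ae; [exact: H1_L2|by case: hD1 => /H1_L2|].
    have f1 := ae_sym eS; have f2 := ae_sym e0; have f3 := ae_sym e1.
    move: f1 f2 f3; apply: filterS3 => p k1 k2 k3 Tp.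
    by rewrite /D /D1 /=; move: (k1 Tp) (k2 Tp) (k3 Tp) => /= -> -> ->.
  exact: normH1_le_norm_state.
have n3 : normL2 (damped_laplacian W D.1 D.2) <= norm_state D1.
  have -> : normL2 (damped_laplacian W D.1 D.2) = normL2 D1.2.
    rewrite (normL2_ae LD Lg eg) -normL2_opp.
    have LN : L2 (fun p => - g p).
      have -> : (fun p => - g p) = (fun p => (-1) * g p + (fun=> 0) p).
        by apply/funext => p; rewrite mulN1r addr0.
      by apply: L2_lin => //; exact: L2_zero.
    apply: normL2_ae => //; first by case: hD1.
    move: eS' e0' e1'; apply: filterS3 => p f1 f2 f3 Tp.
    rewrite /g /q /D1 /=; move: (f1 Tp) (f2 Tp) (f3 Tp) => /= -> -> ->; ring.
  exact: normL2_le_norm_state.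
by rewrite /graph_norm; move: n1 n2 n3; move: (norm_grad _) (normH1 _) (normL2 _) => *; lra.
Qed.

Section EulerStep.
Variables (Phi : state R -> R[i]) (lam K r : R) (tau : state R -> R).
Hypothesis Phi_lin : forall c X Y, in_energy_space X -> in_energy_space Y ->
  Phi (add_state (scale_state c X) Y) = c * Phi X + Phi Y.
Hypothesis Phi_ae : forall X Y, in_energy_space X -> in_energy_space Y ->
  eq_state X Y -> Phi X = Phi Y.
Hypothesis Phi_bound : forall X, in_energy_space X -> cabs (Phi X) <= K * Num.sqrt (energy X).
Hypothesis Phi_gen : forall X Y, is_generator X Y ->
  cabs (Phi Y - Complex 0 1 * lam%:C%C * Phi X) <= r * Num.sqrt (energy X) + tau X.

Lemma cabs_one_plus (s : R) : 1 <= cabs (1 + Complex 0 1 * s%:C%C).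
Proof.
apply: le_trans (Re_le_cabs _) => /=.
by rewrite !(mul0r, mulr0, mul1r) subrr addr0 normr1.
Qed.

(** The orbit is followed by Euler steps, each of which multiplies Phi by
    1 + i d lam up to the error; as |1 + i d lam| >= 1, the modulus of Phi can
    only drop by the error. *)
Lemma euler_step t d U0 U1 : 0 <= t -> 0 < d -> is_generator U0 U1 ->
  cabs (Phi (S t U0)) <= cabs (Phi (S (t + d) U0)) +
    d * (r * Num.sqrt (energy (S t U0)) + tau (S t U0) + K * Num.sqrt (energy (S t (quotient (d^-1)%:C%C (S d U0) U0 U1)))).
Proof.
move=> t0 d0 g01; pose D := quotient (d^-1)%:C%C (S d U0) U0 U1; rewrite -/D; have [h0 h1 _ _] := g01.
have hS := S_space (ltW d0) h0.
have hD : in_energy_space D by exact: energy_space_quotient.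
have gS := generator_semigroup t0 g01; have [hSt hSt1 _ _] := gS.
have dn : d%:C%C != 0 :> R[i].
  by rewrite eq_complex /= negb_and gt_eqF.
have hStD := S_space t0 hD.
pose V := add_state (scale_state 1 D) U1.
have hV : in_energy_space V by exact: energy_space_lin.
have SE : S d U0 = add_state (scale_state d%:C%C V) U0.
  have dd : d%:C%C * (d^-1)%:C%C = 1 :> R[i].
    by rewrite -rmorphM mulfV ?gt_eqF.
  have key (x y z : R[i]) : x = d%:C%C * (1 * ((d^-1)%:C%C * (x - y) - z) + z) + y.
    rewrite mul1r subrK mulrA dd mul1r subrK //.
  rewrite [LHS]surjective_pairing /V /D /quotient /add_state /scale_state /sub_state /=.
  by congr pair; apply/funext => p; exact: key.
have E1 : Phi (S (t + d) U0) = Phi (S t (S d U0)).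
  apply: Phi_ae; first by apply: S_space => //; rewrite addr_ge0// ltW.
    exact: S_space.
  by apply: S_add => //; exact: ltW.
have E2 : Phi (S t (S d U0)) =
    d%:C%C * (Phi (S t D) + Phi (S t U1)) + Phi (S t U0).
  rewrite SE.
  have hStV := S_space t0 hV.
  have a1 : in_energy_space (add_state (scale_state d%:C%C (S t V)) (S t U0)).
    exact: energy_space_lin.
  have a2 : in_energy_space (S t (add_state (scale_state d%:C%C V) U0)).
    exact: S_space t0 (energy_space_lin _ hV h0).
  rewrite (Phi_ae a2 a1 (S_lin _ t0 hV h0)) Phi_lin//; congr (_ * _ + _).
  have a3 : in_energy_space (add_state (scale_state 1 (S t D)) (S t U1)).
    exact: energy_space_lin.
  by rewrite (Phi_ae hStV a3 (S_lin _ t0 hD h1)) Phi_lin// mul1r.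
set e := Phi (S t U1) - Complex 0 1 * lam%:C%C * Phi (S t U0).
have E3 : (1 + Complex 0 1 * (d * lam)%:C%C) * Phi (S t U0) =
    Phi (S (t + d) U0) + - (d%:C%C * (e + Phi (S t D))).
  by rewrite E1 E2 /e rmorphM; ring.
have b1 := Phi_gen gS; have b2 := Phi_bound hStD.
have b3 := cabsD (Phi (S (t + d) U0)) (- (d%:C%C * (e + Phi (S t D)))).
have b4 := cabsD e (Phi (S t D)).
have b5 : cabs (Phi (S t U0)) <= cabs ((1 + Complex 0 1 * (d * lam)%:C%C) * Phi (S t U0)).
  by rewrite cabsM ler_peMl ?cabs_ge0// cabs_one_plus.
move: b5; rewrite E3 => b5; apply: (le_trans b5); apply: (le_trans b3).
rewrite cabsN cabsM cabs_real gtr0_norm// lerD2l ler_wpM2l ?(ltW d0)//.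
by apply: (le_trans b4); apply: lerD.
Qed.

End EulerStep.
End Semigroup.

(** * Powers of the positive part of the cosine *)

Section Bumps.
Context {R : realType}.
Implicit Types (x y t : R) (n k : nat) (a b : R -> R).
Local Notation T2 := (@torus R).
Local Notation mA := (@area R).

Definition pos t := Num.max t 0.

Lemma pos_ge0 t : 0 <= pos t. Proof. by rewrite /pos le_max lexx orbT. Qed.

Lemma pos_id t : 0 <= t -> pos t = t. Proof. by move=> h; exact/max_idPl. Qed.

Lemma pos_eq0 t : t <= 0 -> pos t = 0. Proof. by move=> h; exact/max_idPr. Qed.

Lemma continuous_pos : continuous pos. Proof. exact: continuous_max0. Qed.

Lemma posX t n : t * pos t ^+ n.+1 = pos t ^+ n.+2.
Proof.
rewrite (exprS _ n.+1); have [h|h] := leP 0 t; first by rewrite pos_id.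
by rewrite pos_eq0 ?(ltW h)// expr0n mul0r mulr0.
Qed.

(** Compare with the primitives of 0 and of t on the two half-lines. *)
Lemma der_pos_sqr t : is_derive t 1 (fun t => pos t ^+ 2) (2 * pos t).
Proof.
have [G [dG G0]] := primitive_exists 0 continuous_pos.
suff -> : (fun t => pos t ^+ 2) = (fun t => 2 * G t) by exact: derZ.
apply/funext => s; have [s0|/ltW s0] := leP 0 s.
- have dH x : is_derive x 1 (fun x => G x - 2^-1 * (x * x)) (pos x - x).
    by apply: (der_eq (derB (dG x) (derZ 2^-1 (derM (derid x) (derid x))))); field.
  have [c /andP[c0 _]] := mean_valueT s0 dH.
  rewrite pos_id// subrr mul0r G0 mul0r mulr0 subr0 subr0 => e.
  by rewrite pos_id//; lra.
- have [c /andP[_ c0]] := mean_valueT s0 dG.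
  by rewrite !pos_eq0// mul0r G0 expr0n /= => e; lra.
Qed.

Lemma der_posX n t : is_derive t 1 (fun t => pos t ^+ n.+2) (n.+2%:R * pos t ^+ n.+1).
Proof.
elim: n => [|n IH]; first by rewrite expr1; exact: der_pos_sqr.
have -> : (fun t => pos t ^+ n.+3) = (fun t => t * pos t ^+ n.+2).
  by apply/funext => s; rewrite posX.
apply: (der_eq (derM (derid t) IH)).
by rewrite [t * _]mulrCA posX; ring.
Qed.

(** Supported in the strip |x| <= pi / 2, and the smoother the larger n is. *)
Definition cbump n x := pos (cos x) ^+ n.

Lemma cbump_ge0 n x : 0 <= cbump n x. Proof. by rewrite exprn_ge0// pos_ge0. Qed.

Lemma cbump_le1 n x : cbump n x <= 1.
Proof. by rewrite exprn_ile1 ?pos_ge0// /pos ge_max cos_le1 ler01. Qed.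

Lemma cbump_eq0 n x : cos x <= 0 -> cbump n.+1 x = 0.
Proof. by move=> h; rewrite /cbump pos_eq0// expr0n. Qed.

Lemma cbumpS n x : cos x * cbump n.+1 x = cbump n.+2 x. Proof. exact: posX. Qed.

Lemma der_cos x : is_derive x 1 (cos : R -> R) (- sin x).
Proof. exact: is_derive_cos. Qed.

Lemma der_sin x : is_derive x 1 (sin : R -> R) (cos x).
Proof. exact: is_derive_sin. Qed.

Definition dbump n x := - (n%:R * (cbump n.-1 x * sin x)).

Lemma der_cbump n x : is_derive x 1 (cbump n.+2) (dbump n.+2 x).
Proof.
apply: (der_eq (@derC _ (fun t => pos t ^+ n.+2) cos x _ _ (der_posX n _) (der_cos x))).
by rewrite /dbump /cbump /=; ring.
Qed.

Definition ddbump n x := n%:R * (n.-1)%:R * cbump n.-2 x - n%:R ^+ 2 * cbump n x.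

Lemma der_dbump n x : is_derive x 1 (dbump n.+4) (ddbump n.+4 x).
Proof.
apply: (der_eq (derN (derZ _ (derM (der_cbump n.+1 x) (der_sin x))))).
rewrite /dbump /ddbump /= -[cbump n.+4 x]cbumpS -[cbump n.+3 x]cbumpS.
have := cos2Dsin2 x; rewrite -[n.+4]addn1 natrD => /eqP; rewrite eq_sym -subr_eq => /eqP s2.
move: s2; move: (cbump n.+2 x) (sin x) (cos x) (n.+3%:R : R) => B s c N s2.
transitivity ((N + 1) * (N * B * s ^+ 2 - c ^+ 2 * B)); first by ring.
by rewrite [c * (c * B)]mulrA -expr2 -s2; ring.
Qed.

Lemma continuous_cbump n : continuous (cbump n).
Proof.
rewrite /cbump; elim: n => [|n IH]; first by under eq_fun do rewrite expr0; move=> x; exact: cst_continuous.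
under eq_fun do rewrite exprS.
apply: continuousMf => //; apply: (continuous_compf continuous_pos).
exact: (is_derive_continuous der_cos).
Qed.

Lemma continuous_dbump n : continuous (dbump n).
Proof.
move=> x; apply: cvgN.
have h := continuousMf (@continuous_cbump n.-1) (@continuous_sin R).
exact: (@continuousZf _ n%:R _ h x).
Qed.

Lemma periodic_cbump n : periodic2pi (cbump n).
Proof. by move=> x; rewrite /cbump cos_shift. Qed.

Lemma periodic_dbump n : periodic2pi (dbump n).
Proof. by move=> x; rewrite /dbump periodic_cbump sin_shift. Qed.

(** From the derivative of sin x cbump n.+2 x. *)
Lemma cbump_recurrence n : tint (fun p : R * R => cbump n.+3 p.1) =
  n.+2%:R / n.+3%:R * tint (fun p : R * R => cbump n.+1 p.1).
Proof.
have c1 m : continuous (fun p : R * R => cbump m p.1).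
  by move=> p; apply: (@continuous_comp _ _ _ fst (cbump m)); [exact: cvg_fst|exact: continuous_cbump].
have i1 m : rL1 (fun p : R * R => cbump m p.1).
  by have [M /rL1_bmeas] := continuous_bmeas (c1 m).
have d (x y : R) : is_derive x 1 (fun t => sin t * cbump n.+2 t)
    (n.+3%:R * cbump n.+3 x - n.+2%:R * cbump n.+1 x).
  apply: (der_eq (derM (der_sin x) (der_cbump n x))).
  rewrite /dbump /= -[cbump n.+3 x]cbumpS -[cbump n.+2 x]cbumpS.
  have := cos2Dsin2 x; rewrite -[n.+3]addn1 natrD => /eqP; rewrite eq_sym -subr_eq => /eqP s2.
  move: s2; move: (cbump n.+1 x) (sin x) (cos x) (n.+2%:R : R) => B s c N s2.
  transitivity (c ^+ 2 * B - N * B * s ^+ 2); first by ring.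
  by rewrite [c * (c * B)]mulrA -expr2 -s2; ring.
have := @int_dx_eq0 _ (fun p => sin p.1 * cbump n.+2 p.1)
  (fun p => n.+3%:R * cbump n.+3 p.1 - n.+2%:R * cbump n.+1 p.1) _ d.
rewrite tintB; [|exact: rL1Z|exact: rL1Z]; rewrite !tintZ//.
move=> h; have {}h : n.+3%:R * tint (fun p : R * R => cbump n.+3 p.1)
    - n.+2%:R * tint (fun p : R * R => cbump n.+1 p.1) = 0.
  apply: h.
    by move=> p; apply: cvgB; exact: (@continuousZ2 _ _ _ (c1 _)).
  by move=> x y; rewrite /= sin_shift periodic_cbump.
have n0 : n.+3%:R != 0 :> R by rewrite pnatr_eq0.
apply: (mulfI n0); move: h => /eqP; rewrite subr_eq0 => /eqP ->.
by rewrite mulrA mulrCA mulrV ?mulr1// unitfE.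
Qed.

(** The positive part of the cosine is at least (cos + cos^2) / 2. *)
Lemma cbump1_mean : 2^-1 * (2 * pi) ^+ 2 <= 2 * tint (fun p : R * R => cbump 1 p.1).
Proof.
have c0 : continuous (cos : R -> R) by exact: is_derive_continuous der_cos.
have cc (f : R -> R) : continuous f -> continuous (fun p : R * R => f p.1).
  by move=> cf p; apply: (@continuous_comp _ _ _ fst f); [exact: cvg_fst|exact: cf].
have ii (f : R -> R) : continuous f -> rL1 (fun p : R * R => f p.1).
  by move=> /cc /continuous_bmeas[M /rL1_bmeas].
have i1 := ii _ (@continuous_cbump 1); have i2 := ii _ c0.
have i3 := ii _ (continuousMf c0 c0).
have z1 : tint (fun p : R * R => cos p.1) = 0.
  apply: (@int_dx_eq0 _ (fun p => sin p.1)) => //; first exact: cc.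
  by move=> x y; rewrite /= sin_shift.
have z2 : 2 * tint (fun p : R * R => cos p.1 * cos p.1) - (2 * pi) ^+ 2 = 0.
  rewrite -[X in _ - X]mul1r -tint_cst -tintZ// -tintB; [|exact: rL1Z|exact: rL1_const].
  apply: (@int_dx_eq0 _ (fun p => sin p.1 * cos p.1)) => //.
  - move=> p; apply: cvgB; last exact: cvg_cst.
    exact: (@continuousZ2 _ 2 _ (cc _ (continuousMf c0 c0))).
  - move=> x y; apply: (der_eq (derM (der_sin x) (der_cos x))) => /=.
    have := cos2Dsin2 x => s2; rewrite -[X in _ = _ - X]s2; ring.
  - by move=> x y; rewrite /= sin_shift cos_shift.
have le1 : tint (fun p : R * R => cos p.1 + cos p.1 * cos p.1) <=
    tint (fun p : R * R => 2 * cbump 1 p.1).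
  apply: tint_le; [exact: rL1D|exact: rL1Z|move=> p _].
  rewrite /cbump expr1; have h1 := cos_le1 p.1; have h2 := cos_geN1 p.1.
  have [h|h] := leP 0 (cos p.1).
    rewrite pos_id//; have := ler_wpM2l h h1; lra.
  rewrite pos_eq0 ?(ltW h)// mulr0.
  have : 0 <= (- cos p.1) * (1 + cos p.1) by rewrite mulr_ge0//; lra.
  lra.
move: le1; rewrite tintD// tintZ// z1 add0r => le1; lra.
Qed.

End Bumps.

(** * Initial data in the undamped strip *)

Section ClassicalWeak.
Context {R : realType}.
Implicit Types (x y t : R) (a b : R -> R) (W : R * R -> R).
Local Notation T2 := (@torus R).
Local Notation mA := (@area R).

Lemma rL1_continuous (f : R * R -> R) : continuous f -> rL1 f.
Proof. by move=> /continuous_bmeas[M /rL1_bmeas]. Qed.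

Lemma test_slice_x (phi : R * R -> R) x y : test_function phi ->
  is_derive x 1 (fun t => phi (t, y)) ('D_(dir_x R) phi (x, y)).
Proof.
move=> /test_function_derivable-/(_ (x, y)) [h _].
by rewrite derive_dir_x /=; rewrite derivable_dir_x in h; exact: (DeriveDef h).
Qed.

Lemma test_slice_y (phi : R * R -> R) x y : test_function phi ->
  is_derive y 1 (fun t => phi (x, t)) ('D_(dir_y R) phi (x, y)).
Proof.
move=> /test_function_derivable-/(_ (x, y)) [_ h].
by rewrite derive_dir_y /=; rewrite derivable_dir_y in h; exact: (DeriveDef h).
Qed.

Let rweak_of_tint d (u v phi : R * R -> R) : is_dir d -> test_function phi ->
  continuous u -> continuous v ->
  tint (fun p => 'D_d phi p * u p + phi p * v p) = 0 ->
  tint (fun p => 'D_d phi p * u p) = - tint (fun p => phi p * v p).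
Proof.
move=> hd tphi cu cv; rewrite tintD.
- by move/eqP; rewrite addr_eq0 => /eqP.
- by apply: rL1_cont; [exact: cont_dir|exact: rL1_continuous].
- by apply: rL1_cont; [exact: test_function_cont|exact: rL1_continuous].
Qed.

Let cont_leibniz d (u v phi : R * R -> R) : is_dir d -> test_function phi ->
  continuous u -> continuous v ->
  continuous (fun p => 'D_d phi p * u p + phi p * v p).
Proof.
move=> hd tphi cu cv p.
have c1 := cont_dir hd tphi; have c2 := test_function_cont tphi.
exact: (cvgD (cvgM (c1 p) (cu p)) (cvgM (c2 p) (cv p))).
Qed.

(** Classical derivatives are weak derivatives: the Leibniz rule, integrated
    over a period. *)
Lemma rweak_tensor_x a a1 b : (forall x, is_derive x 1 a (a1 x)) -> periodic2pi a ->
  continuous a1 -> continuous b -> rweak (dir_x R) (tensor a b) (tensor a1 b).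
Proof.
move=> da pa ca1 cb phi tphi.
have c0 := continuous_tensor (is_derive_continuous da) cb.
have c1 := continuous_tensor ca1 cb.
apply: rweak_of_tint => //; first exact: dx_dir.
apply: (@int_dx_eq0 _ (fun p => phi p * tensor a b p)).
- by apply: cont_leibniz => //; exact: dx_dir.
- move=> x y; have h1 := test_slice_x x y tphi.
  have h2 := derM (da x) (derc (b y) x).
  by apply: (der_eq (derM h1 h2)); rewrite /tensor /=; ring.
- by move=> x y; rewrite /tensor /= pa; have [_ /(_ x y) [-> _]] := tphi.
Qed.

Lemma rweak_tensor_y a b b1 : (forall x, is_derive x 1 b (b1 x)) -> periodic2pi b ->
  continuous b1 -> continuous a -> rweak (dir_y R) (tensor a b) (tensor a b1).
Proof.
move=> db pb cb1 ca_ phi tphi.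
have c0 := continuous_tensor ca_ (is_derive_continuous db).
have c1 := continuous_tensor ca_ cb1.
apply: rweak_of_tint => //; first exact: dy_dir.
apply: (@int_dy_eq0 _ (fun p => phi p * tensor a b p)).
- by apply: cont_leibniz => //; exact: dy_dir.
- move=> x y; have h1 := test_slice_y x y tphi.
  have h2 := derM (derc (a x) y) (db y).
  by apply: (der_eq (derM h1 h2)); rewrite /tensor /=; ring.
- by move=> x y; rewrite /tensor /= pb; have [_ /(_ x y) [_ ->]] := tphi.
Qed.

Definition cplx (f : R * R -> R) p : R[i] := (f p)%:C%C.

Lemma re_cplx f : re (cplx f) = f. Proof. by []. Qed.
Lemma im_cplx f : im (cplx f) = fun=> 0. Proof. by []. Qed.

Lemma tint_mul0 (m : R * R -> R) : tint (fun p => m p * 0) = 0.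
Proof. by rewrite (@tint_eq _ _ (fun=> 0)) ?tint_cst ?mul0r// => p _; rewrite mulr0. Qed.

Lemma L2_cplx f : continuous f -> L2 (cplx f).
Proof.
move=> cf; apply/L2P; rewrite re_cplx im_cplx; split.
  by have [M] := continuous_bmeas cf; exact: rL2_bmeas.
by apply: (@rL2_bmeas _ 0); split => // p _; rewrite normr0.
Qed.

Lemma weak_partial_cplx d f g : rweak d f g -> weak_partial d (cplx f) (cplx g).
Proof.
move=> h; apply/weak_partialP; rewrite !re_cplx !im_cplx; split => // phi _.
by rewrite !tint_mul0 oppr0.
Qed.

Lemma normL2_cplx_le f M : 0 <= M -> bmeas M f -> normL2 (cplx f) <= 2 * pi * M.
Proof.
move=> M0 [mf bf]; have pi0 := pi_gt0 R.
have MM : 0 <= 2 * pi * M by rewrite !mulr_ge0// ltW.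
rewrite -[leRHS]ger0_norm// -sqrtr_sqr; rewrite ler_wsqrtr//.
have -> : (2 * pi * M) ^+ 2 = tint (fun=> M ^+ 2) by rewrite tint_cst; ring.
have rf : rL2 f by exact: rL2_bmeas (conj mf bf).
apply: tint_le; [|exact: rL1_const|].
  by apply: (@rL1_eq _ (fun p => f p ^+ 2)) rf.2 => p _; rewrite /sqabs /= expr0n addr0.
move=> p Tp; rewrite /sqabs /= expr0n addr0 -[f p ^+ 2]real_normK ?num_real//.
by rewrite ler_pXn2r ?nnegrE// bf.
Qed.

End ClassicalWeak.

Section Data.
Context {R : realType}.
Implicit Types (x y : R) (n : nat).
Local Notation T2 := (@torus R).
Local Notation mA := (@area R).
Variable k : nat.

Definition emode n : R * R -> R := tensor (cbump n) (cosk k).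

Definition lapmode n p : R := n%:R * (n.-1)%:R * emode n.-2 p
  - (n%:R ^+ 2 + k%:R ^+ 2) * emode n p.

Lemma continuous_emode n : continuous (emode n).
Proof. by apply: continuous_tensor; [exact: continuous_cbump|exact: continuous_cosk]. Qed.

Lemma continuous_lapmode n : continuous (lapmode n).
Proof.
move=> p; apply: cvgB; [exact: (@continuousZ2 _ _ _ (@continuous_emode n.-2))|].
exact: (@continuousZ2 _ _ _ (@continuous_emode n)).
Qed.

Let ck := @continuous_cosk R k.

Let csk : continuous (fun y : R => - k%:R * sink k y).
Proof. exact: (continuousZf (@continuous_sink R k)). Qed.

Lemma rweak_emode_x n : rweak (dir_x R) (emode n.+2) (tensor (dbump n.+2) (cosk k)).
Proof.
apply: rweak_tensor_x => //; [exact: der_cbump|exact: periodic_cbump|exact: continuous_dbump].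
Qed.

Lemma rweak_emode_y n : rweak (dir_y R) (emode n) (tensor (cbump n) (fun y => - k%:R * sink k y)).
Proof.
apply: rweak_tensor_y => //; [exact: der_cosk|exact: periodic_cosk|exact: continuous_cbump].
Qed.

Lemma H1_emode n : H1 (cplx (emode n.+2)).
Proof.
split; first by apply: L2_cplx; exact: continuous_emode.
- exists (cplx (tensor (dbump n.+2) (cosk k))).
    by apply: L2_cplx; apply: continuous_tensor => //; exact: continuous_dbump.
  exact: (weak_partial_cplx (@rweak_emode_x n)).
- exists (cplx (tensor (cbump n.+2) (fun y => - k%:R * sink k y))).
    by apply: L2_cplx; apply: continuous_tensor => //; exact: continuous_cbump.
  exact: (weak_partial_cplx (@rweak_emode_y n.+2)).
Qed.

Lemma H1_lapmode n : H1 (cplx (lapmode n.+4)).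
Proof.
have -> : cplx (lapmode n.+4) = (fun p => (n.+4%:R * (n.+4.-1)%:R : R)%:C%C * cplx (emode n.+2) p
   + (fun p => (- (n.+4%:R ^+ 2 + k%:R ^+ 2))%:C%C * cplx (emode n.+4) p + (fun=> 0) p) p).
  by apply/funext => p; rewrite /cplx /lapmode addr0 -!rmorphM -rmorphD mulNr.
apply: H1_lin; first exact: H1_emode.
by apply: H1_lin; [exact: H1_emode|exact: H1_zero].
Qed.

Variable W : R * R -> R.
Hypothesis W0 : forall p, T2 p -> 0 < cos p.1 -> W p = 0.

Lemma W_emode n p : T2 p -> W p * emode n.+1 p = 0.
Proof.
move=> Tp; have [h|h] := leP (cos p.1) 0.
  by rewrite /emode /tensor cbump_eq0// mul0r mulr0.
by rewrite W0// mul0r.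
Qed.

Lemma W_lapmode n p : T2 p -> W p * lapmode n.+3 p = 0.
Proof.
move=> Tp; rewrite /lapmode mulrBr [W p * (_ * emode _ _)]mulrCA W_emode// mulr0.
by rewrite [W p * (_ * emode _ _)]mulrCA W_emode// mulr0 subrr.
Qed.

Lemma rrepresents_emode n :
  rrepresents W (emode n.+4) (fun=> 0) (fun p => - lapmode n.+4 p).
Proof.
split.
  by apply: (@rL1_eq _ (fun=> 0)) (rL1_const 0) => p _; rewrite mulr0.
move=> phi tphi.
have tx := test_function_dx tphi; have ty := test_function_dy tphi.
have c0 := test_function_cont tphi.
have cx := test_function_cont tx; have cy := test_function_cont ty.
have cxx := test_function_cont (test_function_dx tx).
have cyy := test_function_cont (test_function_dy ty).
have ie := rL1_continuous (@continuous_emode n.+4).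
have cdd : continuous (@ddbump R n.+4).
  move=> x; apply: cvgB; [exact: (continuousZf (@continuous_cbump R n.+2))|].
  exact: (continuousZf (@continuous_cbump R n.+4)).
have x1 := @rweak_emode_x n.+2 _ tx.
have x2 : rweak (dir_x R) (tensor (dbump n.+4) (cosk k)) (tensor (ddbump n.+4) (cosk k)).
  exact: (rweak_tensor_x (@der_dbump R n) (@periodic_dbump R n.+4) cdd ck).
have {x2} := x2 _ tphi => x2.
have y1 := @rweak_emode_y n.+4 _ ty.
have ckk : continuous (fun y : R => - k%:R * (k%:R * cosk k y)).
  exact: (continuousZf (continuousZf ck)).
have y2 : rweak (dir_y R) (tensor (cbump n.+4) (fun y => - k%:R * sink k y))
    (tensor (cbump n.+4) (fun y => - k%:R * (k%:R * cosk k y))).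
  apply: rweak_tensor_y => //; last exact: continuous_cbump.
    by move=> y; exact: (derZ (- k%:R) (der_sink k y)).
  by move=> y; rewrite /sink periodic_sink.
have {y2} := y2 _ tphi => y2.
have j1 := rL1_cont cxx ie; have j2 := rL1_cont cyy ie.
rewrite (@tint_eq _ (fun p => - (laplacian phi p * _) + _)
  (fun p => - ('D_(dir_x R) (fun q => 'D_(dir_x R) phi q) p * emode n.+4 p +
               'D_(dir_y R) (fun q => 'D_(dir_y R) phi q) p * emode n.+4 p))); last first.
  by move=> p _; rewrite /laplacian mulr0 mulr0 addr0 mulrDl.
rewrite (tintN (rL1D j1 j2)).
rewrite (tintD j1 j2).
have j3 : rL1 (fun p => phi p * tensor (ddbump n.+4) (cosk k) p).
  by apply: rL1_cont => //; apply: rL1_continuous; exact: continuous_tensor.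
have j4 : rL1 (fun p => phi p * tensor (cbump n.+4) (fun y => - k%:R * (k%:R * cosk k y)) p).
  apply: rL1_cont => //; apply: rL1_continuous.
  by apply: continuous_tensor => //; exact: continuous_cbump.
transitivity (- (tint (fun p => phi p * tensor (ddbump n.+4) (cosk k) p) +
  tint (fun p => phi p * tensor (cbump n.+4) (fun y => - k%:R * (k%:R * cosk k y)) p))).
  congr (- (_ + _)).
    exact: (etrans x1 (etrans (congr1 (@GRing.opp R) x2) (opprK _))).
  exact: (etrans y1 (etrans (congr1 (@GRing.opp R) y2) (opprK _))).
rewrite -(tintD j3 j4) -(tintN (rL1D j3 j4)).
by apply: tint_eq => p _; rewrite /lapmode /emode /tensor /ddbump /=; ring.
Qed.

Lemma rrepresents_velocity n :
  rrepresents W (fun=> 0) (lapmode n.+3) (fun=> 0).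
Proof.
split.
  by apply: (@rL1_eq _ (fun=> 0)) (rL1_const 0) => p Tp; rewrite W_lapmode.
move=> phi _; apply: tint_eq => p Tp; rewrite W_lapmode// !mulr0 oppr0 addr0 //.
Qed.

(** The data and their first two images by the generator: W vanishes on the
    support of these functions, and the fourth power is regular enough for the
    Laplacian to be in H^1. *)
Definition data0 : state R := (cplx (emode 4), fun=> 0).
Definition data1 : state R := (fun=> 0, cplx (lapmode 4)).
Definition data2 : state R := (cplx (lapmode 4), fun=> 0).

Let rz : rrepresents W (fun=> 0) (fun=> 0) (fun=> 0).
Proof. by have /representsP[] := @represents_zero R W. Qed.

Let rep0 : represents_damped_laplacian W data0.1 data0.2 (cplx (fun p => - lapmode 4 p)).
Proof.
apply/representsP; rewrite /= !re_cplx !im_cplx; split; last exact: rz.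
exact: rrepresents_emode.
Qed.

Let rep1 : represents_damped_laplacian W data1.1 data1.2 (fun=> 0).
Proof.
apply/representsP; rewrite /= re_cplx im_cplx; split; last exact: rz.
exact: rrepresents_velocity.
Qed.

Let L2_lap : L2 (cplx (fun p => - lapmode 4 p)).
Proof. by apply: L2_cplx => p; apply: cvgN; exact: continuous_lapmode. Qed.

Lemma domain_data0 : domain W data0.
Proof. by split; [exact: H1_emode|exact: H1_zero|exists (cplx (fun p => - lapmode 4 p))]. Qed.

Lemma domain_data1 : domain W data1.
Proof. by split; [exact: H1_zero|exact: H1_lapmode|exists (fun=> 0) => //; exact: L2_zero]. Qed.

Lemma damped_data0 : ae_eq mA T2 (damped_laplacian W data0.1 data0.2) (cplx (fun p => - lapmode 4 p)).
Proof.
have [L r] := damped_laplacianP domain_data0.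
exact: represents_unique L L2_lap r rep0.
Qed.

Lemma is_generator_data0 : is_generator W data0 data1.
Proof.
split; [|by split; [exact: H1_zero|exact/H1_L2/H1_lapmode]|exact: domain_data0|].
  by split; [exact: H1_emode|exact: L2_zero].
split; first exact: ae_refl.
apply: filterS damped_data0 => p h Tp; rewrite /= h// /cplx.
by rewrite rmorphN opprK.
Qed.

Lemma is_generator_data1 : is_generator W data1 data2.
Proof.
split; [|by split; [exact: H1_lapmode|exact: L2_zero]|exact: domain_data1|].
  by split; [exact: H1_zero|exact/H1_L2/H1_lapmode].
have [L r] := damped_laplacianP domain_data1.
split; first exact: ae_refl.
have h := represents_unique L (@L2_zero R) r rep1.
by apply: filterS h => p h Tp; rewrite /= h// oppr0.
Qed.

Lemma norm_grad_bound u ux uy (A B : R) : 0 <= A -> 0 <= B -> H1 u -> bmeas A ux -> bmeas B uy ->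
  weak_partial (dir_x R) u (cplx ux) -> weak_partial (dir_y R) u (cplx uy) ->
  norm_grad u <= 2 * pi * (A + B).
Proof.
move=> A0 B0 hu [mx bx] [my by_] wx wy.
have rx : rL2 ux by exact: rL2_bmeas (conj mx bx).
have ry : rL2 uy by exact: rL2_bmeas (conj my by_).
have rz0 : rL2 (fun=> 0 : R).
  by apply: (@rL2_bmeas _ 0); split => // p _; rewrite normr0.
have Lx : L2 (cplx ux) by apply/L2P.
have Ly : L2 (cplx uy) by apply/L2P.
have ex := partial_ae_eq dx_dir hu Lx wx.
have ey := partial_ae_eq dy_dir hu Ly wy.
have pi0 := pi_gt0 R.
have MM : 0 <= 2 * pi * (A + B) by rewrite mulr_ge0 ?addr_ge0// mulr_ge0// ltW.
rewrite -[leRHS]ger0_norm// -sqrtr_sqr ler_wsqrtr//.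
have isum : rL1 (fun p => ux p ^+ 2 + uy p ^+ 2) by exact: (rL1D rx.2 ry.2).
have -> : \int[mA]_(p in T2) sqgrad u p = tint (fun p => ux p ^+ 2 + uy p ^+ 2).
  apply: tint_ae.
  - by have := rL1_measurable (rL1_sqgrad hu).
  - by have := rL1_measurable isum.
  - apply: filterS2 ex ey => p h1 h2 Tp; rewrite /sqgrad h1// h2// /sqabs /=.
    by rewrite expr0n !addr0.
have le1 : (A ^+ 2 + B ^+ 2) * (2 * pi) ^+ 2 <= (2 * pi * (A + B)) ^+ 2.
  rewrite [leRHS](_ : _ = (A + B) ^+ 2 * (2 * pi) ^+ 2); last by ring.
  rewrite ler_wpM2r ?sqr_ge0// sqrrD; have := mulr_ge0 A0 B0; lra.
apply: le_trans le1; rewrite -tint_cst; apply: tint_le => //; first exact: rL1_const.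
move=> p Tp; apply: lerD.
  by rewrite -[ux p ^+ 2]real_normK ?num_real// ler_pXn2r ?nnegrE// bx.
by rewrite -[uy p ^+ 2]real_normK ?num_real// ler_pXn2r ?nnegrE// by_.
Qed.

Lemma cont_bmeas (f : R * R -> R) M : continuous f -> (forall p, `|f p| <= M) -> bmeas M f.
Proof.
by move=> cf h; split=> [|p _ //]; exact: (measurable_funS _ _ (continuous_measurable2 cf)).
Qed.

Lemma emode_le1 n p : `|emode n p| <= 1.
Proof.
rewrite /emode /tensor normrM -[leRHS]mulr1; apply: ler_pM => //; last exact: cosk_le1.
by rewrite ger0_norm ?cbump_ge0// cbump_le1.
Qed.

Lemma graph_norm_data0 : (1 <= k)%N -> graph_norm W data0 <= 70 * pi * k%:R ^+ 2.
Proof.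
move=> k1; have pi0 := pi_gt0 R.
have kR : 1 <= k%:R :> R by rewrite ler1n.
have n1 : norm_grad data0.1 <= 2 * pi * (4 + k%:R).
  apply: (@norm_grad_bound _ (tensor (dbump 4) (cosk k)) (tensor (cbump 4) (fun y => - k%:R * sink k y))) => //.
  - exact: H1_emode.
  - apply: cont_bmeas.
      by apply: continuous_tensor => //; exact: continuous_dbump.
    move=> p; rewrite /tensor normrM -[leRHS]mulr1; apply: ler_pM => //; last exact: cosk_le1.
    rewrite /dbump normrN normrM (ger0_norm (ler0n _ _)) -[leRHS]mulr1; apply: ler_wpM2l => //.
    rewrite (normrM (cbump _ _)); apply: mulr_ile1 => //.
      by rewrite ger0_norm ?cbump_ge0// cbump_le1.
    by rewrite ler_norml sin_geN1 sin_le1.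
  - apply: cont_bmeas.
      by apply: continuous_tensor => //; exact: continuous_cbump.
    move=> p; rewrite /tensor normrM -[leRHS]mul1r; apply: ler_pM => //.
      by rewrite ger0_norm ?cbump_ge0// cbump_le1.
    rewrite normrM normrN (ger0_norm (ler0n _ _)) -[leRHS]mulr1; apply: ler_wpM2l => //.
    exact: sink_le1.
  - exact: (weak_partial_cplx (@rweak_emode_x 2)).
  - exact: (weak_partial_cplx (@rweak_emode_y 4)).
have b0 : bmeas 0 (fun=> 0 : R) by apply: cont_bmeas => [x|p]; [exact: cvg_cst|rewrite normr0].
have z2 : normL2 (fun=> 0 : R[i]) = 0.
  apply/eqP; rewrite eq_le normL2_ge0 andbT.
  by have := @normL2_cplx_le R (fun=> 0) 0 (lexx 0) b0; rewrite mulr0.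
have z1 : normH1 (fun=> 0 : R[i]) = 0.
  have w0 d : weak_partial d (fun=> 0 : R[i]) (cplx (fun=> 0)).
    apply: (@weak_partial_cplx R d (fun=> 0) (fun=> 0)) => phi _.
    by rewrite !tint_mul0 oppr0.
  have := norm_grad_bound (lexx 0) (lexx 0) (@H1_zero R) b0 b0 (w0 _) (w0 _).
  rewrite addr0 mulr0 /normH1 z2 => h.
  have -> : norm_grad (fun=> 0 : R[i]) = 0 by apply/eqP; rewrite eq_le h norm_grad_ge0.
  by rewrite expr0n addr0 sqrtr0.
have n3 : normL2 (damped_laplacian W data0.1 data0.2) <= 2 * pi * (28 + k%:R ^+ 2).
  have [L _] := damped_laplacianP domain_data0.
  rewrite (normL2_ae L L2_lap damped_data0).
  apply: normL2_cplx_le; first by rewrite addr_ge0// sqr_ge0.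
  apply: cont_bmeas; first by move=> p; apply: cvgN; exact: continuous_lapmode.
  move=> p; rewrite normrN /lapmode /=.
  have e2 := emode_le1 2 p; have e4 := emode_le1 4 p.
  apply: (le_trans (ler_normB _ _)); rewrite (normrM (4 * 3)) (normrM (4 ^+ 2 + k%:R ^+ 2)).
  have k2 : 0 <= k%:R ^+ 2 :> R by exact: sqr_ge0.
  have q1 : 0 <= 4 ^+ 2 + k%:R ^+ 2 :> R by rewrite addr_ge0// sqr_ge0.
  rewrite (ger0_norm q1) (ger0_norm (mulr_ge0 (ler0n _ 4) (ler0n _ 3))).
  have l1 : (4 * 3) * `|emode 2 p| <= (4 * 3) * 1 by rewrite ler_wpM2l.
  have l2 := ler_wpM2l q1 e4.
  by move: l1 l2; lra.
rewrite /graph_norm z1 addr0.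
have kk : k%:R <= k%:R ^+ 2 :> R by rewrite expr2 ler_peMl.
have k2 : 1 <= k%:R ^+ 2 :> R by exact: le_trans kk.
apply: (le_trans (lerD n1 n3)).
have -> : 2 * pi * (4 + k%:R) + 2 * pi * (28 + k%:R ^+ 2) = pi * (64 + 2 * k%:R + 2 * k%:R ^+ 2) :> R by ring.
rewrite [leRHS](_ : _ = pi * (70 * k%:R ^+ 2)); last by ring.
by rewrite ler_wpM2l ?(ltW pi0)//; lra.
Qed.

End Data.

(** * The pairing of the data with the mode *)

Section LowerBound.
Context {R : realType}.
Implicit Types (x y : R) (n : nat).
Local Notation T2 := (@torus R).
Local Notation mA := (@area R).

Lemma pihalf_gt0 : 0 < pi / 2 :> R.
Proof. by rewrite divr_gt0// pi_gt0. Qed.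

Lemma cos_norm x : cos `|x| = cos x.
Proof. by have [h|h] := leP 0 x; [rewrite ger0_norm|rewrite ltr0_norm// cosN]. Qed.

Lemma cos_outside x : pi / 2 <= x -> x <= pi -> cos x <= 0.
Proof.
move=> h1 h2; have -> : x = (x - pi / 2) + pi / 2 by rewrite subrK.
rewrite cosDpihalf oppr_le0; apply: sin_ge0_pi.
by rewrite subr_ge0 h1 /=; have := pihalf_gt0; lra.
Qed.

Lemma cos_inside p : T2 p -> 0 < cos p.1 -> `|p.1| < pi / 2.
Proof.
case=> /=; rewrite in_itv /= => /andP[h1 h2] _ c; rewrite ltNge; apply/negP => h.
have : cos `|p.1| <= 0 by apply: cos_outside => //; rewrite ler_norml h1 ltW.
by rewrite cos_norm leNgt c.
Qed.

Variable k : nat.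
Hypothesis k1 : (1 <= k)%N.

Let cS n : continuous (tensor (cbump n) (fun y : R => sink k y ^+ 2)).
Proof.
apply: continuous_tensor; first exact: continuous_cbump.
exact: (continuousMf (@continuous_sink R k) (@continuous_sink R k)).
Qed.

(** The mean of cos(2 k y) is zero. *)
Lemma sin_sqr_mean n : 2 * tint (tensor (cbump n) (fun y : R => sink k y ^+ 2)) =
  tint (fun p : R * R => cbump n p.1).
Proof.
have cc := @continuous_cosk R k; have cs := @continuous_sink R k.
have k0 : k%:R != 0 :> R by rewrite pnatr_eq0 -lt0n.
have cb : continuous (fun p : R * R => cbump n p.1).
  by move=> p; apply: (@continuous_comp _ _ _ fst (cbump n)); [exact: cvg_fst|exact: continuous_cbump].
have i0 := rL1_continuous cb; have i1 := rL1_continuous (@cS n).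
have i2 := rL1Z 2 i1.
have h : tint (fun p : R * R => cbump n p.1 - 2 * tensor (cbump n) (fun y : R => sink k y ^+ 2) p) = 0.
  apply: (@int_dy_eq0 _ (fun p => cbump n p.1 * (k%:R^-1 * (sink k p.2 * cosk k p.2)))).
  - move=> p; apply: cvgB; first exact: cb.
    exact: (@continuousZ2 _ 2 _ (@cS n)).
  - move=> x y.
    have d := derM (derc (cbump n x) y) (derZ k%:R^-1 (derM (der_sink k y) (der_cosk k y))).
    apply: (der_eq d); rewrite /tensor /= mul0r add0r.
    have := cos2Dsin2 (k%:R * y + 0); rewrite -/(cosk k y) -/(sink k y) => s2.
    rewrite -[X in _ = X - _](mulr1 (cbump n x)) -[X in _ = _ * X - _]s2.
    by field.
  - by move=> x y; rewrite /= /sink /cosk periodic_sink periodic_cosk.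
move: h; rewrite (tintB i0 i2) (tintZ _ i1) => /eqP; rewrite subr_eq0 => /eqP -> //.
Qed.

Lemma cbump5_mean : (2 * pi) ^+ 2 <= 8 * tint (fun p : R * R => cbump 5 p.1).
Proof.
have := @cbump1_mean R; rewrite (cbump_recurrence 2) (cbump_recurrence 0).
move: (tint _) => t h.
rewrite [leRHS](_ : _ = (64 / 15) * t); last by field.
by have := sqr_ge0 (2 * pi : R); lra.
Qed.

Variables (lam : R) (a a1 a2 b b1 b2 : R -> R).
Hypotheses (da : forall x, is_derive x 1 a (a1 x)) (da1 : forall x, is_derive x 1 a1 (a2 x)).
Hypotheses (ca2 : continuous a2) (a10 : a1 0 = 0) (a1pi : a1 pi = 0).
Hypotheses (inside : forall x, 0 <= x <= pi / 2 -> a1 x = - sin x /\ cos x <= a x).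

(** After Green's formula the x part of the pairing is
    4 cos_+(x)^3 sin(x)^2 cos(k y)^2 >= 0, and the y part is at least
    k^2 cos_+(x)^5 sin(k y)^2. *)
Lemma pairing_data0 : pi ^+ 2 / 4 * k%:R ^+ 2 <=
  complex.Re (pairing k lam a a2 b b2 (data0 k)).
Proof.
have ck := @continuous_cosk R k; have sk := @continuous_sink R k.
have c0 := is_derive_continuous da; have c1 := is_derive_continuous da1.
pose u := @emode R k 4; have iu : rL1 u := rL1_continuous (@continuous_emode R k 4).
pose ux := tensor (@dbump R 4) (cosk k).
pose uy := tensor (@cbump R 4) (fun y => - k%:R * sink k y).
have cux : continuous ux by apply: (continuous_tensor (@continuous_dbump R 4) ck).
have csk : continuous (fun y : R => - k%:R * sink k y) by exact: (continuousZf sk).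
have cuy : continuous uy by apply: (continuous_tensor (@continuous_cbump R 4) csk).
have iux := rL1_continuous cux; have iuy := rL1_continuous cuy.
have G := mode_gradient k da da1 ca2 a10 a1pi iu iux iuy (@rweak_emode_x R k 2) (@rweak_emode_y R k 4).
have ctE (f : R -> R) : continuous f -> continuous (tE k f).
  by move=> cf; apply: continuous_tensor => //; exact: continuous_even_ext.
pose A := tint (fun p => tE k (helm k a a2) p * u p).
have AE : A = - tint (fun p => tE k a2 p * u p) + k%:R ^+ 2 * tint (fun p => tE k a p * u p).
  have i1 := rL1_cont (ctE _ ca2) iu; have i2 := rL1_cont (ctE _ c0) iu.
  rewrite -(tintN i1) -(tintZ _ i2) -(tintD (rL1N i1) (rL1Z _ i2)).
  by apply: tint_eq => p _; rewrite /tE /tensor /even_ext /helm; ring.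
have RE : complex.Re (pairing k lam a a2 b b2 (data0 k)) = A.
  have m1 (m f : R * R -> R) : mult m (cplx f) = Complex (tint (fun p => m p * f p)) 0.
    by rewrite /mult cint_scale re_cplx im_cplx tint_mul0.
  have m2 (m : R * R -> R) : mult m (fun=> 0) = Complex 0 0.
    by have := m1 m (fun=> 0); rewrite tint_mul0 => <-.
  have -> : pairing k lam a a2 b b2 (data0 k) =
      mult (tE k (helm k a a2)) (cplx u) + Complex 0 1 * mult (tE k (helm k b b2)) (cplx u)
      - Complex 0 1 * lam%:C%C * (mult (tE k a) (fun=> 0) + Complex 0 1 * mult (tE k b) (fun=> 0)).
    by [].
  rewrite !m2 !m1 -/A.
  by move: (A) (tint _) => ? ? /=; ring.
rewrite RE AE -G.
have F1 : 0 <= tint (fun p => tensor (odd_ext a1) (cosk k) p * ux p).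
  apply: tint_ge0 => p Tp; rewrite /ux /tensor.
  rewrite [leRHS](_ : _ = (odd_ext a1 p.1 * dbump 4 p.1) * cosk k p.2 ^+ 2); last by ring.
  apply: mulr_ge0; last exact: sqr_ge0.
  have [h|h] := leP (cos p.1) 0.
    by rewrite /dbump /= (cbump_eq0 2 h) mul0r mulr0 oppr0 mulr0.
  have hp := cos_inside Tp h.
  rewrite odd_extE//.
  have [-> _] : a1 `|p.1| = - sin `|p.1| /\ cos `|p.1| <= a `|p.1|.
    by apply: inside; rewrite normr_ge0 ltW.
  have -> : Num.sg p.1 * - sin `|p.1| = - sin p.1.
    have [q|q|->] := ltrgtP p.1 0.
    - by rewrite ltr0_sg// ltr0_norm// sinN; ring.
    - by rewrite gtr0_sg// gtr0_norm//; ring.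
    - by rewrite sgr0 mul0r sin0 oppr0.
  rewrite /dbump [leRHS](_ : _ = 4 * (cbump 3 p.1 * sin p.1 ^+ 2)); last by rewrite /=; ring.
  by rewrite mulr_ge0// mulr_ge0 ?sqr_ge0// cbump_ge0.
have F2 : tint (tensor (cbump 5) (fun y : R => sink k y ^+ 2)) * k%:R <=
    - tint (fun p => tensor (even_ext a) (sink k) p * uy p).
  have i3 : rL1 (fun p => tensor (even_ext a) (sink k) p * uy p).
    by apply: rL1_cont => //; apply: continuous_tensor => //; exact: continuous_even_ext.
  have i4 := rL1_continuous (@cS 5).
  rewrite mulrC -(tintZ _ i4) -(tintN i3); apply: tint_le; [exact: rL1Z|exact: rL1N|].
  move=> p Tp; rewrite /uy /tensor /even_ext.
  rewrite [leRHS](_ : _ = k%:R * ((a `|p.1| * cbump 4 p.1) * sink k p.2 ^+ 2)); last by ring.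
  apply: ler_wpM2l => //; apply: ler_wpM2r; first exact: sqr_ge0.
  have [h|h] := leP (cos p.1) 0.
    by rewrite (cbump_eq0 3 h) (cbump_eq0 4 h) mulr0.
  have hp := cos_inside Tp h.
  have [_ le] : a1 `|p.1| = - sin `|p.1| /\ cos `|p.1| <= a `|p.1|.
    by apply: inside; rewrite normr_ge0 ltW.
  by rewrite -cbumpS; apply: ler_wpM2r; [exact: cbump_ge0|rewrite -[cos p.1]cos_norm].
have H := cbump5_mean; rewrite -sin_sqr_mean in H.
move: F1 F2 H; move: (tint _) (tint (tensor (cbump 5) _)) (tint _) => z1 z2 z3 F1 F2 H.
have kk : 0 <= k%:R :> R by [].
have m1 := ler_wpM2l kk F2.
have m2 : pi ^+ 2 / 4 * k%:R ^+ 2 <= z2 * k%:R ^+ 2.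
  by apply: ler_wpM2r; [exact: sqr_ge0|lra].
move: m1 m2; lra.
Qed.

End LowerBound.

(** * Approximate modes *)

Section Profile.
Context {R : realType}.
Implicit Types (x y s : R).

(** The two components of an approximate mode a + i b on the half circle, which
    is cos x up to a constant in the undamped strip; eta bounds the residuals of
    its equation. *)
Record profile (lam eta : R) (w : R -> R) := Profile {
  pa : R -> R; pa1 : R -> R; pa2 : R -> R;
  pb : R -> R; pb1 : R -> R; pb2 : R -> R;
  profile_da : forall x, is_derive x 1 pa (pa1 x);
  profile_da1 : forall x, is_derive x 1 pa1 (pa2 x);
  profile_db : forall x, is_derive x 1 pb (pb1 x);
  profile_db1 : forall x, is_derive x 1 pb1 (pb2 x);
  profile_ca2 : continuous pa2;
  profile_cb2 : continuous pb2;
  profile_a10 : pa1 0 = 0; profile_a1pi : pa1 pi = 0;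
  profile_b10 : pb1 0 = 0; profile_b1pi : pb1 pi = 0;
  profile_inside : forall x, 0 <= x <= pi / 2 -> pa1 x = - sin x /\ cos x <= pa x;
  profile_bound : forall x, 0 <= x <= pi ->
    [/\ `|pa x| <= 1 + eta, `|pb x| <= 1 + eta, `|pa1 x| <= 1 + eta & `|pb1 x| <= 1 + eta];
  profile_resa : forall x, 0 <= x <= pi -> `|- pa2 x - pa x - lam * w x * pb x| <= eta;
  profile_resb : forall x, 0 <= x <= pi -> `|- pb2 x - pb x + lam * w x * pa x| <= eta
}.

Lemma eq_of_derive0 (f g : R -> R) x y : (forall x, is_derive x 1 f (g x)) -> x <= y ->
  (forall z, x <= z <= y -> g z = 0) -> f x = f y.
Proof.
move=> df xy g0; have [c hc e] := mean_valueT xy df.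
by move: e; rewrite g0// mul0r => /eqP; rewrite subr_eq0 => /eqP.
Qed.

Lemma cos_inside01 x : 0 <= x -> x <= pi / 2 -> 0 <= cos x.
Proof. by move=> h1 h2; apply: cos_ge0_pihalf; have := pihalf_gt0; lra. Qed.

(** Adding this second primitive of - pos (cos x) to a layer which is affine of
    slope -1 up to x = pi / 2 gives cos x plus a constant inside, and does not
    change the layer outside. *)
Lemma glue_exists : exists c c1 : R -> R,
  [/\ forall x, is_derive x 1 c (c1 x), forall x, is_derive x 1 c1 (- pos (cos x)),
      forall x, 0 <= x <= pi / 2 -> c x = cos x + x - pi / 2 /\ c1 x = 1 - sin x &
      forall x, pi / 2 <= x <= pi -> c x = 0 /\ c1 x = 0].
Proof.
have ccos : continuous (cos : R -> R) by exact: is_derive_continuous der_cos.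
have cpos : continuous (fun x : R => - pos (cos x)).
  by move=> x; apply: cvgN; exact: (continuous_compf continuous_pos ccos).
have [c1 [dc1 c1h]] := primitive_exists (pi / 2) cpos.
have [c [dc ch]] := primitive_exists (pi / 2) (is_derive_continuous dc1).
have pi0 := @pihalf_gt0 R.
have in1 x : 0 <= x <= pi / 2 -> c1 x = 1 - sin x.
  move=> /andP[x0 x1].
  have d y := derD (dc1 y) (der_sin y).
  have := eq_of_derive0 d x1; rewrite c1h sin_pihalf => e.
  suff : c1 x + sin x = 0 + 1 by lra.
  apply: e => z /andP[z0 z1]; rewrite pos_id ?addNr//.
  by apply: cos_inside01; lra.
have out1 x : pi / 2 <= x <= pi -> c1 x = 0.
  move=> /andP[x0 x1]; rewrite -c1h; apply/esym/(eq_of_derive0 dc1 x0) => z /andP[z0 z1].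
  by rewrite pos_eq0 ?oppr0//; apply: cos_outside; lra.
exists c, c1; split => //.
- move=> x hx; split; last exact: in1.
  have /andP[x0 x1] := hx.
  have d y := derB (derB (dc y) (der_cos y)) (derid y).
  have := eq_of_derive0 d x1; rewrite ch cos_pihalf => e.
  suff : c x - cos x - x = 0 - 0 - pi / 2 by lra.
  apply: e => z /andP[z0 z1]; rewrite in1; first by ring.
  by apply/andP; split; lra.
- move=> x hx; split; last exact: out1.
  have /andP[x0 x1] := hx; rewrite -ch; apply/esym/(eq_of_derive0 dc x0) => z /andP[z0 z1].
  by apply: out1; apply/andP; split; lra.
Qed.

Lemma sqr_le_norm (u v t : R) : 0 <= t -> u ^+ 2 + v ^+ 2 <= t ^+ 2 -> `|u| <= t /\ `|v| <= t.
Proof.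
move=> t0 h; split; rewrite -(@ler_pXn2r _ 2)// ?nnegrE// real_normK ?num_real//.
  by have := sqr_ge0 v; lra.
by have := sqr_ge0 u; lra.
Qed.

(** The profile is cos x + e(0) inside and e(x - pi / 2) outside, e being the
    boundary layer: the slopes -1 of the cosine and of the layer agree at the
    edge. The residual of f'' + f = i lam w f is the constant e(0) inside and e
    itself outside, where e'' = i lam w e; both are bounded by eta = |e(0)|. *)
Lemma profile_exists (w : R -> R) (L lam h m : R) :
  continuous w -> (forall s, 0 <= w s) -> (forall s, w s <= L) ->
  (forall s, s <= 0 -> w s = 0) ->
  0 < lam -> 0 < h -> h <= pi / 2 -> 0 < m -> (forall s, h / 2 <= s <= h -> m <= w s) ->
  exists2 eta, [/\ 0 <= eta & 4 * h <= eta -> lam * m * h * eta <= 4] &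
    inhabited (profile lam eta (fun x => w (x - pi / 2))).
Proof.
move=> cw w0 wL wneg lam0 h0 hl m0 wm.
have [ea [eb [ea1 [eb1 [[dea deb] [dea1 deb1] [ea10 eb10 ea1l eb1l] [ea0 bound] layer]]]]] :=
  layer_solution cw w0 wL lam0 h0 hl m0 wm.
have [c [c1 [dc dc1 c_in c_out]]] := glue_exists.
have pi0 := @pihalf_gt0 R.
pose eta := Num.sqrt (ea 0 ^+ 2 + eb 0 ^+ 2).
have eta0 : 0 <= eta by exact: sqrtr_ge0.
have etaE : eta ^+ 2 = ea 0 ^+ 2 + eb 0 ^+ 2 by rewrite sqr_sqrtr// addr_ge0// sqr_ge0.
exists eta; first by split => //; exact: layer.
have neg1 s : s <= 0 -> ea1 s = -1 /\ eb1 s = 0.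
  move=> s0; split.
    rewrite -ea10; apply: (eq_of_derive0 dea1 s0) => z /andP[_ z0].
    by rewrite wneg// mulr0 mul0r oppr0.
  rewrite -eb10; apply: (eq_of_derive0 deb1 s0) => z /andP[_ z0].
  by rewrite wneg// mulr0 mul0r.
have neg0 s : s <= 0 -> ea s = ea 0 - s /\ eb s = eb 0.
  move=> s0; split.
    have d y := derD (dea y) (derid y).
    have := eq_of_derive0 d s0; rewrite addr0 => e.
    suff : ea s + s = ea 0 by lra.
    by apply: e => z /andP[_ z0]; rewrite (neg1 z z0).1 addNr.
  by apply: (eq_of_derive0 deb s0) => z /andP[_ z0]; rewrite (neg1 z z0).2.
have ds x : is_derive x 1 (fun y => y - pi / 2) (1 : R).
  by apply: (der_eq (derB (derid x) (derc (pi / 2) x))); rewrite subr0.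
have sh (f f1 : R -> R) : (forall s, is_derive s 1 f (f1 s)) ->
    forall x, is_derive x 1 (fun x => f (x - pi / 2)) (f1 (x - pi / 2)).
  move=> df x; apply: (der_eq (@derC _ f (fun y => y - pi / 2) x _ _ (df _) (ds x))).
  by rewrite mulr1.
have cshift (f : R -> R) : continuous f -> continuous (fun x => f (x - pi / 2)).
  by move=> cf; apply: (continuous_compf cf); exact: is_derive_continuous ds.
pose a x := c x + ea (x - pi / 2).
pose a1 x := c1 x + ea1 (x - pi / 2).
pose a2 x := - pos (cos x) + - (lam * w (x - pi / 2) * eb (x - pi / 2)).
pose b x := eb (x - pi / 2).
pose b1 x := eb1 (x - pi / 2).
pose b2 x := lam * w (x - pi / 2) * ea (x - pi / 2).
have ccos : continuous (cos : R -> R) by exact: is_derive_continuous der_cos.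
have cws := cshift _ cw.
have cpr (f : R -> R) : continuous f -> continuous (fun x => lam * w (x - pi / 2) * f (x - pi / 2)).
  by move=> /cshift cf; exact: (continuousMf (@continuousZf _ lam _ cws) cf).
have inout x : 0 <= x <= pi -> 0 <= x <= pi / 2 \/ pi / 2 <= x <= pi.
  move=> /andP[x0 x1]; have [h'|/ltW h'] := leP x (pi / 2).
    by left; rewrite x0.
  by right; rewrite h'.
have ain x : 0 <= x <= pi / 2 -> a x = cos x + ea 0 /\ a1 x = - sin x.
  move=> hx; have [e1 e2] := c_in x hx; have /andP[x0 x1] := hx.
  have s0 : x - pi / 2 <= 0 by lra.
  by rewrite /a /a1 e1 e2 (neg0 _ s0).1 (neg1 _ s0).1; split; ring.
have bin x : 0 <= x <= pi / 2 -> b x = eb 0 /\ b1 x = 0.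
  move=> /andP[x0 x1]; have s0 : x - pi / 2 <= 0 by lra.
  by rewrite /b /b1 (neg0 _ s0).2 (neg1 _ s0).2.
have win x : 0 <= x <= pi / 2 -> w (x - pi / 2) = 0.
  by move=> /andP[x0 x1]; apply: wneg; lra.
have aout x : pi / 2 <= x <= pi -> a x = ea (x - pi / 2) /\ a1 x = ea1 (x - pi / 2).
  by move=> hx; have [e1 e2] := c_out x hx; rewrite /a /a1 e1 e2 !add0r.
have bout x : pi / 2 <= x <= pi ->
    [/\ `|ea (x - pi / 2)| <= eta, `|eb (x - pi / 2)| <= eta,
        `|ea1 (x - pi / 2)| <= 1 & `|eb1 (x - pi / 2)| <= 1].
  move=> /andP[x0 x1].
  have [|q1 q2] := bound (x - pi / 2); first by apply/andP; split; lra.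
  have [r1 r2] : `|ea (x - pi / 2)| <= eta /\ `|eb (x - pi / 2)| <= eta.
    by apply: sqr_le_norm => //; rewrite etaE.
  have [r3 r4] : `|ea1 (x - pi / 2)| <= 1 /\ `|eb1 (x - pi / 2)| <= 1.
    by apply: sqr_le_norm => //; rewrite expr1n.
  by split.
have [e0a e0b] : `|ea 0| <= eta /\ `|eb 0| <= eta.
  by apply: sqr_le_norm => //; rewrite etaE.
have pcos x : 0 <= x <= pi / 2 -> pos (cos x) = cos x.
  by move=> /andP[x0 x1]; rewrite pos_id//; exact: cos_inside01.
have pcos0 x : pi / 2 <= x <= pi -> pos (cos x) = 0.
  by move=> /andP[x0 x1]; rewrite pos_eq0//; exact: cos_outside.
have le_one : 1 <= 1 + eta by lra.
have le_eta : eta <= 1 + eta by lra.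
constructor; exists a a1 a2 b b1 b2.
- by move=> x; exact: (derD (dc x) (sh _ _ dea x)).
- by move=> x; exact: (derD (dc1 x) (sh _ _ dea1 x)).
- exact: sh deb.
- by move=> x; exact: (sh _ _ deb1 x).
- move=> x; apply: cvgD; apply: cvgN.
    exact: (continuous_compf continuous_pos ccos).
  by apply: cpr; exact: is_derive_continuous deb.
- by apply: cpr; exact: is_derive_continuous dea.
- have [|_ ->] := ain 0; last by rewrite sin0 oppr0.
  by rewrite lexx ltW.
- have [|_ ->] := aout pi; first by apply/andP; split; lra.
  by rewrite (_ : pi - pi / 2 = pi / 2 :> R) ?ea1l//; field.
- have [|_ ->//] := bin 0; by rewrite lexx ltW.
- by rewrite /b1 (_ : pi - pi / 2 = pi / 2 :> R) ?eb1l//; field.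
- by move=> x hx; have [-> ->] := ain x hx; split => //; lra.
- move=> x hx; have [hi|ho] := inout x hx.
  + have [-> ->] := ain x hi; have [-> ->] := bin x hi.
    have n1 : `|cos x| <= 1 by rewrite ler_norml cos_geN1 cos_le1.
    have n2 : `|sin x| <= 1 by rewrite ler_norml sin_geN1 sin_le1.
    rewrite normrN normr0; split.
    * by apply: (le_trans (ler_normD _ _)); exact: lerD.
    * exact: le_trans e0b le_eta.
    * exact: le_trans n2 le_one.
    * exact: le_trans ler01 le_one.
  + have [-> ->] := aout x ho; have [r1 r2 r3 r4] := bout x ho.
    by split; [exact: le_trans r1 le_eta|exact: le_trans r2 le_eta|exact: le_trans r3 le_one|
      exact: le_trans r4 le_one].
- move=> x hx; have [hi|ho] := inout x hx.
  + rewrite /a2 (win x hi) (pcos x hi) (ain x hi).1.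
    by rewrite [X in `|X|](_ : _ = - ea 0) ?normrN//; ring.
  + have [r1 _ _ _] := bout x ho; rewrite /a2 (pcos0 x ho) (aout x ho).1 /b.
    by rewrite [X in `|X|](_ : _ = - ea (x - pi / 2)) ?normrN//; ring.
- move=> x hx; have [hi|ho] := inout x hx.
  + rewrite /b2 (win x hi) (bin x hi).1.
    by rewrite [X in `|X|](_ : _ = - eb 0) ?normrN//; ring.
  + have [_ r1 _ _] := bout x ho; rewrite /b2 (aout x ho).1 /b.
    by rewrite [X in `|X|](_ : _ = - eb (x - pi / 2)) ?normrN//; ring.
Qed.

End Profile.

(** * Dampings supported off a strip *)

Section Powers.
Context {R : realType}.
Implicit Types (x y h s M : R).

Lemma powRE x r : 0 < x -> x `^ r = expR (r * ln x).
Proof. by move=> x0; rewrite /powR gt_eqF. Qed.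

Lemma continuous_powR_at r x : 0 < x -> {for x, continuous (fun x => x `^ r)}.
Proof.
move=> x0; apply/differentiable_continuous/derivable1_diffP/derivable_powR.
by rewrite in_itv /= x0.
Qed.

(** The factor 2 ^ -|r| covers both signs of the exponent. *)
Lemma powR_half_le r h s : 0 < h -> h / 2 <= s <= h -> 2 `^ (- `|r|) * h `^ r <= s `^ r.
Proof.
move=> h0 /andP[s1 s2]; have s0 : 0 < s by lra.
have two : 0 < 2 :> R by [].
rewrite !powRE// -expRD ler_expR.
have l1 : ln s <= ln h by rewrite ler_ln ?posrE.
have l2 : ln h - ln 2 <= ln s by rewrite -ln_div ?posrE// ler_ln ?posrE// divr_gt0.
have [r0|r0] := leP 0 r.
  rewrite ger0_norm//; have := ler_wpM2l r0 l2; lra.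
rewrite ltr0_norm//; have r0' : 0 <= - r by rewrite oppr_ge0 ltW.
have l0 : 0 <= ln 2 :> R by rewrite ln_ge0// ler1n.
have := mulr_ge0 r0' l0; have := ler_wpM2l r0' l1; lra.
Qed.

Lemma powR_range_le r M x : 1 <= M -> M^-1 <= x -> x <= M -> x `^ r <= M `^ `|r|.
Proof.
move=> M1 x1 x2; have M0 : 0 < M by lra.
have x0 : 0 < x by apply: lt_le_trans x1; rewrite invr_gt0.
rewrite !powRE// ler_expR.
have l1 : ln x <= ln M by rewrite ler_ln ?posrE.
have l2 : - ln M <= ln x by rewrite -lnV ?posrE// ler_ln ?posrE// invr_gt0.
apply: (le_trans (ler_norm _)); rewrite normrM ler_wpM2l//.
by rewrite ler_norml l1 l2.
Qed.

(** The width h = lam ^ (-1 / (r + 2)) balances the thickness of the layer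
    with the strength lam h ^ r of the damping in it. *)
Lemma layer_width (r lam eta c : R) : - 2 < r -> 0 < lam -> 0 < c -> c <= 1 ->
  let h := lam `^ (- (r + 2)^-1) in
  (4 * h <= eta -> lam * (c * h `^ r) * h * eta <= 4) -> eta <= 4 / c * h.
Proof.
move=> r2 lam0 c0 c1 h hyp; have h0 : 0 < h by exact: powR_gt0.
have c4 : 4 * h <= 4 / c * h.
  by rewrite ler_pM2r// ler_pdivlMr// ler_piMr.
have [e|/ltW e] := leP (4 * h) eta; last exact: le_trans c4.
have {hyp e} := hyp e.
have r20 : r + 2 != 0 by rewrite gt_eqF//; lra.
have key : lam * h `^ r * h = h^-1.
  have lamE : lam = h `^ (- (r + 2)).
    by rewrite /h -powRrM mulNr mulrN opprK mulVf// powRr1// ltW.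
  rewrite {1}lamE -powRD; last by rewrite (gt_eqF h0) implybT.
  rewrite -{2}[h]powRr1 ?(ltW h0)// -powRD; last by rewrite (gt_eqF h0) implybT.
  by rewrite -powR_inv1 ?(ltW h0)//; congr (_ `^ _); ring.
have -> : lam * (c * h `^ r) * h * eta = c * (lam * h `^ r * h) * eta by ring.
rewrite key => le; have hn : h != 0 by rewrite gt_eqF.
rewrite -(@ler_pM2l _ (c / h)) ?divr_gt0//.
rewrite [leRHS](_ : _ = 4); last by field; rewrite hn gt_eqF.
by apply: le_trans le; rewrite lexx.
Qed.

End Powers.

Section Damping.
Context {R : realType}.
Implicit Types (x s M h : R).
Local Notation T2 := (@torus R).
Local Notation mA := (@area R).
Variables (beta c : R).
Hypothesis c0 : 0 <= c.

(** The damping as a function of the distance to the edge of its support. *)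
Definition om s := s `^ beta + c.

Definition ramp M s := clamp 0 1 (M * s - 1).

(** A continuous truncation of om, for which layers exist: the ramp vanishes up
    to s = 1 / M, and the clamp keeps the power away from 0 and infinity. *)
Definition damp M s := ramp M s * om (clamp M^-1 (pi / 2) s).

Lemma om_ge0 s : 0 <= om s.
Proof. by rewrite addr_ge0// powR_ge0. Qed.

Lemma ramp_01 M s : 0 <= ramp M s <= 1.
Proof. by apply: clampP. Qed.

Lemma damp_ge0 M s : 0 <= damp M s.
Proof. by rewrite mulr_ge0 ?om_ge0//; have /andP[] := ramp_01 M s. Qed.

Let pih1 : 1 <= pi / 2 :> R. Proof. exact: pihalf_ge1. Qed.

Let Minv M : 1 <= M -> M^-1 <= pi / 2.
Proof. by move=> M1; apply: le_trans pih1; rewrite invf_le1//; lra. Qed.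

Lemma damp_neg M s : 1 <= M -> s <= M^-1 -> damp M s = 0.
Proof.
move=> M1 sM; rewrite /damp /ramp.
have h : M * s - 1 <= 0.
  rewrite subr_le0 -(@mulfV _ M) ?gt_eqF//; last by lra.
  by rewrite ler_wpM2l//; lra.
rewrite /clamp; have -> : Num.min 1 (M * s - 1) = M * s - 1.
  by apply/min_idPr; lra.
have -> : Num.max 0 (M * s - 1) = 0 by apply/max_idPl.
by rewrite mul0r.
Qed.

Lemma damp_eq M s : 1 <= M -> 2 <= M * s -> s <= pi / 2 -> damp M s = om s.
Proof.
move=> M1 Ms s1; rewrite /damp /ramp.
have h : 1 <= M * s - 1 by lra.
have M0 : 0 < M by lra.
have -> : clamp 0 1 (M * s - 1) = 1.
  rewrite /clamp; have -> : Num.min 1 (M * s - 1) = 1 by apply/min_idPl.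
  by apply/max_idPr; exact: ler01.
rewrite mul1r clamp_id// s1 andbT -(@ler_pM2l _ M)// mulfV ?gt_eqF//; lra.
Qed.

Lemma damp_le M s : 1 <= M -> 0 <= s -> s <= pi / 2 -> damp M s <= om s.
Proof.
move=> M1 s0 s1; have [h|/ltW h] := leP s M^-1.
  by rewrite damp_neg// om_ge0.
rewrite /damp clamp_id ?h// -[leRHS]mul1r ler_wpM2r ?om_ge0//.
by have /andP[] := ramp_01 M s.
Qed.

Lemma damp_continuous M : 1 <= M -> continuous (damp M).
Proof.
move=> M1; have M0 : 0 < M by lra.
apply: continuousMf.
  apply: (continuous_compf (@clamp_continuous R 0 1)).
  exact: (is_derive_continuous (fun s => derB (derZ M (derid s)) (derc 1 s))).
have cc := @clamp_continuous R M^-1 (pi / 2).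
move=> s; apply: cvgD; last exact: cvg_cst.
apply: (@continuous_comp _ _ _ (clamp M^-1 (pi / 2)) (fun x => x `^ beta)); first exact: cc.
apply: continuous_powR_at; have /andP[h _] := clampP s (Minv M1).
by apply: lt_le_trans h; rewrite invr_gt0.
Qed.

Lemma damp_bounded M s : 2 <= M -> damp M s <= M `^ `|beta| + c.
Proof.
move=> M2; have M1 : 1 <= M by lra.
have /andP[h1 h2] := ramp_01 M s.
apply: (@le_trans _ _ (om (clamp M^-1 (pi / 2) s))).
  by rewrite -[leRHS]mul1r ler_wpM2r ?om_ge0.
rewrite lerD2r; have /andP[q1 q2] := clampP s (Minv M1).
apply: powR_range_le => //; apply: (le_trans q2).
by have := @pihalf_lt2 R; lra.
Qed.

Lemma damp_lower M h s : 1 <= M -> 0 < h -> h <= pi / 2 -> 4 <= M * h -> h / 2 <= s <= h ->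
  2 `^ (- `|beta|) * h `^ beta <= damp M s.
Proof.
move=> M1 h0 h1 Mh hs; have /andP[s1 s2] := hs.
have M0 : 0 <= M by lra.
have hM := ler_wpM2l M0 s1.
rewrite damp_eq//; [|by lra|by lra].
by apply: (le_trans (powR_half_le beta h0 hs)); rewrite /om lerDl.
Qed.

(** The edge |x| = pi / 2 is left out: it is negligible, and the explicit damping
    jumps there. *)
Definition strip_damping (W : R * R -> R) := forall p, T2 p ->
  [/\ 0 <= W p, `|p.1| < pi / 2 -> W p = 0 & pi / 2 < `|p.1| -> W p = om (`|p.1| - pi / 2)].

Lemma edge_null : mA.-negligible [set p | `|p.1| = pi / 2].
Proof.
have half : forall a : R, mA ([set a] `*` setT) = 0%E.
  move=> a; rewrite /area product_measure1E//.
  by rewrite /= (@lebesgue_measure_set1 R a) mul0e.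
pose N := ([set (pi / 2 : R)] `*` setT) `|` ([set (- (pi / 2) : R)] `*` setT) : set (R * R).
have mN a : measurable ([set a : R] `*` setT : set (R * R)) by exact: measurableX.
exists N; split; first exact: (measurableU _ _ (mN _) (mN _)).
  by apply: (@null_set_setU _ _ _ mA); [exact: mN|exact: mN|exact: half|exact: half].
move=> [x y] /=; rewrite /N /=.
have [h|h] := leP 0 x; first by rewrite ger0_norm// => ->; left.
by rewrite ltr0_norm// => e; right; split => //=; rewrite -e opprK.
Qed.

Variable W : R * R -> R.
Hypothesis HW : strip_damping W.

Lemma strip_damping0 p : T2 p -> 0 < cos p.1 -> W p = 0.
Proof. by move=> Tp h; have [_ W0 _] := HW Tp; apply: W0; exact: cos_inside. Qed.

Let gap M (g : R * R -> R) p := (W p - damp M (`|p.1| - pi / 2)) * g p.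

Let Tpi p : T2 p -> `|p.1| <= pi.
Proof. by case=> /=; rewrite in_itv /= => /andP[h1 h2] _; rewrite ler_norml h1 ltW. Qed.

Let damp_le_W M p : 1 <= M -> T2 p -> damp M (`|p.1| - pi / 2) <= W p.
Proof.
move=> M1 Tp; have [W0 W1 W2] := HW Tp.
have [h|h] := leP (`|p.1|) (pi / 2).
  rewrite damp_neg//; apply: (@le_trans _ _ 0); first by rewrite subr_le0.
  by rewrite invr_ge0; lra.
rewrite W2//; apply: damp_le => //; first by rewrite subr_ge0 ltW.
by have := Tpi Tp; lra.
Qed.

Let cdamp M : 1 <= M -> continuous (fun p : R * R => damp M (`|p.1| - pi / 2)).
Proof.
move=> M1 p; apply: (@continuous_comp _ _ _ fst (fun x => damp M (`|x| - pi / 2))); first exact: cvg_fst.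
apply: (@continuous_compf _ (damp M) (fun x : R => `|x| - pi / 2)); first exact: damp_continuous.
by move=> x; apply: cvgB; [exact: norm_continuous|exact: cvg_cst].
Qed.

(** Dominated convergence: the truncations lie between 0 and W, and off the edge
    they are eventually equal to W. *)
Lemma damp_tail (g : R * R -> R) : rL1 g -> rL1 (fun p => W p * g p) ->
  tint (fun p => `|(W p - damp n.+1%:R (`|p.1| - pi / 2)) * g p|) @[n --> \oo] --> (0 : R).
Proof.
move=> ig iW.
have M1 n : 1 <= n.+1%:R :> R by rewrite ler1n.
have ig_ n : rL1 (gap n.+1%:R g).
  have i1 := rL1_cont (cdamp (M1 n)) ig.
  by apply: (rL1_eq _ (rL1B iW i1)) => p _; rewrite /gap mulrBl.
have jg n := rL1_norm (ig_ n).
have dom n p : T2 p -> `|gap n.+1%:R g p| <= `|W p * g p|.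
  move=> Tp; rewrite /gap !normrM ler_wpM2r//.
  have l1 := damp_le_W (M1 n) Tp; have l2 := damp_ge0 n.+1%:R (`|p.1| - pi / 2).
  by rewrite ger0_norm ?subr_ge0// ger0_norm; lra.
have lim : {ae mA, forall p, T2 p -> (`|gap n.+1%:R g p|)%:E @[n --> \oo] --> 0%E}.
  have [N [mN N0 sN]] := edge_null.
  exists N; split => //; apply: subset_trans sN => p /= nc; apply: contrapT => hp; apply: nc => Tp.
  have [_ W0 W1] := HW Tp.
  apply: cvg_near_cst.
  have [h|h|//] := ltgtP `|p.1| (pi / 2).
    apply: nearW => n; rewrite /gap W0// damp_neg ?subr0 ?mul0r ?normr0//.
    by apply: (@le_trans _ _ 0); [rewrite subr_le0 ltW|rewrite invr_ge0].
  have s0 : 0 < `|p.1| - pi / 2 by rewrite subr_gt0.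
  near=> n; rewrite /gap W1// damp_eq ?subrr ?mul0r ?normr0//.
    rewrite -ler_pdivrMr//; apply: (@le_trans _ _ n%:R); last by rewrite ler_nat.
    by near: n; exact: nbhs_infty_ger.
  by have := Tpi Tp; lra.
have le : {ae mA, forall p n, T2 p -> (`| (`|gap n.+1%:R g p|)%:E | <= (`|W p * g p|)%:E)%E}.
  by apply: aeW => p n Tp /=; rewrite lee_fin normr_id; exact: dom.
have [_ _ H] := @dominated_convergence _ _ _ mA T2 measurable_torus
  (fun n p => (`|gap n.+1%:R g p|)%:E) (cst 0%E) (fun p => (`|W p * g p|)%:E)
  (fun n => measurable_int _ (jg n)) (measurable_cst _) lim (rL1_norm iW) le.
move: H; rewrite integral0 => H.
exact: (fine_cvg H).
Unshelve. all: by end_near. Qed.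

End Damping.

(** * Comparison of rates *)

Section Rates.
Context {R : realType}.
Implicit Types (x y t T p g : R).

(** Young's inequality. *)
Lemma powR_bernoulli x p : 0 <= x -> 0 < p -> p < 1 -> x `^ p <= p * x + (1 - p).
Proof.
move=> x0 p0 p1.
have q0 : 0 < 1 - p by lra.
have H := @conjugate_powR R (x `^ p) 1 p^-1 (1 - p)^-1 (powR_ge0 _ _) ler01.
rewrite !invrK in H.
have {H} := H ltac:(by rewrite invr_gt0) ltac:(by rewrite invr_gt0) ltac:(ring).
rewrite mulr1 powR1 mul1r -powRrM mulfV ?gt_eqF// powRr1//.
by rewrite mulrC.
Qed.

Lemma powR_concave x y p : 0 <= x -> x <= y -> 0 < y -> 0 < p -> p < 1 ->
  p * ((y - x) * y `^ (p - 1)) <= y `^ p - x `^ p.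
Proof.
move=> x0 xy y0 p0 p1; have yn : y != 0 by rewrite gt_eqF.
have z0 : 0 <= x / y by rewrite divr_ge0// ltW.
have H := powR_bernoulli z0 p0 p1.
have xE : x `^ p = (x / y) `^ p * y `^ p by rewrite -powRM ?(ltW y0)// divfK.
have yE : y `^ (p - 1) = y `^ p / y.
  by rewrite powRB ?yn ?implybT// powRr1// ltW.
have yp : 0 <= y `^ p by exact: powR_ge0.
have := ler_wpM2r yp H; rewrite -xE yE.
rewrite [X in _ -> X <= _](_ : _ = (p - p * (x / y)) * y `^ p); last by field.
by move: (x / y) (y `^ p) (x `^ p) => *; lra.
Qed.

Lemma bracket_ge1 t : 1 <= bracket t.
Proof. by rewrite -[leLHS]sqrtr1 ler_wsqrtr// lerDl sqr_ge0. Qed.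

Lemma bracket_ge t : t <= bracket t.
Proof.
apply: (le_trans (ler_norm t)); rewrite -sqrtr_sqr ler_wsqrtr//; lra.
Qed.

Lemma powRN_le x y g : 0 < x -> x <= y -> 0 <= g -> y `^ (- g) <= x `^ (- g).
Proof.
move=> x0 xy g0; have y0 : 0 < y by exact: lt_le_trans xy.
rewrite !powRN lef_pV2 ?posrE ?powR_gt0//.
by apply: ge0_ler_powR => //; rewrite nnegrE ltW.
Qed.

Lemma bracket_powRN_le1 t g : 0 <= g -> bracket t `^ (- g) <= 1.
Proof.
move=> g0; have := powRN_le ltr01 (bracket_ge1 t) g0.
by rewrite powR1.
Qed.

Lemma bracket_powRN_le t g : 0 < t -> 0 <= g -> bracket t `^ (- g) <= t `^ (- g).
Proof. by move=> t0 g0; apply: powRN_le => //; exact: bracket_ge. Qed.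

(** By concavity the increments of s ^ (1 - g) / (1 - g) bound the terms, except
    for the first one, which is d. *)
Lemma sum_bracket g d m : 0 < g -> g < 1 -> 0 < d ->
  \sum_(j < m.+1) d * bracket (j%:R * d) `^ (- g) <= d + (m%:R * d) `^ (1 - g) / (1 - g).
Proof.
move=> g0 g1 d0; have p0 : 0 < 1 - g by lra.
elim: m => [|m IH].
  rewrite big_ord1 mul0r powR0 ?gt_eqF// mul0r addr0 -[leRHS]mulr1.
  by rewrite ler_wpM2l ?(ltW d0)// bracket_powRN_le1// ltW.
rewrite big_ord_recr /=.
have y0 : 0 < m.+1%:R * d by rewrite mulr_gt0// ltr0n.
have step : d * bracket (m.+1%:R * d) `^ (- g) <=
    ((m.+1%:R * d) `^ (1 - g) - (m%:R * d) `^ (1 - g)) / (1 - g).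
  have b1 := bracket_powRN_le y0 (ltW g0).
  apply: (le_trans (ler_wpM2l (ltW d0) b1)).
  rewrite ler_pdivlMr// mulrC.
  have x0 : 0 <= m%:R * d by rewrite mulr_ge0// ltW.
  have xy : m%:R * d <= m.+1%:R * d by rewrite ler_wpM2r ?(ltW d0)// ler_nat.
  have := powR_concave x0 xy y0 p0 ltac:(lra).
  rewrite (_ : 1 - g - 1 = - g); last by ring.
  by rewrite (_ : m.+1%:R * d - m%:R * d = d)// -natr1 mulrDl mul1r addrC addrA addNr add0r.
apply: (le_trans (lerD IH step)).
by rewrite -addrA -mulrDl subrKC.
Qed.

Lemma powRDM x r s : 0 < x -> x `^ r * x `^ s = x `^ (r + s).
Proof. by move=> x0; rewrite powRD// (gt_eqF x0) implybT. Qed.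

(** With T = k ^ th both terms are negative powers of k as soon as
    1 / g < th < kap / (1 - g), and such a th exists when g (1 + kap) > 1. *)
Lemma no_such_rate (A c kap g : R) : 0 < A -> 0 < c -> 0 < kap -> 0 < g -> g < 1 ->
  1 < g * (1 + kap) ->
  (forall (k : nat) T, (1 <= k)%N -> 0 < T ->
     c <= A * (k%:R * T `^ (- g) + k%:R `^ (- kap) * T `^ (1 - g))) -> False.
Proof.
move=> A0 c0 kap0 g0 g1 hg H.
have p0 : 0 < 1 - g by lra.
pose th := (g^-1 + kap / (1 - g)) / 2.
have lt : g^-1 < kap / (1 - g).
  by rewrite ltr_pdivlMr// mulrC ltr_pdivrMr//; lra.
have e1 : 0 < th * g - 1.
  have : g^-1 * g < th * g by rewrite ltr_pM2r// /th; lra.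
  by rewrite mulVf ?gt_eqF//; lra.
have e2 : 0 < kap - th * (1 - g).
  have : th * (1 - g) < kap / (1 - g) * (1 - g) by rewrite ltr_pM2r// /th; lra.
  by rewrite divfK ?gt_eqF//; lra.
pose rho := Num.min (th * g - 1) (kap - th * (1 - g)).
have rho0 : 0 < rho by rewrite lt_min e1 e2.
pose B := (2 * A / c) `^ rho^-1.
have B0 : 0 < B by rewrite powR_gt0// divr_gt0// mulr_gt0.
pose k := (Num.bound B).+1.
have k0 : 0 < k%:R :> R by rewrite ltr0n.
have k1 : 1 <= k%:R :> R by rewrite ler1n.
have Bk : B < k%:R.
  apply: (lt_le_trans (archi_boundP (ltW B0))); by rewrite ler_nat.
have T0 : 0 < k%:R `^ th by exact: powR_gt0.
have {H} := H k _ isT T0.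
rewrite -!powRrM -{1}[k%:R]powRr1 ?(ltW k0)// !powRDM// => H.
have small r : rho <= - r -> k%:R `^ r <= k%:R `^ (- rho).
  by move=> hr; apply: ler_powR => //; lra.
have s1 : k%:R `^ (1 + th * - g) <= k%:R `^ (- rho) :> R.
  apply: small; apply: (@le_trans _ _ (th * g - 1)); first by rewrite ge_min lexx.
  by lra.
have s2 : k%:R `^ (- kap + th * (1 - g)) <= k%:R `^ (- rho) :> R.
  apply: small; apply: (@le_trans _ _ (kap - th * (1 - g))); first by rewrite ge_min lexx orbT.
  by lra.
have H2 : c <= A * (2 * k%:R `^ (- rho)).
  apply: (le_trans H); rewrite ler_wpM2l ?(ltW A0)//.
  by apply: (le_trans (lerD s1 s2)); rewrite mulrDl mul1r.
have kr : 2 * A / c < k%:R `^ rho.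
  have -> : 2 * A / c = B `^ rho.
    by rewrite /B -powRrM mulVf ?gt_eqF// powRr1// ltW// divr_gt0// mulr_gt0.
  by apply: gt0_ltr_powR => //; rewrite nnegrE ltW.
have kp : 0 < k%:R `^ rho :> R by exact: powR_gt0.
move: H2; rewrite powRN mulrA ler_pdivlMr// => H2.
move: kr; rewrite ltr_pdivrMr// => kr.
by have := mulrC c (k%:R `^ rho); lra.
Qed.

End Rates.

(** * The decay of the pairing along the orbit *)

Section ObservedMode.
Context {R : realType}.
Implicit Types (X Y : state R) (M t T e d : R).
Local Notation T2 := (@torus R).
Local Notation mA := (@area R).
Variables (beta c : R) (W : R * R -> R) (k : nat).
Hypotheses (hbeta : - 1 < beta) (c0 : 0 <= c) (HW : strip_damping beta c W) (k1 : (1 <= k)%N).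

Definition freq : R := Num.sqrt (k%:R ^+ 2 + 1).
(** The width of the boundary layer, see [layer_width]. *)
Definition width : R := freq `^ (- (beta + 2)^-1).
Definition layer_cst : R := 4 / 2 `^ (- `|beta|).
(** The last term of [pairing_generator] for the truncated damping. *)
Definition tail M X : R :=
  2 * (tint (fun p => `|(W p - damp beta c M (`|p.1| - pi / 2)) * re X.2 p|) +
       tint (fun p => `|(W p - damp beta c M (`|p.1| - pi / 2)) * im X.2 p|)).

Let freq_sqr : freq ^+ 2 = k%:R ^+ 2 + 1.
Proof. by rewrite sqr_sqrtr// addr_ge0// sqr_ge0. Qed.

Lemma freq_ge : k%:R <= freq.
Proof.
have -> : k%:R = Num.sqrt (k%:R ^+ 2) :> R by rewrite sqrtr_sqr ger0_norm.
by rewrite ler_wsqrtr// lerDl.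
Qed.

Lemma freq_ge1 : 1 <= freq.
Proof. by apply: le_trans freq_ge; rewrite ler1n. Qed.

Lemma freq_le : freq <= k%:R + 1.
Proof.
have k0 : 0 <= k%:R :> R by [].
rewrite -[leRHS]ger0_norm ?addr_ge0// -sqrtr_sqr ler_wsqrtr//.
by rewrite sqrrD1 -addrA lerD2l; lra.
Qed.

Let freq0 : 0 < freq. Proof. exact: lt_le_trans ltr01 freq_ge1. Qed.

Lemma width_gt0 : 0 < width. Proof. exact: powR_gt0. Qed.

Let ibeta0 : 0 <= (beta + 2)^-1.
Proof. by rewrite invr_ge0; move: hbeta; lra. Qed.

Lemma width_le1 : width <= 1.
Proof. by have := powRN_le ltr01 freq_ge1 ibeta0; rewrite powR1. Qed.

Lemma width_le : width <= k%:R `^ (- (beta + 2)^-1).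
Proof. by apply: powRN_le freq_ge ibeta0; rewrite ltr0n. Qed.

Let half_gt0 : 0 < 2 `^ (- `|beta|) :> R. Proof. exact: powR_gt0. Qed.

Let half_le1 : 2 `^ (- `|beta|) <= 1 :> R.
Proof. by have := @powRN_le _ 1 2 `|beta| ltr01 ltac:(lra) (normr_ge0 _); rewrite powR1. Qed.

Lemma layer_cst_gt0 : 0 < layer_cst. Proof. by rewrite divr_gt0. Qed.

(** The pairing with the profile of the truncated damping. The bounds do not
    depend on M, except for the tail, so that the truncation can be removed
    along a given finite part of an orbit. *)
Lemma functional_exists M : 2 <= M -> 4 <= M * width ->
  exists Phi : state R -> R[i],
  [/\ (forall z X Y, in_energy_space X -> in_energy_space Y ->
         Phi (add_state (scale_state z X) Y) = z * Phi X + Phi Y),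
      (forall X Y, in_energy_space X -> in_energy_space Y -> eq_state X Y -> Phi X = Phi Y),
      (forall X, in_energy_space X -> cabs (Phi X) <=
         16 * pi * (1 + layer_cst) * (1 + k%:R + freq) * Num.sqrt (energy X)),
      (forall X Y, is_generator W X Y ->
         cabs (Phi Y - Complex 0 1 * freq%:C%C * Phi X) <=
         layer_cst * width * (16 * pi) * Num.sqrt (energy X) +
         freq * (1 + layer_cst) * tail M X) &
      pi ^+ 2 / 4 * k%:R ^+ 2 <= cabs (Phi (data0 k))].
Proof.
move=> M2 Mw; have M1 : 1 <= M by lra.
have w0 := width_gt0; have w1 := width_le1; have pih := @pihalf_ge1 R.
have wp : width <= pi / 2 by lra.
have mpos : 0 < 2 `^ (- `|beta|) * width `^ beta by rewrite mulr_gt0// powR_gt0.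
have wneg s : s <= 0 -> damp beta c M s = 0.
  by move=> s0; apply: damp_neg => //; apply: (le_trans s0); rewrite invr_ge0; lra.
have cd := @damp_continuous R beta c M M1.
have [eta [eta0 hyp] [P]] := profile_exists cd (damp_ge0 beta c0 M)
  (fun s => damp_bounded beta c0 s M2) wneg freq0 w0 wp mpos
  (fun s => damp_lower beta c0 M1 w0 wp Mw).
have b2 : - 2 < beta by move: hbeta; lra.
have etaw : eta <= layer_cst * width := layer_width b2 freq0 half_gt0 half_le1 hyp.
case: P => a a1 a2 b b1 b2' da da1 db db1 ca2 cb2 a10 a1p b10 b1p inside bnd resa resb.
pose S0 := 1 + layer_cst.
have l0 := layer_cst_gt0.
have S00 : 0 <= S0 by rewrite /S0; lra.
have etaS : 1 + eta <= S0.
  rewrite lerD2l; apply: (le_trans etaw).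
  by rewrite -[leRHS]mulr1 ler_wpM2l ?(ltW l0).
have bS x : 0 <= x <= pi -> [/\ `|a x| <= S0, `|b x| <= S0, `|a1 x| <= S0 & `|b1 x| <= S0].
  by move=> /bnd[? ? ? ?]; split; exact: le_trans etaS.
exists (pairing k freq a a2 b b2'); split.
- by move=> z X Y [/H1_L2 ? ?] [/H1_L2 ? ?]; exact: pairing_lin.
- by move=> X Y [/H1_L2 ? ?] [/H1_L2 ? ?]; exact: pairing_ae.
- move=> X hX.
  exact: (pairing_bound k da da1 db db1 ca2 cb2 a10 a1p b10 b1p bS hX S00 (ltW freq0)).
- move=> [u v] Y [hX hY dX eY].
  have [Lg rep] := damped_laplacianP dX; have [Hu Hv _] := dX.
  have hG : in_energy_space (generator W (u, v)).
    split; first exact: Hv.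
    rewrite /generator /=.
    have -> : (fun p => - damped_laplacian W u v p) =
        (fun p => (-1) * damped_laplacian W u v p + (fun=> 0) p).
      by apply/funext => p; rewrite mulN1r addr0.
    by apply: L2_lin => //; exact: L2_zero.
  have [/H1_L2 y1 y2] := hY; have [/H1_L2 g1 g2] := hG.
  rewrite (pairing_ae k freq da db ca2 cb2 y1 y2 g1 g2 eY).
  have cws : continuous (fun x => damp beta c M (x - pi / 2)).
    apply: (continuous_compf cd).
    exact: (is_derive_continuous (fun s => derB (derid s) (derc (pi / 2) s))).
  have := pairing_generator da da1 db db1 ca2 cb2 a10 a1p b10 b1p bS cws freq_sqr eta0
    resa resb Hu Hv Lg S00 (ltW freq0) rep.
  move=> H; apply: (le_trans H); apply: lerD => //.
  by rewrite mulrA ler_wpM2r ?sqrtr_ge0// ler_wpM2r// mulr_ge0// pi_ge0.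
- apply: le_trans (Re_le_cabs _); apply: le_trans (ler_norm _).
  exact: (pairing_data0 k1 freq b b2' da da1 ca2 a10 a1p inside).
Qed.

Variable S : R -> state R -> state R.
Hypotheses (sgS : C0_semigroup S) (genS : generated_by W S).
Variables (Crate g : R).
Hypotheses (C0 : 0 < Crate) (g0 : 0 < g) (g1 : g < 1).
Hypothesis rate : forall t U, 0 < t -> domain W U ->
  Num.sqrt (energy (S t U)) <= Crate * bracket t `^ (- g) * graph_norm W U.

Let S_space t U : 0 <= t -> in_energy_space U -> in_energy_space (S t U).
Proof. by move=> t0 hU; have [/(_ t t0) [h _ _] _ _ _] := sgS; exact: h. Qed.

Let S0E U : in_energy_space U -> eq_state (S 0 U) U.
Proof. by have [_ h _ _] := sgS; exact: h. Qed.

Lemma domain_energy_space U : domain W U -> in_energy_space U.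
Proof. by case=> h1 /H1_L2. Qed.

(** At t = 0 the graph norm bounds the energy. *)
Lemma rate0 t U : 0 <= t -> domain W U ->
  Num.sqrt (energy (S t U)) <= (Crate + 1) * (bracket t `^ (- g) * graph_norm W U).
Proof.
move=> t0 dU; have G0 := graph_norm_ge0 W U; have Crate0 := C0.
have hU := domain_energy_space dU.
have [tp|tn|te] := ltgtP 0 t; last 2 first.
- by move: tn; rewrite ltNge t0.
- rewrite -te (energy_ae (S_space (lexx 0) hU) hU (S0E hU)).
  have -> : bracket (0 : R) `^ (- g) = 1.
    by rewrite /bracket expr0n addr0 sqrtr1 powR1.
  rewrite mul1r; apply: (le_trans (energy_le hU)).
  apply: (@le_trans _ _ (graph_norm W U)); last by rewrite ler_peMl//; lra.
  rewrite /graph_norm; have := normL2_le_normH1 U.2; have := normL2_ge0 (damped_laplacian W U.1 U.2).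
  by move: (norm_grad _) (normL2 _) (normH1 _) (normL2 _) => *; lra.
- apply: (le_trans (rate tp dU)); rewrite -mulrA; apply: ler_wpM2r.
    by rewrite mulr_ge0// powR_ge0.
  by lra.
Qed.

Local Notation quot d := (quotient (d^-1)%:C%C (S d (data0 k)) (data0 k) (data1 k)).

Let g01 : is_generator W (data0 k) (data1 k).
Proof. exact: is_generator_data0. Qed.
Let g12 : is_generator W (data1 k) (data2 k).
Proof. exact: (is_generator_data1 k (strip_damping0 HW)). Qed.

Lemma quot_small e : 0 < e -> exists2 d0, 0 < d0 &
  forall d, 0 < d -> d < d0 -> domain W (quot d) /\ graph_norm W (quot d) <= e.
Proof.
move=> e0; have [h0 h1 d0 e0'] := g01; have [_ h2 d1 e1'] := g12.
have l0 := (genS h0 h1).2 (conj d0 e0').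
have l1 := (genS h1 h2).2 (conj d1 e1').
have e3 : 0 < e / 3 by rewrite divr_gt0.
move/cvgrPdist_le : l0 => /(_ _ e3); rewrite near_withinE => n0.
move/cvgrPdist_le : l1 => /(_ _ e3); rewrite near_withinE => n1.
have [r /= r0 hr] := filterI n0 n1.
exists r => // d dp dr.
have db : ball (0 : R) r d by rewrite /ball /= sub0r normrN gtr0_norm.
have [/(_ dp) q0 /(_ dp) q1] := hr d db.
have [dD G] := quotient_graph sgS genS dp g01 g12; split => //.
apply: (le_trans G).
have ar (x y : R) : x <= e / 3 -> y <= e / 3 -> x + 2 * y <= e by lra.
exact: ar (le_of_dist0 q0) (le_of_dist0 q1).
Qed.

Let G := graph_norm W (data0 k).
Let KK := 16 * pi * (1 + layer_cst) * (1 + k%:R + freq).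
Let rr := layer_cst * width * (16 * pi).

Let G0 : 0 <= G. Proof. exact: graph_norm_ge0. Qed.
Let KK0 : 0 <= KK.
Proof.
have := freq0; have := layer_cst_gt0; have := pi_gt0 R => *.
have k0 : 0 <= k%:R :> R by [].
by rewrite /KK !mulr_ge0//; lra.
Qed.
Let rr0 : 0 <= rr.
Proof.
have := width_gt0; have := layer_cst_gt0; have := pi_gt0 R => *.
by rewrite /rr !mulr_ge0//; lra.
Qed.

Lemma euler_sum M d n : 2 <= M -> 4 <= M * width -> 0 < d ->
  pi ^+ 2 / 4 * k%:R ^+ 2 <= KK * Num.sqrt (energy (S (n%:R * d) (data0 k))) +
    \sum_(j < n) d * (rr * Num.sqrt (energy (S (j%:R * d) (data0 k))) +
       freq * (1 + layer_cst) * tail M (S (j%:R * d) (data0 k)) +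
       KK * Num.sqrt (energy (S (j%:R * d) (quot d)))).
Proof.
move=> M2 Mw d0.
have [Phi [Plin Pae Pbound Pgen Plow]] := functional_exists M2 Mw.
have [h0 _ _ _] := g01.
have nd m : 0 <= m%:R * d by rewrite mulr_ge0// ltW.
have step m : cabs (Phi (S 0 (data0 k))) <= cabs (Phi (S (m%:R * d) (data0 k))) +
    \sum_(j < m) d * (rr * Num.sqrt (energy (S (j%:R * d) (data0 k))) +
       freq * (1 + layer_cst) * tail M (S (j%:R * d) (data0 k)) +
       KK * Num.sqrt (energy (S (j%:R * d) (quot d)))).
  elim: m => [|m IH]; first by rewrite mul0r big_ord0 addr0.
  rewrite big_ord_recr /=; apply: (le_trans IH).
  have := euler_step sgS genS Plin Pae Pbound Pgen (nd m) d0 g01.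
  rewrite (_ : m%:R * d + d = m.+1%:R * d); last by rewrite -natr1 mulrDl mul1r.
  set s := \sum_(_ < _) _; move: s.
  by move: (cabs _) (cabs _) (d * _) => x y z s; lra.
apply: (le_trans Plow).
rewrite -(Pae _ _ (S_space (lexx 0) h0) h0 (S0E h0)).
apply: (le_trans (step n)); rewrite lerD2r.
by apply: Pbound; exact: S_space.
Qed.

(** The functional is followed from the data to time T. At time T it is bounded
    by the energy, and on the way it loses the residual of the mode times the
    integral of the rate; the other errors vanish when first M and then the
    number of steps tend to infinity. *)
Lemma rate_inequality T : 0 < T ->
  pi ^+ 2 / 4 * k%:R ^+ 2 <=
  (Crate + 1) * G * (KK * T `^ (- g) + rr * (T `^ (1 - g) / (1 - g))).
Proof.
move=> T0; have Crate0 := C0; have gl1 := g1; have C1 : 0 < Crate + 1 by lra.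
have CG : 0 <= (Crate + 1) * G by rewrite mulr_ge0// ltW.
rewrite -lee_fin; apply/lee_addgt0Pr => e e0; rewrite -EFinD lee_fin.
(* A third of e for the remainders of the Euler steps, a third for the first
   term of the Riemann sum and a third for the truncation of the damping. *)
have A0 : 0 < 3 * (T * (KK * (Crate + 1)) + 1).
  by rewrite mulr_gt0// ltr_wpDl// mulr_ge0 ?(ltW T0)// mulr_ge0// ltW.
have B0 : 0 < 3 * ((Crate + 1) * G * rr + 1).
  by rewrite mulr_gt0// ltr_wpDl// mulr_ge0.
have [d0 d00 small] := quot_small (divr_gt0 e0 A0).
pose dm := Num.min d0 (e / (3 * ((Crate + 1) * G * rr + 1))).
have dm0 : 0 < dm by rewrite lt_min d00 divr_gt0.
pose n := Num.bound (T / dm); pose d := T / n.+1%:R.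
have n0 : 0 < n.+1%:R :> R by rewrite ltr0n.
have dp : 0 < d by rewrite divr_gt0.
have ddm : d < dm.
  rewrite /d ltr_pdivrMr// mulrC -ltr_pdivrMr//.
  apply: (lt_le_trans (archi_boundP _)); first by rewrite divr_ge0 ?ltW.
  by rewrite ler_nat.
have [dl dB] : d < d0 /\ d <= e / (3 * ((Crate + 1) * G * rr + 1)).
  by move: ddm; rewrite lt_min => /andP[? /ltW].
have [dD gD] := small d dp dl.
have gD1 : 1 * graph_norm W (quot d) <= e / (3 * (T * (KK * (Crate + 1)) + 1)).
  by rewrite mul1r; exact: gD.
have nd : n.+1%:R * d = T by rewrite /d mulrC divfK// gt_eqF.
pose F := freq * (1 + layer_cst).
have F0 : 0 < F by apply: mulr_gt0; [exact: freq0|apply: addr_gt0 => //; exact: layer_cst_gt0].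
pose X (j : 'I_n.+1) := S (j%:R * d) (data0 k).
have jd (j : 'I_n.+1) : 0 <= j%:R * d by rewrite mulr_ge0// ltW.
have [h0 _ dU _] := g01.
have e' : 0 < e / (3 * (T * F)) by apply: divr_gt0 => //; apply: mulr_gt0 => //; exact: mulr_gt0.
have tails : \forall m \near \oo, forall j : 'I_n.+1, tail m.+1%:R (X j) <= e / (3 * (T * F)).
  apply: filter_forall => j.
  have [hX1 hX2 dX _] := generator_semigroup sgS genS (jd j) g01.
  have [_ [/= [iWr iWi] _]] := damped_laplacianP dX.
  have [ir ii] := L2_rL1 hX1.2.
  have {}iWr : rL1 (fun p => W p * re (X j).2 p) by rewrite -re_scale.
  have {}iWi : rL1 (fun p => W p * im (X j).2 p) by rewrite -im_scale.
  have lr := damp_tail c0 HW ir iWr; have li := damp_tail c0 HW ii iWi.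
  have e4 : 0 < e / (3 * (T * F)) / 4 by rewrite divr_gt0.
  move/cvgrPdist_le : lr => /(_ _ e4) lr; move/cvgrPdist_le : li => /(_ _ e4) li.
  near=> m.
  have q1 : `|0 - tint (fun p => `|(W p - damp beta c m.+1%:R (`|p.1| - pi / 2)) * re (X j).2 p|)|
     <= e / (3 * (T * F)) / 4 by near: m; exact: lr.
  have q2 : `|0 - tint (fun p => `|(W p - damp beta c m.+1%:R (`|p.1| - pi / 2)) * im (X j).2 p|)|
     <= e / (3 * (T * F)) / 4 by near: m; exact: li.
  have ar (x y z : R) : x <= z / 4 -> y <= z / 4 -> 0 < z -> 2 * (x + y) <= z by lra.
  exact: ar (le_of_dist0 q1) (le_of_dist0 q2) e'.
have big : \forall m \near \oo, 2 <= m.+1%:R :> R /\ 4 <= m.+1%:R * width.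
  near=> m; split.
    apply: (@le_trans _ _ m%:R); last by rewrite ler_nat.
    by near: m; exact: nbhs_infty_ger.
  rewrite -ler_pdivrMr ?width_gt0//; apply: (@le_trans _ _ m%:R); last by rewrite ler_nat.
  by near: m; exact: nbhs_infty_ger.
have [m [/= tl [M2 Mw]]] : exists m : nat, (forall j : 'I_n.+1, tail m.+1%:R (X j) <= e / (3 * (T * F))) /\
    (2 <= m.+1%:R :> R /\ 4 <= m.+1%:R * width).
  have [m h] := filter_ex (filterI tails big); by exists m.
have main := euler_sum n.+1 M2 Mw dp; rewrite nd in main.
apply: (le_trans main).
have p1 : KK * Num.sqrt (energy (S T (data0 k))) <= (Crate + 1) * G * (KK * T `^ (- g)).
  have := rate0 (ltW T0) dU; rewrite -/G => h.
  have := ler_wpM2l KK0 h => h'; apply: (le_trans h').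
  have bT := bracket_powRN_le T0 (ltW g0).
  rewrite [leLHS](_ : _ = (Crate + 1) * G * (KK * bracket T `^ (- g))); last by ring.
  by rewrite ler_wpM2l// ler_wpM2l.
have p2 : \sum_(j < n.+1) d * (rr * Num.sqrt (energy (S (j%:R * d) (data0 k))) +
       F * tail m.+1%:R (S (j%:R * d) (data0 k)) +
       KK * Num.sqrt (energy (S (j%:R * d) (quot d)))) <=
   \sum_(j < n.+1) (((Crate + 1) * G * rr) * (d * bracket (j%:R * d) `^ (- g)) +
      d * (e / (3 * T) + KK * ((Crate + 1) * (e / (3 * (T * (KK * (Crate + 1)) + 1)))))).
  apply: ler_sum => j _.
  have r1 := rate0 (jd j) dU; have r2 := rate0 (jd j) dD.
  have b1 := @bracket_powRN_le1 R (j%:R * d) g (ltW g0).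
  have r3 := le_trans r2 (ler_wpM2l (ltW C1) (le_trans (ler_wpM2r (graph_norm_ge0 W _) b1) gD1)).
  have t1 : F * tail m.+1%:R (S (j%:R * d) (data0 k)) <= e / (3 * T).
    have := ler_wpM2l (ltW F0) (tl j); rewrite [F * (e / _)](_ : _ = e / (3 * T)) //.
    by field; rewrite gt_eqF//= gt_eqF.
  have r4 := ler_wpM2l KK0 r3; have r5 := ler_wpM2l rr0 r1.
  rewrite -/G in r5.
  rewrite [leRHS](_ : _ = d * (rr * ((Crate + 1) * (bracket (j%:R * d) `^ (- g) * G)) +
      (e / (3 * T)) + KK * ((Crate + 1) * (e / (3 * (T * (KK * (Crate + 1)) + 1)))))); last by ring.
  by apply: ler_wpM2l; [exact: ltW|apply: lerD => //; exact: lerD].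
have p3 := @sum_bracket R g d n g0 g1 dp.
have CGr : 0 <= (Crate + 1) * G * rr by rewrite mulr_ge0.
have p4 : (n%:R * d) `^ (1 - g) <= T `^ (1 - g).
  apply: ge0_ler_powR; [lra|by rewrite nnegrE mulr_ge0// ltW|by rewrite nnegrE ltW|].
  by rewrite -nd ler_wpM2r ?(ltW dp)// ler_nat.
have p5 : (n%:R * d) `^ (1 - g) / (1 - g) <= T `^ (1 - g) / (1 - g).
  by rewrite ler_pM2r// invr_gt0; lra.
rewrite -/F; apply: (le_trans (lerD p1 p2)).
rewrite big_split /= -mulr_sumr sumr_const card_ord -[(_ * _) *+ n.+1]mulr_natl [n.+1%:R * (d * _)]mulrA nd.
have p6 := ler_wpM2l CGr (le_trans p3 (lerD (lexx d) p5)).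
have p7 : (Crate + 1) * G * rr * d <= e / 3.
  have := ler_wpM2l CGr dB => h; apply: (le_trans h).
  rewrite mulrA ler_pdivrMr//.
  by move: e0; move: ((Crate + 1) * G * rr) => z e0'; lra.
have p8 : T * (e / (3 * T) + KK * ((Crate + 1) * (e / (3 * (T * (KK * (Crate + 1)) + 1))))) <= e / 3 + e / 3.
  rewrite mulrDr; apply: lerD.
    by rewrite [leLHS](_ : _ = e / 3)//; field; rewrite gt_eqF.
  move: A0; move: KK (Crate + 1) => K C' A0'.
  rewrite [leLHS](_ : _ = (T * (K * C')) * e / (3 * (T * (K * C') + 1))); last by ring.
  by rewrite ler_pdivrMr//; move: (T * (K * C')) => z; lra.
move: p6 p7 p8; set q1 := \sum_(_ < _) _; set q2 := _ / (1 - g).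
set q3 := T * (_ + _); set q4 := (Crate + 1) * G.
rewrite !mulrDr => *; lra.
Unshelve. all: by end_near. Qed.

End ObservedMode.

(** * Sharpness of the rate *)

Section Sharpness.
Context {R : realType}.
Implicit Types (W : R * R -> R).

(** Were the rate not sharp, all data in the domain would decay at a rate g with
    (beta + 2) / (beta + 3) < g < 1, and [rate_inequality], divided by k^2,
    would contradict [no_such_rate]. *)
Lemma strip_rate_sharp (beta c : R) W : -1 < beta -> 0 <= c -> strip_damping beta c W ->
  rate_sharp beta W.
Proof.
move=> hb c0 HW S sgS genS C eps C0 e0; apply: contrapT => nex.
pose g0 := (beta + 2) / (beta + 3).
have b2 : 0 < beta + 2 by lra.
have b3 : 0 < beta + 3 by lra.
have g00 : 0 < g0 by rewrite divr_gt0.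
have g01 : g0 < 1 by rewrite ltr_pdivrMr//; lra.
pose g := Num.min (g0 + eps) ((g0 + 1) / 2).
have gg0 : g0 < g by rewrite lt_min; apply/andP; split; lra.
have gle : g <= g0 + eps by rewrite ge_min lexx.
have gle1 : g <= (g0 + 1) / 2 by rewrite ge_min lexx orbT.
have gpos : 0 < g by lra.
have g1 : g < 1 by lra.
have rate t U : 0 < t -> domain W U ->
    Num.sqrt (energy (S t U)) <= C * bracket t `^ (- g) * graph_norm W U.
  move=> t0 dU; rewrite leNgt; apply/negP => bad; apply: nex.
  exists t, U.1, U.2; rewrite -surjective_pairing; split => //.
  apply: le_lt_trans bad; rewrite -/(graph_norm W U).
  apply: ler_wpM2r; first exact: graph_norm_ge0.
  apply: ler_wpM2l; first exact: ltW.
  by apply: ler_powR; [exact: bracket_ge1|rewrite -/g0; lra].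
pose l := layer_cst beta.
have l0 : 0 < l by exact: layer_cst_gt0.
have pi0 := pi_gt0 R.
have p0 : 0 < 1 - g by lra.
have ip0 : 0 <= (1 - g)^-1 by rewrite invr_ge0 ltW.
pose kap := (beta + 2)^-1.
have kap0 : 0 < kap by rewrite invr_gt0.
pose A := (C + 1) * (70 * pi) * (16 * pi) * (4 * (1 + l) + l / (1 - g)).
have A0 : 0 < A.
  by rewrite /A !mulr_gt0//; first lra; rewrite addr_gt0// ?mulr_gt0 ?invr_gt0//; lra.
have gk : 1 < g * (1 + kap).
  have -> : 1 + kap = g0^-1 by rewrite /kap /g0; field; rewrite !gt_eqF.
  by rewrite ltr_pdivlMr// mul1r.
have cc : 0 < pi ^+ 2 / 4 :> R by rewrite divr_gt0// exprn_gt0.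
apply: (no_such_rate A0 cc kap0 gpos g1 gk) => k T k1 T0.
have k0 : 0 < k%:R :> R by rewrite ltr0n.
have kR : 1 <= k%:R :> R by rewrite ler1n.
have main := rate_inequality hb c0 HW k1 sgS genS C0 gpos g1 rate T0.
have k2 : 0 < k%:R ^+ 2 :> R by rewrite exprn_gt0.
rewrite -(ler_pM2r k2); apply: (le_trans main).
have G := graph_norm_data0 W k1.
have x0 : 0 <= T `^ (- g) by exact: powR_ge0.
have y0 : 0 <= T `^ (1 - g) by exact: powR_ge0.
have z0 : 0 <= k%:R `^ (- kap) :> R by exact: powR_ge0.
have fr := @freq_le R k; have wi := width_le hb k1; have w0 := width_gt0 beta k1.
rewrite -/kap in wi.
have fr0 := @freq_ge1 R k k1.
have h1 : 16 * pi * (1 + l) * (1 + k%:R + freq k) * T `^ (- g) <=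
    16 * pi * (4 * (1 + l) * (k%:R * T `^ (- g))).
  rewrite [leRHS](_ : _ = 16 * pi * (1 + l) * (4 * k%:R) * T `^ (- g)); last by ring.
  apply: ler_wpM2r => //; apply: ler_wpM2l; last by lra.
  by rewrite !mulr_ge0//; lra.
have h2 : l * width beta k * (16 * pi) * (T `^ (1 - g) / (1 - g)) <=
    16 * pi * (l / (1 - g) * (k%:R `^ (- kap) * T `^ (1 - g))).
  rewrite [leRHS](_ : _ = l * k%:R `^ (- kap) * (16 * pi) * (T `^ (1 - g) / (1 - g))); last by ring.
  apply: ler_wpM2r; first by rewrite mulr_ge0.
  apply: ler_wpM2r; first by rewrite mulr_ge0// ltW.
  by apply: ler_wpM2l => //; exact: ltW.
have C1 : 0 <= C + 1 by lra.
have s0 : 0 <= 16 * pi * (1 + l) * (1 + k%:R + freq k) * T `^ (- g) +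
    l * width beta k * (16 * pi) * (T `^ (1 - g) / (1 - g)).
  have f1 : 0 <= 16 * pi * (1 + l) * (1 + k%:R + freq k).
    by apply: mulr_ge0; [apply: mulr_ge0; lra|lra].
  have f2 : 0 <= l * width beta k * (16 * pi).
    by apply: mulr_ge0; [apply: mulr_ge0; exact: ltW|lra].
  exact: addr_ge0 (mulr_ge0 f1 x0) (mulr_ge0 f2 (mulr_ge0 y0 ip0)).
have h3 := ler_wpM2l C1 G.
apply: (le_trans (ler_wpM2r s0 h3)).
have q0 : 0 <= (C + 1) * (70 * pi * k%:R ^+ 2) by rewrite !mulr_ge0// ltW.
apply: (le_trans (ler_wpM2l q0 (lerD h1 h2))).
rewrite [leRHS](_ : _ = (C + 1) * (70 * pi * k%:R ^+ 2) * (16 * pi *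
   ((4 * (1 + l) + l / (1 - g)) * (k%:R * T `^ (- g) + k%:R `^ (- kap) * T `^ (1 - g))))); last by rewrite /A; ring.
rewrite -mulrDr; apply: ler_wpM2l => //; apply: ler_wpM2l; first by rewrite mulr_ge0// ltW.
have u0 : 0 <= k%:R * T `^ (- g) by rewrite mulr_ge0// ltW.
have v0 : 0 <= k%:R `^ (- kap) * T `^ (1 - g) by rewrite mulr_ge0.
have l1 : 0 <= l / (1 - g) by rewrite mulr_ge0// ltW.
have l2 : 0 <= 4 * (1 + l) by lra.
have ar (a b u v : R) : 0 <= a * u -> 0 <= b * v -> b * u + a * v <= (b + a) * (u + v) by lra.
exact: ar (mulr_ge0 l1 u0) (mulr_ge0 l2 v0).
Qed.

Lemma wrap_id (x : R) : - pi <= x < pi -> Defs.wrap x = x.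
Proof.
move=> /andP[h1 h2]; have pi0 := pi_gt0 R.
rewrite /Defs.wrap (_ : Num.floor _ = 0) ?mulr0 ?subr0//.
apply: floor_def; rewrite mulr0z add0r.
by rewrite divr_ge0 ?ltr_pdivrMr//=; lra.
Qed.

Lemma wrap_shift (x : R) : Defs.wrap (x + 2 * pi) = Defs.wrap x.
Proof.
have pi0 := pi_gt0 R; have p2 : 2 * pi != 0 :> R by rewrite gt_eqF// mulr_gt0.
rewrite /Defs.wrap; set y := (x + pi) / (2 * pi).
have -> : (x + 2 * pi + pi) / (2 * pi) = y + 1.
  by rewrite /y -[X in _ = _ + X](mulfV p2) -mulrDl addrAC.
have -> : Num.floor (y + 1) = (Num.floor y + 1)%R.
  apply: floor_def; have /andP[h1 h2] := floor_itv y.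
  by rewrite !intrD; apply/andP; split; [lra|move: h2; rewrite intrD; lra].
by rewrite intrD; ring.
Qed.

Lemma measurable_wrap : measurable_fun setT (@Defs.wrap R).
Proof.
have pi0 := pi_gt0 R.
apply: measurable_funB => //.
apply: measurable_funM => //.
apply: nondecreasing_measurable => // x y xy.
rewrite ler_int; apply: le_floor; rewrite ler_pM2r ?invr_gt0 ?mulr_gt0//.
by rewrite lerD2r.
Qed.

Definition explicit_profile (beta x : R) : R :=
  if pi / 2 <= `|Defs.wrap x| then (`|Defs.wrap x| - pi / 2) `^ beta + 1 else 0.

Let measurable_dist : measurable_fun setT (fun x : R => `|Defs.wrap x| - pi / 2).
Proof.
apply: measurable_funB => //.
by apply: measurableT_comp => //; exact: measurable_wrap.
Qed.

Let measurable_pow (beta : R) :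
  measurable_fun setT (fun x : R => (`|Defs.wrap x| - pi / 2) `^ beta).
Proof. exact: (measurableT_comp (measurable_powR beta) measurable_dist). Qed.

Let measurable_abs : measurable_fun setT (fun x : R => `|Defs.wrap x|).
Proof. by apply: measurableT_comp => //; exact: measurable_wrap. Qed.

Lemma explicit_controlled (beta : R) : beta < 0 ->
  polynomially_controlled beta 0 (explicit_profile beta).
Proof.
move=> b0; have pih := @pihalf_gt0 R; have pi0 := pi_gt0 R; split.
- apply: measurable_fun_ifT => //.
    by apply: measurable_fun_ler => //; exact: measurable_abs.
  by apply: measurable_funD => //; exact: measurable_pow.
- by move=> x; rewrite /explicit_profile wrap_shift.
pose D := (pi / 2 : R) `^ (- beta).
have D0 : 0 < D by exact: powR_gt0.
have D1 : 1 <= 1 + D by lra.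
exists (1 + D), (pi / 2); split; try lra.
(* On the edge the damping is 1 whereas Vctrl is 0. *)
exists [set pi / 2; - (pi / 2)]; split.
- by apply: measurableU; exact: measurable_set1.
- apply: countable_lebesgue_measure0; apply: finite_set_countable.
  by rewrite finite_setU; split; exact: finite_set1.
move=> x /= nh; apply: contrapT => nx; apply: nh => hx; rewrite add0r /explicit_profile wrap_id//.
have [h|h] := leP (pi / 2) `|x|; last first.
  by rewrite /Vctrl (ltW h) !mulr0 lexx.
have hn : `|x| != pi / 2.
  apply/negP => /eqP e; apply: nx.
  have [x0|x0] := leP 0 x; first by left; rewrite -e ger0_norm.
  by right; rewrite -e ltr0_norm// opprK.
have s0 : 0 < `|x| - pi / 2 by rewrite subr_gt0 lt_neqAle eq_sym hn.
have xpi : `|x| <= pi by move: hx => /andP[h1 h2]; rewrite ler_norml h1 ltW.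
have xs : (`|x| <= pi / 2) = false by apply/negbTE; rewrite -ltNge -subr_gt0.
rewrite /Vctrl xs.
(* The summand 1 is absorbed by the power, which is at least (pi / 2) ^ beta. *)
have V1 : 1 <= D * (`|x| - pi / 2) `^ beta.
  have : (pi / 2 : R) `^ beta <= (`|x| - pi / 2) `^ beta.
    have := @powRN_le R (`|x| - pi / 2) (pi / 2) (- beta) s0 ltac:(lra) ltac:(lra).
    by rewrite opprK.
  by rewrite /D powRN ler_pdivlMl ?powR_gt0// mulr1.
have V0 := powR_ge0 (`|x| - pi / 2) beta.
apply/andP; split.
  apply: (@le_trans _ _ ((`|x| - pi / 2) `^ beta)); last by rewrite lerDl.
  by rewrite ler_piMl// invf_le1//; lra.
by move: V1; move: (_ `^ beta) => v V1; rewrite (mulrDl 1 D v) mul1r lerD2l.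
Qed.

Lemma Vctrl_controlled (beta : R) :
  polynomially_controlled beta 0 (fun x => Vctrl beta (pi / 2) (Defs.wrap x)).
Proof.
have pih := @pihalf_gt0 R; have pi0 := pi_gt0 R; split.
- apply: measurable_fun_ifT; [|exact: measurable_cst|exact: (measurable_pow beta)].
  by apply: measurable_fun_ler => //; exact: measurable_abs.
- by move=> x; rewrite wrap_shift.
exists 1, (pi / 2); split; try lra.
by apply: aeW => x hx; rewrite add0r wrap_id// invr1 !mul1r lexx.
Qed.

Lemma one_strip_class (beta : R) (w : R -> R) W :
  polynomially_controlled beta 0 w -> (forall p, W p = w p.1) -> damping_class beta W.
Proof.
move=> hw WE; exists 0%N, (fun=> 0), (fun=> w); split => // p.
by rewrite big_ord1 WE.
Qed.

Let wrap_torus (p : R * R) : torus p -> Defs.wrap p.1 = p.1.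
Proof. by case=> /=; rewrite in_itv /= => h _; exact: wrap_id. Qed.

Lemma explicit_strip (beta : R) : strip_damping beta 1 (explicit_damping beta).
Proof.
move=> p Tp; rewrite /explicit_damping wrap_torus//; split.
- by case: ifP => // _; rewrite addr_ge0// powR_ge0.
- by rewrite ltNge => /negbTE ->.
- by move=> /ltW ->.
Qed.

Lemma Vctrl_strip (beta : R) : strip_damping beta 0 (fun p => Vctrl beta (pi / 2) (Defs.wrap p.1)).
Proof.
move=> p Tp; rewrite /Vctrl wrap_torus//; split.
- by case: ifP => // _; exact: powR_ge0.
- by move=> /ltW ->.
- by rewrite ltNge => /negbTE ->; rewrite /om addr0.
Qed.

End Sharpness.

Theorem theorem2 (R : realType) (beta : R) (hbeta : -1 < beta) :
  (exists W : R * R -> R, damping_class beta W /\ rate_sharp beta W) /\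
  (beta < 0 ->
     damping_class beta (explicit_damping beta) /\
     rate_sharp beta (explicit_damping beta)).
Proof.
split.
  exists (fun p => Vctrl beta (pi / 2) (Defs.wrap p.1)); split.
    exact: one_strip_class (Vctrl_controlled beta) _.
  exact: (strip_rate_sharp hbeta (lexx 0) (@Vctrl_strip R beta)).
move=> b0; split.
  exact: one_strip_class (explicit_controlled b0) _.
exact: (strip_rate_sharp hbeta ler01 (@explicit_strip R beta)).
Qed.
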